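(* Let $\mathfrak g$ be a finite dimensional semisimple Lie algebra over $\mathbb C$ and let $e\in\mathfrak g$ be nilpotent. Given any two good gradings $\Gamma$ and $\Gamma'$ for $e$, there exists a chain $\Gamma_1,\dots,\Gamma_n$ of good gradings for $e$ such that $\Gamma$ is conjugate to $\Gamma_1$, $\Gamma_i$ is adjacent to $\Gamma_{i+1}$ for each $i=1,\dots,n-1$, and $\Gamma_n$ is conjugate to $\Gamma'$.
   Context: An $\mathbb R$-grading of $\mathfrak g$ is a decomposition $\mathfrak g=\bigoplus_{j\in\mathbb R}\mathfrak g_j$ with $[\mathfrak g_i,\mathfrak g_j]\subseteq\mathfrak g_{i+j}$. It is a good grading for $e$ if $e\in\mathfrak g_2$ and the linear map $\operatorname{ad} e:\mathfrak g_j\to\mathfrak g_{j+2}$ is injective for all $j\le -1$ and surjective for all $j\ge -1$. Two good gradings $\Gamma:\mathfrak g=\bigoplus_{i\in\mathbb R}\mathfrak g_i$ and $\Gamma':\mathfrak g=\bigoplus_{j\in\mathbb R}\mathfrak g'_j$ for $e$ are adjacent if $$\mathfrak g=\bigoplus_{i^-\le j\le i^+}\mathfrak g_i\cap\mathfrak g'_j$$ (sum over pairs of real numbers $i,j$ with $i^-\le j\le i^+$), where $i^-$ denotes the largest integer strictly smaller than $i$ and $i^+$ the smallest integer strictly greater than $i$. Let $G$ be a connected semisimple algebraic group over $\mathbb C$ with Lie algebra $\mathfrak g$, acting on $\mathfrak g$ by the adjoint action. Two gradings are conjugate if some $x\in G$ maps the degree $j$ piece of the first onto the degree $j$ piece of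 the second, for every $j\in\mathbb R$. *)

(* Defs.v *)
From HB Require Import structures.
From mathcomp Require Import all_boot all_order all_algebra.
From mathcomp Require Import classical_sets reals complex.
From mathcomp Require mpoly.

Set Implicit Arguments.
Unset Strict Implicit.
Unset Printing Implicit Defensive.

Import Order.TTheory GRing.Theory Num.Theory.
Local Open Scope classical_set_scope.
Local Open Scope ring_scope.

(* Finite dimensionality is part of the Vector structure. *)
HB.mixin Record isLieAlgebra (K : fieldType) (L : Type) of Vector K L := {
  lie : L -> L -> L;
  lieDZl : forall (a : K) (x y z : L),
    lie (a *: x + y) z = a *: lie x z + lie y z;
  lieDZr : forall (a : K) (x y z : L),
    lie z (a *: x + y) = a *: lie z x + lie z y;
  liexx : forall x : L, lie x x = 0;
  lie_jacobi : forall x y z : L,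
    lie x (lie y z) + lie y (lie z x) + lie z (lie x y) = 0
}.

#[short(type="lieAlgType")]
HB.structure Definition LieAlgebra (K : fieldType) :=
  {L of Vector K L & isLieAlgebra K L}.

Section LieAlgebras.
Variables (K : fieldType) (L : lieAlgType K).
Implicit Types (U V I : {vspace L}) (e x y : L).

Definition lie_span U V : {vspace L} :=
  <<[seq lie x y | x <- vbasis U, y <- vbasis V]>>%VS.

Definition lie_ideal I : Prop := forall x y, y \in I -> lie x y \in I.

Definition lie_solvable I : Prop :=
  exists k : nat, iter k (fun U => lie_span U U) I = 0%VS.

Definition lie_semisimple : Prop :=
  forall I, lie_ideal I -> lie_solvable I -> I = 0%VS.

Definition lie_nilpotent e : Prop :=
  exists k : nat, forall x, iter k (lie e) x = 0.

End LieAlgebras.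

Arguments lie_semisimple {K} L.

(* L is the internal direct sum of the V i over the possibly infinitely many
   indices i with P i: every finite subfamily is independent, and every vector
   lies in the sum of a finite subfamily. *)
Definition is_direct_sum (K : fieldType) (L : vectType K) (I : choiceType)
    (P : pred I) (V : I -> {vspace L}) : Prop :=
  (forall s : seq I, uniq s -> directv (\sum_(i <- s | P i) V i)) /\
  (forall x : L, exists s : seq I, x \in (\sum_(i <- s | P i) V i)%VS).

(* The largest integer < x and the smallest integer > x. *)
Definition int_below (R : realType) (x : R) : R := (Num.ceil x - 1)%:~R.
Definition int_above (R : realType) (x : R) : R := (Num.floor x + 1)%:~R.

Lemma int_belowP (R : realType) (x : R) :
  int_below x < x /\ forall m : int, m%:~R < x -> m%:~R <= int_below x.
Proof.
split=> [|m]; first exact: ceilB1_lt.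
by rewrite -ceil_gt_int ler_int -ltzD1 subrK.
Qed.

Lemma int_aboveP (R : realType) (x : R) :
  x < int_above x /\ forall m : int, x < m%:~R -> int_above x <= m%:~R.
Proof.
split=> [|m]; first by case/andP: (floor_itv x).
by rewrite -floor_lt_int ler_int lezD1.
Qed.

Section Gradings.
Variables (R : realType) (K : fieldType) (L : lieAlgType K).
Implicit Types (Gamma : R -> {vspace L}) (e : L).

Definition is_grading Gamma : Prop :=
  is_direct_sum predT Gamma /\
  (forall (i j : R) (x y : L),
     x \in Gamma i -> y \in Gamma j -> lie x y \in Gamma (i + j)).

Definition good_grading e Gamma : Prop :=
  [/\ is_grading Gamma,
      e \in Gamma 2,
      (forall j : R, j <= -1 ->
         {in Gamma j &, injective (lie e)}) &
      (forall j : R, -1 <= j ->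
         forall y, y \in Gamma (j + 2) ->
           exists2 x, x \in Gamma j & lie e x = y)].

Definition adjacent Gamma Gamma' : Prop :=
  is_direct_sum
    (fun ij : R * R => int_below ij.1 <= ij.2 <= int_above ij.1)
    (fun ij : R * R => (Gamma ij.1 :&: Gamma' ij.2)%VS).

End Gradings.

(* Linear algebraic groups over an algebraically closed field, identified with
   the set of their points, as Zariski closed subgroups of GL_n. *)
Section AlgebraicGroups.
Variables (C : closedFieldType) (n : nat).
Implicit Types (G H Z S : set 'M[C]_n) (X A B : 'M[C]_n).

Definition mxpolyfun := mpoly.mpoly (n * n) C.

Definition mxeval (p : mxpolyfun) A : C :=
  mpoly.meval (fun k => mxvec A 0 k) p.

(* The differential of p at the identity matrix, in the direction X. *)
Definition mxdiff1 (p : mxpolyfun) X : C :=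
  \sum_(k < n * n) mxeval (mpoly.mderiv k p) 1%:M * mxvec X 0 k.

(* Closed for the topology induced on GL_n, whose closed subsets are already cut
   out by polynomials in the matrix entries, without 1/det. *)
Definition zariski_closed Z : Prop :=
  exists E : set mxpolyfun,
    Z = [set A | A \in unitmx /\ forall p, E p -> mxeval p A = 0].

Definition closed_subgroup G : Prop :=
  [/\ zariski_closed G,
      G 1%:M,
      (forall A B, G A -> G B -> G (A *m B)) &
      (forall A, G A -> G (invmx A))].

Definition zariski_connected G : Prop :=
  forall Z1 Z2, zariski_closed Z1 -> zariski_closed Z2 ->
    G = Z1 `|` Z2 -> Z1 `&` Z2 = set0 -> Z1 = set0 \/ Z2 = set0.

(* Closed under inverses when H is a group, since the inverse of a commutator is
   a commutator. *)
Inductive derived_subgroup H : 'M[C]_n -> Prop :=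
| derived1 : derived_subgroup H 1%:M
| derivedR A B : H A -> H B ->
    derived_subgroup H (A *m B *m invmx A *m invmx B)
| derivedM A B : derived_subgroup H A -> derived_subgroup H B ->
    derived_subgroup H (A *m B).

Definition group_solvable H : Prop :=
  exists k : nat, iter k derived_subgroup H `<=` [set 1%:M].

Definition normal_in H G : Prop :=
  H `<=` G /\ forall A B, G A -> H B -> H (A *m B *m invmx A).

(* Connected with trivial radical. *)
Definition connected_semisimple_group G : Prop :=
  [/\ closed_subgroup G,
      zariski_connected G &
      forall H, closed_subgroup H -> zariski_connected H ->
        normal_in H G -> group_solvable H -> H = [set 1%:M]].

(* The tangent space of G at the identity, as a subspace of gl_n. *)
Definition tangent1 G : set 'M[C]_n :=
  [set X | forall p : mxpolyfun,
     (forall A, G A -> mxeval p A = 0) -> mxdiff1 p X = 0].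

Section Adjoint.
Variable L : lieAlgType C.

(* phi identifies the Lie algebra L with Lie(G). *)
Definition lie_algebra_of G (phi : 'Hom(L, 'M[C]_n)) : Prop :=
  [/\ forall x y : L, phi (lie x y) = phi x *m phi y - phi y *m phi x,
      injective phi &
      forall X, X \in limg phi <-> tangent1 G X].

(* The adjoint action y |-> A y A^-1, transported from Lie(G) to L. *)
Definition Ad (phi : 'Hom(L, 'M[C]_n)) A : 'End(L) :=
  (phi^-1 \o linfun (mulmx A \o mulmxr (invmx A)) \o phi)%VF.

Definition conjugate (R : realType) G (phi : 'Hom(L, 'M[C]_n))
    (Gamma Gamma' : R -> {vspace L}) : Prop :=
  exists2 A, G A & forall j : R, (Ad phi A @: Gamma j)%VS = Gamma' j.

End Adjoint.
End AlgebraicGroups.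

(* Main.v *)
(* Since the Killing form is nondegenerate, derivations are inner, so a grading
   consists of the eigenspaces of ad h for some h. Let h and h' be the elements
   attached to the two good gradings.

   Goodness yields sl2-triples (e, h0, f) and (e, h0', f') with h0 in degree 0
   for h and h0' in degree 0 for h'. The difference h0' - h0 lies in the
   centralizer of e and in positive h0-degrees, so exponentials of centralizer
   elements allow one to assume h0' = h0. Then h - h0 and h' - h0 lie in the
   centralizer c of the triple, on which the Killing form is nondegenerate. If
   q, q' are the nonnegative parts of c for the two gradings and u, u' the
   positive parts, orthogonality shows that h - h0 lies in u + (q :&: q'), and
   likewise h' - h0 in u' + (q :&: q'). Removing the components in u and u' by
   exponentials, and then one more component in u :&: u', makes h and h' commute.
   This replaces the conjugacy of maximal tori.

   For commuting h and h', goodness for (1 - t) h + t h' follows from the joint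
   eigenspace decomposition, because a convex combination that is <= -1 (resp.
   >= 1) has a term that is <= -1 (resp. >= 1). Between two consecutive times at
   which a joint weight becomes an integer no weight crosses an integer, so the
   gradings at these times form the chain.

   The exponential of a nilpotent X tangent to G lies in G: if p vanishes on G,
   then t |-> p (exp (t X)) is a polynomial all of whose derivatives vanish at 0. *)

Require Import Defs.
From HB Require Import structures.
From mathcomp Require Import all_boot all_order all_algebra.
From mathcomp Require Import boolp classical_sets reals complex.
From mathcomp Require Import zify ring.
From mathcomp Require mpoly.

Set Implicit Arguments.
Unset Strict Implicit.
Unset Printing Implicit Defensive.

Import Order.TTheory GRing.Theory Num.Theory.
Import passmx.
Import (canonicals) mpoly.
Local Open Scope ring_scope.

(** Exponentials are taken only of eigenvectors [n] of some [ad h] with nonzero eigenvalue [a]. The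
    powers [phi n ^+ k] are then eigenvectors for the distinct values [k a], which makes [phi n] a
    nilpotent matrix and not merely an ad-nilpotent one. This is why corrections are removed one
    homogeneous component at a time. All exponents centralize [e], so goodness is always transported
    for the same [e].

    A triple adapted to a good grading exists once [e] lies in the image of [(ad e)^2]. By Killing
    duality this is orthogonality of [e] to the kernel of [(ad e)^2], which follows because [[e, v]]
    is ad-nilpotent for [v] in that kernel.

    Membership of [h - h0] in [u + (q :&: q')] is what a maximal torus common to two parabolic
    subalgebras would give. Here it comes from a trace computation: [tr (ad h \o ad y) = 0] for [y]
    ad-nilpotent and of nonnegative degrees for [h]. *)

Lemma sum_seq_single (V : nmodType) (I : eqType) (s : seq I) (i : I) (c : I -> V) :
  uniq s -> i \in s -> (forall j, j \in s -> j != i -> c j = 0) ->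
  \sum_(j <- s) c j = c i.
Proof.
move=> us si c0; rewrite (bigD1_seq i) //= big1_seq ?addr0 // => j /andP[ji sj].
exact: c0.
Qed.

(** * Joint eigenvectors and finite sums of subspaces *)

Section Separation.
Variables (K : fieldType) (V : vectType K).
Implicit Types (U : {vspace V}) (T : 'End(V)).

Definition stable T U := forall x, x \in U -> T x \in U.

(* Taking [U = 0] gives the independence of joint eigenvectors. *)
Lemma joint_eigen_mem (I : eqType) (s : seq I) U (v : I -> V) :
  uniq s ->
  (forall i k, i \in s -> k \in s -> i != k ->
     exists T (l : I -> K),
       [/\ stable T U, forall j, j \in s -> T (v j) = l j *: v j & l i != l k]) ->
  \sum_(j <- s) v j \in U -> forall i, i \in s -> v i \in U.
Proof.
have [n le_sn] := ubnP (size s); elim: n s v le_sn => // n IHn s v le_sn uniq_s.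
move=> sep sumU i si; case: (boolP (all (pred1 i) s)) => [all_i|/allPn[k ks nki]].
  have eq_s : perm_eq s [:: i].
    apply: uniq_perm => // j; rewrite inE.
    by apply/idP/eqP => [/(allP all_i)/eqP|->].
  by move: sumU; rewrite (perm_big _ eq_s) big_seq1.
have ik : i != k by rewrite eq_sym.
have [T [l [TU Tv lik]]] := sep i k si ks ik.
have uk : uniq (rem k s) by rewrite rem_uniq.
(* [T - l k] kills the [k]-th term and multiplies the [i]-th one by [l i - l k], which is
   nonzero. *)
have sumT : \sum_(j <- rem k s) (l j - l k) *: v j \in U.
  have <- : T (\sum_(j <- s) v j) - l k *: (\sum_(j <- s) v j) =
            \sum_(j <- rem k s) (l j - l k) *: v j.
    rewrite linear_sum scaler_sumr -sumrB (big_rem k) //=.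
    rewrite Tv // subrr add0r !big_seq; apply: eq_bigr => j /mem_rem sj.
    by rewrite Tv // scalerBl.
  by rewrite rpredB ?rpredZ // TU.
have si' : i \in rem k s by rewrite mem_rem_uniq // inE ik.
have lt_n : (size (rem k s) < n)%N.
  by rewrite size_rem //; case: (s) ks le_sn.
have := IHn (rem k s) (fun j => (l j - l k) *: v j) lt_n uk _ sumT i si'.
move=> H.
have {}H : (l i - l k) *: v i \in U.
  apply: H => a b /mem_rem sa /mem_rem sb ab.
  have [T' [l' [T'U T'v l'ab]]] := sep a b sa sb ab.
  exists T', l'; split=> // j /mem_rem sj.
  by rewrite linearZ /= T'v // !scalerA mulrC.
have := rpredZ (l i - l k)^-1 H.
by rewrite scalerA mulVf ?scale1r // subr_eq0.
Qed.

Lemma memv_sum_seq (I : eqType) (s : seq I) (W : I -> {vspace V}) x :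
  uniq s -> x \in (\sum_(i <- s) W i)%VS ->
  exists2 c : I -> V, (forall i, c i \in W i) & x = \sum_(i <- s) c i.
Proof.
elim: s x => [|k s IHs] x /=.
  by rewrite big_nil memv0 => _ /eqP->; exists (fun=> 0) => [i|]; rewrite ?mem0v ?big_nil.
case/andP=> nks /IHs{}IHs; rewrite big_cons => /memv_addP[u uW [w /IHs[c cW ->] ->]].
exists (fun i => if i == k then u else c i) => [i|]; first by case: eqP => [->|].
rewrite big_cons eqxx; congr (_ + _); rewrite !big_seq; apply: eq_bigr => i si.
by case: eqP => // eik; rewrite -eik si in nks.
Qed.

Lemma memv_sum_seqr (I : eqType) (s : seq I) (P : pred I) (W : I -> {vspace V})
    (c : I -> V) :
  (forall i, i \in s -> P i -> c i \in W i) ->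
  \sum_(i <- s | P i) c i \in (\sum_(i <- s | P i) W i)%VS.
Proof.
elim: s => [|k s IHs] cW; first by rewrite !big_nil mem0v.
have {}IHs : \sum_(i <- s | P i) c i \in (\sum_(i <- s | P i) W i)%VS.
  by apply: IHs => i si; apply: cW; rewrite inE si orbT.
by rewrite !big_cons; case: ifP => // Pk; rewrite memv_add ?cW ?mem_head.
Qed.

Lemma sumv_seq_sup (I : eqType) (s : seq I) (P : pred I) (W : I -> {vspace V}) i :
  i \in s -> P i -> (W i <= \sum_(j <- s | P j) W j)%VS.
Proof.
move=> si Pi; rewrite (big_rem i) //= Pi; exact: addvSl.
Qed.

Lemma subv_sum_seq (I : eqType) (s : seq I) (P : pred I) (W : I -> {vspace V}) U :
  (forall i, i \in s -> P i -> (W i <= U)%VS) ->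
  (\sum_(i <- s | P i) W i <= U)%VS.
Proof.
move=> WU; rewrite big_seq_cond; elim/big_rec: _ => [|i S /andP[si Pi] SU].
  exact: sub0v.
by rewrite subv_add WU.
Qed.

Lemma sumv_undup (I : eqType) (s : seq I) (P : pred I) (W : I -> {vspace V}) :
  (\sum_(i <- undup s | P i) W i = \sum_(i <- s | P i) W i)%VS.
Proof. by rewrite big_undup //; exact: addvv. Qed.

Lemma daddv_pi0 U W x : (U :&: W = 0)%VS -> x \in W -> daddv_pi U W x = 0.
Proof.
move=> UW xW; have := daddv_pi_add UW (subvP (addvSr U W) x xW).
rewrite (daddv_pi_id _ xW) 1?capvC // => /eqP.
by rewrite -subr_eq0 addrK => /eqP.
Qed.

Lemma directv_seq (I : eqType) (s : seq I) (P : pred I) (W : I -> {vspace V}) :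
  uniq s ->
  (forall v : I -> V, (forall i, v i \in W i) ->
     forall s', uniq s' -> \sum_(i <- s') v i = 0 -> forall i, i \in s' -> v i = 0) ->
  directv (\sum_(i <- s | P i) W i).
Proof.
move=> us indep; apply/directvP => /=; rewrite -[in LHS]big_filter -[in RHS]big_filter.
move: (filter P s) (filter_uniq P us) => {us}s us.
elim: s us => [|k s IHs] /=; first by rewrite !big_nil dimv0.
case/andP=> nks us; rewrite !big_cons dimv_disjoint_sum ?IHs //.
apply/eqP; rewrite -subv0; apply/subvP=> x /memv_capP[xk /(memv_sum_seq us)[c cW def_x]].
pose v i := if i == k then - x else c i.
have vW i : v i \in W i by rewrite /v; case: eqP => [->|_]; rewrite ?rpredN.
have uks : uniq (k :: s) by rewrite /= nks.
have sum0 : \sum_(i <- k :: s) v i = 0.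
  rewrite big_cons {1}/v eqxx def_x; apply/eqP; rewrite addrC subr_eq0; apply/eqP.
  rewrite !big_seq; apply: eq_bigr => i si; rewrite /v.
  by case: eqP => // eik; rewrite -eik si in nks.
have := indep v vW _ uks sum0 k (mem_head _ _).
by rewrite /v eqxx memv0 => /eqP; rewrite oppr_eq0.
Qed.

Lemma directv_seq_cap (I : eqType) (k : I) (s : seq I) (W : I -> {vspace V}) :
  directv (\sum_(i <- k :: s) W i) -> (W k :&: \sum_(i <- s) W i = 0)%VS.
Proof.
move/directvP=> /=; rewrite !big_cons => dim_eq.
apply/eqP; rewrite -dimv_eq0 -leqn0 -(leq_add2l (\dim (W k + \sum_(i <- s) W i))).
rewrite dimv_sum_cap addn0 dim_eq leq_add2l.
elim: (s) => [|j r IHr]; first by rewrite !big_nil dimv0.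
by rewrite !big_cons (leq_trans (dimv_add_leqif _ _)) // leq_add2l.
Qed.

Lemma stable_inj_surj T U :
  stable T U -> (forall x, x \in U -> T x = 0 -> x = 0) ->
  forall y, y \in U -> exists2 x, x \in U & T x = y.
Proof.
move=> TU injT y Uy; suff /memv_imgP[x Ux ->] : y \in (T @: U)%VS by exists x.
suff -> : (T @: U = U)%VS by [].
apply/eqP; rewrite eqEdim; apply/andP; split.
  by apply/subvP=> _ /memv_imgP[x Ux ->]; apply: TU.
rewrite limg_dim_eq //; apply/eqP; rewrite -subv0; apply/subvP=> x.
by case/memv_capP=> Ux; rewrite memv_ker memv0 => /eqP/(injT _ Ux)->.
Qed.

End Separation.

Lemma memv_capl (K : fieldType) (V : vectType K) (U W : {vspace V}) x :
  x \in (U :&: W)%VS -> x \in U.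
Proof. by case/memv_capP. Qed.

Lemma memv_capr (K : fieldType) (V : vectType K) (U W : {vspace V}) x :
  x \in (U :&: W)%VS -> x \in W.
Proof. by case/memv_capP. Qed.

(** * Traces and nilpotent operators *)

Section Trace.
Variables (K : fieldType) (V : vectType K).
Implicit Types (f g : 'End(V)).

Definition ltr f : K := \tr (mxof (vbasis {:V}) (vbasis {:V}) f).

Fact ltr_is_scalar : scalar ltr.
Proof. by move=> a f g; rewrite /ltr linearP raddfD /= linearZ. Qed.
HB.instance Definition _ := GRing.isLinear.Build K 'End(V) K _ ltr ltr_is_scalar.

Lemma ltr_comp f g : ltr (f \o g)%VF = ltr (g \o f)%VF.
Proof.
by rewrite /ltr !(mxof_comp _ _ (vbasisP _)) mxtrace_mulC.
Qed.

Definition lnilp (f : V -> V) := exists k, forall x, iter k f x = 0.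

Lemma iter_le0 (f : V -> V) k m x :
  (k <= m)%N -> f 0 = 0 -> iter k f x = 0 -> iter m f x = 0.
Proof.
move=> /subnK <- f0; rewrite iterD => ->.
by elim: (m - k)%N => //= n ->.
Qed.

Lemma iter_lfun0 f k : iter k f 0 = 0.
Proof. by elim: k => //= k ->; rewrite linear0. Qed.

Lemma iter_lfunD f k (x y : V) : iter k f (x + y) = iter k f x + iter k f y.
Proof. by elim: k => //= k ->; rewrite linearD. Qed.

Lemma iter_lfunZ f k a x : iter k f (a *: x) = a *: iter k f x.
Proof. by elim: k => //= k ->; rewrite linearZ. Qed.

Lemma iter_lfun_sum f k I (s : seq I) (x : I -> V) :
  iter k f (\sum_(i <- s) x i) = \sum_(i <- s) iter k f (x i).
Proof.
elim: s => [|i s IHs]; first by rewrite !big_nil iter_lfun0.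
by rewrite !big_cons iter_lfunD IHs.
Qed.

(** The orbit of [x] under [f] ends at 0, and its last vector outside [U] is the one sought. In
    Engel's theorem it provides a vector annihilated modulo [U]. *)
Lemma nilp_last (f : V -> V) (P : V -> Prop) (U : {vspace V}) x :
  lnilp f -> (forall y, P y -> P (f y)) -> P x -> x \notin U ->
  exists y, [/\ P y, y \notin U & f y \in U].
Proof.
case=> k nilf fP; have: iter k f x \in U by rewrite nilf mem0v.
elim: k x {nilf} => [|k IHk] x /=; first by move=> ->.
rewrite -iterS iterSr => fkU Px nUx; have [fU|nfU] := boolP (f x \in U).
  by exists x.
by apply: IHk fkU _ nfU; apply: fP.
Qed.

Lemma comm_nilp_comp (f g : 'End(V)) :
  (forall x, f (g x) = g (f x)) -> lnilp g -> lnilp (f \o g)%VF.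
Proof.
move=> fg [k gk]; exists k => x.
have -> : iter k (f \o g)%VF x = iter k f (iter k g x).
  elim: k {gk} => //= k ->; rewrite comp_lfunE; congr (f _).
  by move: (iter k g x) => y; elim: k => //= k <-; rewrite fg.
by rewrite gk iter_lfun0.
Qed.

End Trace.

(** All eigenvalues vanish, so the characteristic polynomial is a power of ['X], and the trace is
    minus its subleading coefficient. *)
Lemma ltr_nilp (K : closedFieldType) (V : vectType K) (f : 'End(V)) :
  lnilp f -> ltr f = 0.
Proof.
case=> k nilf; rewrite /ltr; set e := vbasis {:V}.
pose A := mxof e e f; rewrite -/A.
have eb : basis_of {:V} e := vbasisP _.
have [n_gt0|] := ltnP 0 (\dim {:V}); last first.
  rewrite leqn0 => /eqP n0; rewrite /mxtrace big1 // => i _.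
  by have := ltn_ord i; rewrite {2}n0.
have eig0 a : eigenvalue A a -> a = 0.
  case/eigenvalueP=> v vA nz_v.
  have fv : f (vecof e v) = a *: vecof e v.
    by rewrite (hom_vecof _ eb) vA linearZ.
  have := nilf (vecof e v).
  have -> : iter k f (vecof e v) = a ^+ k *: vecof e v.
    elim: k {nilf} => [|k IHk] /=; first by rewrite scale1r.
    by rewrite IHk linearZ /= fv scalerA -exprSr.
  move/eqP; rewrite scaler_eq0 (vecof_eq0 eb) (negPf nz_v) orbF.
  by rewrite expf_eq0 => /andP[_ /eqP].
have [r def_p] := closed_field_poly_normal (char_poly A).
move: def_p; rewrite (monicP (char_poly_monic A)) scale1r => def_p.
have r0 : {in r, forall z, z = 0}.
  by move=> z rz; apply: eig0; rewrite eigenvalue_root_char def_p root_prod_XsubC.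
have {}def_p : char_poly A = 'X^(size r).
  rewrite def_p big_seq (eq_bigr (fun=> 'X)) => [|z /r0->]; last by rewrite subr0.
  by rewrite -big_seq big_const_seq count_predT iter_mulr_1.
have /eqP := size_char_poly A; rewrite def_p size_polyXn eqSS => /eqP sz_r.
have /eqP := char_poly_trace A n_gt0; rewrite def_p coefXn sz_r.
by rewrite ltn_eqF ?prednK // eq_sym oppr_eq0 => /eqP.
Qed.

(** Cayley-Hamilton with the characteristic polynomial split into linear factors. The factors are
    applied by a fold so that later inductions can run on the list of roots. *)
Lemma mx_char_poly_kills (K : closedFieldType) n (A : 'M[K]_n) :
  exists s : seq K, forall v : 'rV_n, foldr (fun a u => u *m A - a *: u) v s = 0.
Proof.
case: n A => [|n] A; first by exists [::] => v; rewrite thinmx0.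
have [r def_p] := closed_field_poly_normal (char_poly A).
exists r => v; have := Cayley_Hamilton A.
rewrite def_p (monicP (char_poly_monic A)) scale1r => pA0.
have -> : foldr (fun a u => u *m A - a *: u) v r =
          v *m horner_mx A (\prod_(z <- r) ('X - z%:P)).
  elim: r {def_p pA0} => [|z r IHr] /=; first by rewrite big_nil rmorph1 mulmx1.
  rewrite IHr big_cons mulrC rmorphM rmorphB /= horner_mx_X horner_mx_C -mulmxE mulmxA.
  by rewrite mulmxBr mul_mx_scalar.
by rewrite pA0 mulmx0.
Qed.

(** * Generalized eigenspaces of an endomorphism *)

Section GeneralizedEigenvectors.
Variables (K : closedFieldType) (V : vectType K).
Implicit Types (U : {vspace V}) (f g : 'End(V)).

Definition eshift f (a : K) : 'End(V) := (f - a *: \1)%VF.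

Lemma eshiftE f a x : eshift f a x = f x - a *: x.
Proof. by rewrite add_lfunE opp_lfunE scale_lfunE id_lfunE. Qed.

Lemma eshift_comm f a b x : eshift f a (eshift f b x) = eshift f b (eshift f a x).
Proof.
rewrite !eshiftE !linearB !linearZ /= !scalerA [b * a]mulrC.
by rewrite -!addrA; congr (_ + _); rewrite addrCA.
Qed.

Lemma iter_eshift_comm f a b k x :
  eshift f a (iter k (eshift f b) x) = iter k (eshift f b) (eshift f a x).
Proof. by elim: k => //= k <-; rewrite eshift_comm. Qed.

Definition lpow f k : 'End(V) := iter k (comp_lfun f) \1%VF.

Lemma lpowE f k x : lpow f k x = iter k f x.
Proof. by elim: k => [|k IHk] /=; rewrite ?id_lfunE // comp_lfunE IHk. Qed.

Definition geig f k a : {vspace V} := lker (lpow (eshift f a) k).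

Lemma mem_geig f k a x : (x \in geig f k a) = (iter k (eshift f a) x == 0).
Proof. by rewrite memv_ker lpowE. Qed.

Lemma geig_le f k m a : (k <= m)%N -> (geig f k a <= geig f m a)%VS.
Proof.
move=> km; apply/subvP=> x; rewrite !mem_geig => /eqP x0; apply/eqP.
by apply: iter_le0 km _ x0; rewrite linear0.
Qed.

Lemma eshift_stable f a U : stable f U -> stable (eshift f a) U.
Proof. by move=> fU x Ux; rewrite eshiftE rpredB ?rpredZ ?fU. Qed.

Lemma iter_stable g k U x : stable g U -> x \in U -> iter k g x \in U.
Proof. by move=> gU Ux; elim: k => //= k; apply: gU. Qed.

Lemma eshift_geig f k a b : stable (eshift f b) (geig f k a).
Proof.
move=> x; rewrite !mem_geig => /eqP x0.
by rewrite -iter_eshift_comm x0 linear0.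
Qed.

Lemma eshift_inj f k a b x : a != b ->
  x \in geig f k a -> eshift f b x = 0 -> x = 0.
Proof.
rewrite mem_geig => ab /eqP x0 /eqP; rewrite eshiftE subr_eq0 => /eqP fx.
have gx : eshift f a x = (b - a) *: x by rewrite eshiftE fx scalerBl.
have : iter k (eshift f a) x = (b - a) ^+ k *: x.
  elim: k {x0} => [|k IHk] /=; first by rewrite scale1r.
  by rewrite IHk linearZ /= gx scalerA exprSr.
move/eqP; rewrite x0 eq_sym scaler_eq0 expf_eq0 subr_eq0 eq_sym (negPf ab) andbF.
by move/eqP.
Qed.

(** [(f - b)^k] removes the [b]-component and is injective on the other generalized eigenspaces,
    which gives an induction on [s]. *)
Lemma geig_independent f k (s : seq K) (x : K -> V) :
  uniq s -> (forall a, a \in s -> x a \in geig f k a) -> \sum_(a <- s) x a = 0 ->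
  forall a, a \in s -> x a = 0.
Proof.
elim: s x => [|b s IHs] x //= /andP[nbs us] xW sum0.
pose g := eshift f b.
have x0 a : a \in s -> x a = 0.
  move=> sa; have ab : a != b by apply: contraNneq nbs => <-.
  have xa : x a \in geig f k a by apply: xW; rewrite inE sa orbT.
  have iter_inj m y : y \in geig f k a -> iter m g y = 0 -> y = 0.
    elim: m y => //= m IHm y yW; rewrite -iterS iterSr => /IHm g0.
    by apply: (eshift_inj ab yW); apply: g0; apply: eshift_geig.
  apply: (iter_inj k) => //.
  apply: (IHs (fun c => iter k g (x c))) => // [c sc|].
    have : x c \in geig f k c by apply: xW; rewrite inE sc orbT.
    by apply: iter_stable; apply: eshift_geig.
  have := congr1 (iter k g) sum0; rewrite iter_lfun_sum iter_lfun0 big_cons.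
  have /xW : b \in b :: s by rewrite mem_head.
  by rewrite mem_geig => /eqP->; rewrite add0r.
move=> a; rewrite inE => /orP[/eqP->|/x0//].
by move: sum0; rewrite big_cons big_seq big1 ?addr0 // => c /x0.
Qed.

(** By induction [(f - b) x] decomposes. Its components for [a != b] have preimages in their own
    eigenspaces, where [f - b] is injective and hence bijective. Subtracting these preimages from
    [x] leaves a vector that [f - b] sends into the generalized [b]-eigenspace. *)
Lemma geig_span f (s : seq K) U x :
  stable f U -> x \in U -> foldr (fun a => eshift f a) x s = 0 ->
  x \in (\sum_(a <- s) (geig f (size s) a :&: U))%VS.
Proof.
move=> fU; elim/last_ind: s x => [|s b IHs] x Ux /=.
  by move->; rewrite mem0v.
set g := eshift f b; have gU : stable g U by apply: eshift_stable.
rewrite foldr_rcons => gx0; have := IHs (g x) (gU _ Ux) gx0.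
rewrite -sumv_undup => /(memv_sum_seq (undup_uniq s))[c cW gx].
pose W a := (geig f (size s) a :&: U)%VS.
pose Z := (\sum_(a <- undup s | a != b) W a)%VS.
have gW a : stable g (W a).
  by move=> y /memv_capP[yg yU]; rewrite memv_cap eshift_geig ?gU.
have [z zZ gz] : exists2 z, z \in Z & g z = \sum_(a <- undup s | a != b) c a.
  suff /memv_imgP[z zZ ->] : \sum_(a <- undup s | a != b) c a \in (g @: Z)%VS by exists z.
  rewrite big_seq_cond; apply: memv_suml => a /andP[sa ab].
  have [y yW <-] := stable_inj_surj (gW a)
    (fun y yW => eshift_inj ab (subvP (capvSl _ _) y yW)) (cW a).
  by apply: memv_img; apply: (subvP (sumv_seq_sup _ sa ab)).
have ZU : (Z <= U)%VS by apply: subv_sum_seq => a _ _; apply: capvSr.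
have le_s : (size s <= size (rcons s b))%N by rewrite size_rcons.
have xz : x - z \in (geig f (size (rcons s b)) b :&: U)%VS.
  apply/memv_capP; split; last exact: rpredB Ux (subvP ZU z zZ).
  rewrite mem_geig size_rcons iterSr.
  rewrite linearB /= gz gx.
  have [sb|nsb] := boolP (b \in undup s).
    rewrite (bigD1_seq b) ?undup_uniq //= addrK.
    by have /memv_capP[] := cW b; rewrite mem_geig.
  have -> : \sum_(a <- undup s | a != b) c a = \sum_(a <- undup s) c a.
    rewrite big_seq_cond [RHS]big_seq; apply: eq_bigl => a.
    by case: eqP => [->|]; rewrite ?andbF ?andbT // (negPf nsb).
  by rewrite subrr iter_lfun0.
rewrite -[x](subrK z) addrC -cats1 big_cat big_seq1 cats1; apply: memv_add => //.
apply: subvP zZ; apply: subv_sum_seq => a; rewrite mem_undup => sa _.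
pose W' a := (geig f (size (rcons s b)) a :&: U)%VS.
apply: (subv_trans _ (sumv_seq_sup (P := xpredT) W' sa isT)).
by rewrite capvS // geig_le.
Qed.

Lemma char_poly_kills f :
  exists s : seq K, forall x, foldr (fun a => eshift f a) x s = 0.
Proof.
set e := vbasis {:V}; have eb : basis_of {:V} e := vbasisP _.
have [s sA] := mx_char_poly_kills (mxof e e f); exists s => x.
apply/eqP; rewrite -(rVof_eq0 eb); apply/eqP; rewrite -[RHS](sA (rVof e x)).
elim: s {sA} => //= a s IHs.
by rewrite eshiftE linearB linearZ /= (rVof_app _ eb) IHs.
Qed.

(* [pi a] is the projection onto the generalized eigenspace of [a]. *)
Lemma geig_projections f : exists (s : seq K) (pi : K -> 'End(V)),
  [/\ uniq s,
      forall x, x = \sum_(a <- s) pi a x,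
      forall a k x, iter k (eshift f a) x = 0 ->
        forall b, b \in s -> pi b x = if b == a then x else 0,
      (exists k, forall a x, a \in s -> iter k (eshift f a) (pi a x) = 0) &
      forall U a x, stable f U -> x \in U -> a \in s -> pi a x \in U].
Proof.
have [r r0] := char_poly_kills f; pose s := undup r.
pose W a := geig f (size r) a; pose rest a := (\sum_(b <- s | b != a) W b)%VS.
pose pi a := daddv_pi (W a) (rest a).
have us : uniq s := undup_uniq _.
have indep k (c : K -> V) : (forall a, a \in s -> c a \in geig f k a) ->
    \sum_(a <- s) c a = 0 -> forall a, a \in s -> c a = 0.
  exact: geig_independent us.
have W_rest a : a \in s -> (W a :&: rest a = 0)%VS.
  move=> sa; apply/eqP; rewrite -subv0; apply/subvP=> x /memv_capP[xa].
  rewrite /rest -big_filter => /memv_sum_seq; rewrite filter_uniq // => /(_ isT).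
  case=> c cW def_x.
  pose d b := if b == a then - x else c b.
  have dW b : b \in s -> d b \in W b by rewrite /d; case: eqP => [->|]; rewrite ?rpredN.
  have sumd : \sum_(b <- s) d b = 0.
    rewrite (bigD1_seq a) //= {1}/d eqxx def_x big_filter.
    by rewrite addrC -sumrB big1 // => b /negPf; rewrite /d => ->; rewrite subrr.
  have := indep _ d dW sumd a sa.
  by rewrite /d eqxx memv0 => /eqP; rewrite oppr_eq0.
have pi_id a x : a \in s -> x \in W a -> pi a x = x.
  by move=> sa xa; rewrite /pi daddv_pi_id ?W_rest.
have pi_0 a b x : a \in s -> b \in s -> b != a -> x \in W b -> pi a x = 0.
  move=> sa sb ba xb; have xr : x \in rest a by apply: (subvP (sumv_seq_sup _ sb ba)).
  exact: daddv_pi0 (W_rest a sa) xr.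
have decU U x : stable f U -> x \in U -> exists2 c : K -> V,
    (forall a, c a \in (W a :&: U)%VS) & x = \sum_(a <- s) c a.
  move=> fU Ux; have := geig_span fU Ux (r0 x).
  by rewrite -sumv_undup => /(memv_sum_seq us).
have pi_c U x : stable f U -> x \in U -> exists2 c : K -> V,
    (forall a, c a \in (W a :&: U)%VS) &
    x = \sum_(a <- s) c a /\ forall a, a \in s -> pi a x = c a.
  move=> fU Ux; have [c cW def_x] := decU U x fU Ux; exists c => //; split=> // a sa.
  have cWa b : c b \in W b by case/memv_capP: (cW b).
  rewrite def_x linear_sum (bigD1_seq a) //= pi_id // big1_seq ?addr0 // => b /andP[ba sb].
  exact: (pi_0 a b).
have fT : stable f fullv by move=> x _; rewrite memvf.
exists s, pi; split=> // [x|a k x xa b sb||U a x fU Ux sa].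
- have [c _ [def_x pic]] := pi_c fullv x fT (memvf _).
  by rewrite {1}def_x !big_seq; apply: eq_bigr => a /pic->.
- have [c cW [def_x pic]] := pi_c fullv x fT (memvf _); rewrite pic //.
  have cWa d : c d \in W d by case/memv_capP: (cW d).
  (* A common exponent places [x] and its components in generalized eigenspaces of the same order,
     where independence applies. *)
  pose m := maxn k (size r).
  have cm d : c d \in geig f m d by apply: (subvP (geig_le f d (leq_maxr _ _))).
  have xm : x \in geig f m a.
    by apply: (subvP (geig_le f a (leq_maxl k (size r)))); rewrite mem_geig xa.
  have [sa|nsa] := boolP (a \in s).
    have {}xm : forall d, d \in s -> c d - (if d == a then x else 0) \in geig f m d.
      by move=> d _; rewrite rpredB //; case: eqP => [->|]; rewrite ?mem0v.
    apply/eqP; rewrite -subr_eq0; apply/eqP; apply: (indep m _ xm) => //.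
    rewrite sumrB -def_x (bigD1_seq a) //= eqxx big1 ?addr0 ?subrr // => d.
    by move=> /negPf->.
  have ba : (b == a) = false by apply: contraNF nsa => /eqP<-.
  rewrite ba; pose d i := if i == a then - x else c i.
  have us' : uniq (a :: s) by rewrite /= nsa.
  have dW i : i \in a :: s -> d i \in geig f m i.
    by rewrite /d; case: eqP => [->|]; rewrite ?rpredN.
  have sumd : \sum_(i <- a :: s) d i = 0.
    rewrite big_cons {1}/d eqxx def_x addrC big_seq [X in _ - X]big_seq -sumrB.
    apply: big1 => i si; rewrite /d; case: eqP => [eia|]; last by rewrite subrr.
    by rewrite -eia si in nsa.
  have sb' : b \in a :: s by rewrite inE sb orbT.
  by have := geig_independent us' dW sumd sb'; rewrite /d ba.
- exists (size r) => a x sa; have [c cW [_ ->//]] := pi_c fullv x fT (memvf _).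
  by have /memv_capP[] := cW a; rewrite mem_geig => /eqP.
have [c cW [_ ->//]] := pi_c U x fU Ux.
by have /memv_capP[] := cW a.
Qed.

End GeneralizedEigenvectors.

(** * Bracket identities and the Killing form *)

Section LieBasics.
Variables (K : fieldType) (L : lieAlgType K).
Implicit Types (U W Z I : {vspace L}) (x y z : L).

HB.instance Definition _ (x : L) :=
  GRing.isLinear.Build K L L *:%R (lie x) (fun a y z => lieDZr a y z x).

Lemma lieDl x y z : lie (x + y) z = lie x z + lie y z.
Proof. by rewrite -[x]scale1r lieDZl !scale1r. Qed.

Lemma lie0l x : lie 0 x = 0 :> L.
Proof. by apply: (addrI (lie 0 x)); rewrite -lieDl !addr0. Qed.

Lemma lieZl a x y : lie (a *: x) y = a *: lie x y.
Proof. by rewrite -[a *: x]addr0 lieDZl lie0l addr0. Qed.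

Lemma lieC x y : lie x y = - lie y x.
Proof.
have := liexx (x + y); rewrite lieDl !linearD /= !liexx add0r addr0.
by move/eqP; rewrite addr_eq0 => /eqP.
Qed.

Lemma lieNl x y : lie (- x) y = - lie x y.
Proof. by rewrite lieC linearN /= [lie y x]lieC opprK. Qed.

Lemma lieBl x y z : lie (x - y) z = lie x z - lie y z.
Proof. by rewrite lieDl lieNl. Qed.

Lemma lieDr x y z : lie x (y + z) = lie x y + lie x z. Proof. exact: linearD. Qed.
Lemma lieZr a x y : lie x (a *: y) = a *: lie x y. Proof. exact: linearZ. Qed.
Lemma lieNr x y : lie x (- y) = - lie x y. Proof. exact: linearN. Qed.
Lemma lieBr x y z : lie x (y - z) = lie x y - lie x z. Proof. exact: linearB. Qed.
Lemma lie0r x : lie x 0 = 0 :> L. Proof. exact: linear0. Qed.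

Lemma lie_suml (J : Type) (s : seq J) (P : pred J) (c : J -> L) y :
  lie (\sum_(i <- s | P i) c i) y = \sum_(i <- s | P i) lie (c i) y.
Proof.
by rewrite lieC linear_sum -sumrN; apply: eq_bigr => i _; rewrite [RHS]lieC.
Qed.

Lemma lie_der x y z : lie x (lie y z) = lie (lie x y) z + lie y (lie x z).
Proof.
have /eqP := lie_jacobi x y z; rewrite -addrA addr_eq0 => /eqP ->.
by rewrite [lie z x]lieC linearN /= [lie z (lie x y)]lieC opprD !opprK addrC.
Qed.

Definition adl x : 'End(L) := linfun (lie x).

Lemma adlE x y : adl x y = lie x y. Proof. exact: lfunE. Qed.

Lemma adl_lie x y : adl (lie x y) = ((adl x \o adl y) - (adl y \o adl x))%VF.
Proof.
apply/lfunP=> z; rewrite add_lfunE opp_lfunE !comp_lfunE !adlE.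
by rewrite [lie x (lie y z)]lie_der addrK.
Qed.

Lemma adl_is_linear : linear adl.
Proof. by move=> a x y; apply/lfunP=> z; rewrite add_lfunE scale_lfunE !adlE lieDZl. Qed.
HB.instance Definition _ := GRing.isLinear.Build K L 'End(L) *:%R adl adl_is_linear.

Definition killing x y : K := ltr (adl x \o adl y)%VF.

Lemma killingC x y : killing x y = killing y x.
Proof. exact: ltr_comp. Qed.

Fact killing_is_scalar x : scalar (killing x).
Proof. by move=> a y z; rewrite /killing linearP /= comp_lfunDr -comp_lfunZr linearP. Qed.
HB.instance Definition _ x :=
  GRing.isLinear.Build K L K _ (killing x) (killing_is_scalar x).

Lemma killingP x a y z : killing x (a *: y + z) = a * killing x y + killing x z.
Proof. exact: linearP. Qed.

Lemma killing_lie x y z : killing (lie x y) z = killing x (lie y z).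
Proof.
rewrite /killing !adl_lie comp_lfunDl comp_lfunDr !linearD /= comp_lfunNl comp_lfunNr !linearN /=.
by rewrite !comp_lfunA (ltr_comp (_ \o _)%VF (adl y)) comp_lfunA.
Qed.

Lemma killing_lieC x y z : killing (lie x y) z = - killing y (lie x z).
Proof. by rewrite lieC killingC linearN /= killingC killing_lie. Qed.

Lemma mem_lie_span U W x y : x \in U -> y \in W -> lie x y \in lie_span U W.
Proof.
move=> /coord_vbasis -> /coord_vbasis ->; rewrite lie_suml rpred_sum // => i _.
rewrite linear_sum rpred_sum // => j _ /=; rewrite lieZl linearZ /= !rpredZ //.
by apply/memv_span/allpairsP; exists ((vbasis U)`_i, (vbasis W)`_j); split=> //;
  apply: mem_nth; rewrite size_tuple.
Qed.

Lemma lie_span_sub U W Z :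
  (forall x y, x \in U -> y \in W -> lie x y \in Z) -> (lie_span U W <= Z)%VS.
Proof.
move=> UWZ; apply/span_subvP=> _ /allpairsP[[x y] /= [xU yW ->]].
by apply: UWZ; apply: vbasis_mem.
Qed.

Lemma lie_span_ideal I : lie_ideal I -> lie_ideal (lie_span I I).
Proof.
move=> idI x y yI; rewrite -adlE.
suff /subvP : (adl x @: lie_span I I <= lie_span I I)%VS by apply; apply: memv_img.
rewrite limg_span; apply/span_subvP=> _ /mapP[_ /allpairsP[[a b] /= [aI bI ->]] ->].
have {}aI := vbasis_mem aI; have {}bI := vbasis_mem bI.
by rewrite adlE lie_der rpredD ?mem_lie_span ?idI.
Qed.

End LieBasics.

(** * Engel's theorem and Cartan's criterion *)

Section Engel.
Variables (K : fieldType) (L : lieAlgType K).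
Implicit Types (A B U W I : {vspace L}) (x y z : L).

Definition lie_stable A U := forall x y, x \in A -> y \in U -> lie x y \in U.

Lemma lie_stable_addv B a :
  lie_stable B B -> (forall b, b \in B -> lie b a \in B) ->
  lie_stable (B + <[a]>) (B + <[a]>).
Proof.
move=> BB Ba; have aB b : b \in B -> lie a b \in B by move=> bB; rewrite lieC rpredN Ba.
move=> x y /memv_addP[b bB [_ /vlineP[k ->] ->]] /memv_addP[c cB [_ /vlineP[m ->] ->]].
apply: (subvP (addvSl _ _)).
rewrite lieDl !linearD /= !lieZl !linearZ /= liexx !scaler0 addr0.
by rewrite !rpredD ?rpredZ ?Ba ?aB ?BB.
Qed.

(* The pair [U], [W] encodes the quotient module [W / U]. *)
Lemma engel A U W :
  lie_stable A A -> (forall x, x \in A -> lnilp (lie x)) ->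
  lie_stable A U -> lie_stable A W -> ~~ (W <= U)%VS ->
  exists2 w, w \in W /\ w \notin U & forall a, a \in A -> lie a w \in U.
Proof.
have [n le_n] := ubnP (\dim A); elim: n A U W le_n => // n IHn A U W.
rewrite ltnS => le_n AA nilA AU AW nWU.
have [A0|nzA] := eqVneq A 0%VS.
  have /subvPn[w Ww nUw] := nWU; exists w => // a; rewrite A0 memv0 => /eqP->.
  by rewrite lie0l mem0v.
have IHB B : lie_stable B B -> (B <= A)%VS -> (\dim B < \dim A)%N ->
    forall U' W', lie_stable A U' -> lie_stable B W' -> lie_stable B U' -> ~~ (W' <= U')%VS ->
  exists2 w, w \in W' /\ w \notin U' & forall a, a \in B -> lie a w \in U'.
  move=> BB BA dimB U' W' _ BW BU; apply: IHn => //; first exact: leq_trans dimB le_n.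
  by move=> x xB; exact: (nilA x (subvP BA x xB)).
(* Induction on the codimension: Engel for [B] acting on [A / B] gives an [a] outside [B] that
   normalizes [B], and [B] is enlarged by [a] until a single line is missing from [A]. *)
have codim1 k B : lie_stable B B -> (B <= A)%VS -> (\dim B < \dim A)%N ->
    (\dim A - \dim B <= k)%N ->
  exists B' a, [/\ lie_stable B' B', (\dim B' < \dim A)%N, (B' <= A)%VS, a \in A &
    (forall b, b \in B' -> lie b a \in B') /\ A = (B' + <[a]>)%VS].
  elim: k B => [|k IHk] B BB BA dimB le_k.
    by rewrite leqn0 subn_eq0 leqNgt dimB in le_k.
  have nAB : ~~ (A <= B)%VS by apply: contraL dimB => /dimvS; rewrite leqNgt.
  have BsA : lie_stable B A by move=> x y /(subvP BA); apply: AA.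
  have [||a [Aa nBa] Ba] := IHn B B A _ BB _ BB BsA nAB.
  - exact: leq_trans dimB le_n.
  - by move=> x xB; exact: (nilA x (subvP BA x xB)).
  have CA : (B + <[a]> <= A)%VS by rewrite subv_add BA -memvE.
  have [AC|nAC] := boolP (A <= B + <[a]>)%VS.
    by exists B, a; split=> //; split=> //; apply/eqP; rewrite eqEsubv AC.
  apply: (IHk (B + <[a]>)%VS) => //.
  - exact: lie_stable_addv.
  - by rewrite ltn_neqAle dimvS // andbT; apply: contraNneq nAC => eq_d;
      rewrite (eqP (_ : (B + <[a]> == A)%VS)) ?subvv // eqEdim CA eq_d /=.
  rewrite -ltnS; apply: leq_trans le_k; rewrite ltn_sub2l //.
  rewrite ltn_neqAle dimvS ?addvSl // andbT; apply: contraNneq nBa => eq_d.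
  rewrite (eqP (_ : (B == B + <[a]>)%VS)); last by rewrite eqEdim addvSl eq_d /=.
  by apply: (subvP (addvSr _ _)); apply: memv_line.
have dim0 : (\dim (0%VS : {vspace L}) < \dim A)%N by rewrite dimv0 lt0n dimv_eq0.
have st0 : lie_stable 0%VS 0%VS.
  by move=> x y; rewrite !memv0 => /eqP-> _; rewrite lie0l.
have [B [a [BB dimB BA Aa [Ba defA]]]] := codim1 _ _ st0 (sub0v A) dim0 (leqnn _).
have BU : lie_stable B U by move=> x y /(subvP BA); apply: AU.
have BW : lie_stable B W by move=> x y /(subvP BA); apply: AW.
have [||w0 [Ww0 nUw0] Bw0] := IHn B U W _ BB _ BU BW nWU.
- exact: leq_trans dimB le_n.
- by move=> x xB; exact: (nilA x (subvP BA x xB)).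
(* The vectors of [W] that [B] sends into [U]. They are stable under [a] because [a] normalizes [B],
   so nilpotency of [ad a] finds one of them, outside [U], that [a] sends into [U] as well. *)
pose P w := w \in W /\ forall b, b \in B -> lie b w \in U.
have aP w : P w -> P (lie a w).
  case=> Ww Bw; split=> [|b bB]; first exact: AW.
  by rewrite lie_der; apply: rpredD; [apply: Bw (Ba b bB) | apply: AU (Bw b bB)].
have [w [[Ww Bw] nUw aw]] := nilp_last (nilA a Aa) aP (conj Ww0 Bw0) nUw0.
exists w => // x; rewrite defA => /memv_addP[b bB [_ /vlineP[k ->] ->]].
by rewrite lieDl lieZl; apply: rpredD; [apply: Bw | apply: rpredZ].
Qed.

(** By Engel, a proper [I]-submodule [U] grows by lines [<[w]>] with [[I, w]] in [U]. When [U +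
    <[w]>] reaches [I], the bracket [[I, I]] still lies in [U], against perfectness. *)
Lemma engel_perfect I :
  lie_stable I I -> (forall x, x \in I -> lnilp (lie x)) ->
  lie_span I I = I -> I = 0%VS.
Proof.
move=> II nilI perfI; apply/eqP; apply: contraT => nzI.
have step k U : lie_stable I U -> (U <= I)%VS -> (\dim U < \dim I)%N ->
    (\dim I - \dim U <= k)%N -> False.
  elim: k U => [|k IHk] U IU UI dimU le_k.
    by rewrite leqn0 subn_eq0 leqNgt dimU in le_k.
  have nIU : ~~ (I <= U)%VS by apply: contraL dimU => /dimvS; rewrite leqNgt.
  have [w [Iw nUw] Iwu] := engel II nilI IU II nIU.
  have CI : (U + <[w]> <= I)%VS by rewrite subv_add UI -memvE.
  have IC : lie_stable I (U + <[w]>).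
    move=> x y xI /memv_addP[u uU [_ /vlineP[c ->] ->]].
    by apply: (subvP (addvSl _ _)); rewrite linearD linearZ /=; apply: rpredD;
      [apply: IU | apply: rpredZ; apply: Iwu].
  have [IsC|nIC] := boolP (I <= U + <[w]>)%VS.
    case/negP: nIU; rewrite -perfI; apply: lie_span_sub => x y xI.
    move=> /(subvP IsC)/memv_addP[u uU [_ /vlineP[c ->] ->]].
    by rewrite linearD linearZ /=; apply: rpredD; [apply: IU | apply: rpredZ; apply: Iwu].
  apply: (IHk (U + <[w]>)%VS) => //.
    by rewrite ltn_neqAle dimvS // andbT; apply: contraNneq nIC => eq_d;
      rewrite (eqP (_ : (U + <[w]> == I)%VS)) ?subvv // eqEdim CI eq_d /=.
  rewrite -ltnS; apply: leq_trans le_k; rewrite ltn_sub2l //.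
  rewrite ltn_neqAle dimvS ?addvSl // andbT; apply: contraNneq nUw => eq_d.
  rewrite (eqP (_ : (U == U + <[w]>)%VS)); last by rewrite eqEdim addvSl eq_d /=.
  by apply: (subvP (addvSr _ _)); apply: memv_line.
case: (step (\dim I) 0%VS) => //; rewrite ?sub0v ?dimv0 ?subn0 ?lt0n ?dimv_eq0 //.
by move=> x y _; rewrite !memv0 => /eqP->; rewrite linear0.
Qed.

End Engel.

(** * Symmetric forms nondegenerate on a subspace *)

Section Forms.
Variables (K : fieldType) (V : vectType K) (B : V -> V -> K).
Hypotheses (BC : forall x y, B x y = B y x)
  (BP : forall x a y z, B x (a *: y + z) = a * B x y + B x z).
Implicit Types (c S : {vspace V}) (x y z : V).

(** The map from [V] to the dual of [c], written as an endomorphism through a basis of [c]. Its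
    kernel is the orthogonal of [c], so nondegeneracy on [c] becomes injectivity on [c]. *)
Definition gram c y : V := \sum_(j < \dim c) B (vbasis c)`_j y *: (vbasis c)`_j.

Fact gram_is_linear c : linear (gram c).
Proof.
move=> a y z; rewrite /gram scaler_sumr -big_split /=; apply: eq_bigr => j _.
by rewrite BP scalerDl scalerA.
Qed.
HB.instance Definition _ c := GRing.isLinear.Build K V V *:%R (gram c) (gram_is_linear c).

Lemma gramE c y : linfun (gram c) y = gram c y. Proof. exact: lfunE. Qed.

Lemma form0r x : B x 0 = 0.
Proof. by have := BP x 1 0 0; rewrite scale1r mul1r addr0 -{1}[B x 0]addr0 => /addrI. Qed.

Lemma form_sumr x (J : Type) (s : seq J) (a : J -> K) (y : J -> V) :
  B x (\sum_(j <- s) a j *: y j) = \sum_(j <- s) a j * B x (y j).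
Proof.
elim: s => [|j s IHs]; first by rewrite !big_nil form0r.
by rewrite !big_cons BP IHs.
Qed.

Lemma gram_mem c y : gram c y \in c.
Proof.
rewrite rpred_sum // => j _; rewrite rpredZ // vbasis_mem // mem_nth //.
by rewrite size_tuple.
Qed.

Lemma vbasis_form c y (l : V -> K) :
  (forall a u v, l (a *: u + v) = a * l u + l v) ->
  gram c y = \sum_(j < \dim c) l (vbasis c)`_j *: (vbasis c)`_j ->
  forall x, x \in c -> B x y = l x.
Proof.
move=> lP /eqP; rewrite -subr_eq0 /gram -sumrB => /eqP gl x xc.
have /freeP free_c := basis_free (vbasisP c).
have {}gl (j : 'I_(\dim c)) : B (vbasis c)`_j y = l (vbasis c)`_j.
  apply/eqP; rewrite -subr_eq0; apply/eqP.
  apply: (free_c (fun j => B (vbasis c)`_j y - l (vbasis c)`_j) _ j).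
  by rewrite -[RHS]gl; apply: eq_bigr => i _; rewrite scalerBl.
have l0 : l 0 = 0.
  by have := lP 1 0 0; rewrite scale1r mul1r addr0 -{1}[l 0]addr0 => /addrI.
rewrite (coord_vbasis xc) BC form_sumr.
elim/big_rec2: _ => [|j a v _ IHv]; first by rewrite l0.
by rewrite lP -IHv BC gl.
Qed.

Lemma gram0 c y : gram c y = 0 <-> forall x, x \in c -> B x y = 0.
Proof.
split=> [g0|B0]; last first.
  rewrite /gram big1 // => j _; rewrite B0 ?scale0r //.
  by rewrite vbasis_mem // mem_nth // size_tuple.
apply: (vbasis_form (l := fun=> 0)) => [a _ _|]; first by rewrite mulr0 addr0.
by rewrite g0 big1 // => j _; rewrite scale0r.
Qed.

(** Nondegeneracy makes [gram c] injective on [c], hence onto [c]. The preimage of the vector whose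
    coordinates are the values of [l] represents [l]. *)
Lemma form_riesz c (l : V -> K) :
  (forall a u v, l (a *: u + v) = a * l u + l v) ->
  (forall y, y \in c -> (forall x, x \in c -> B x y = 0) -> y = 0) ->
  exists2 y, y \in c & forall x, x \in c -> B x y = l x.
Proof.
move=> lP nondeg.
have gc : stable (linfun (gram c)) c by move=> y _; rewrite gramE gram_mem.
have inj_g y : y \in c -> linfun (gram c) y = 0 -> y = 0.
  by rewrite gramE => yc /gram0; apply: nondeg.
have zc : \sum_(j < \dim c) l (vbasis c)`_j *: (vbasis c)`_j \in c.
  by rewrite rpred_sum // => j _; rewrite rpredZ // vbasis_mem // mem_nth // size_tuple.
have [y yc] := stable_inj_surj gc inj_g zc.
by rewrite gramE => gy; exists y => //; apply: vbasis_form.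
Qed.

(** If [x] were outside [S], some linear form would vanish on [S] but not at [x]. The vector
    representing it in [c] is orthogonal to [S] and not to [x]. *)
Lemma form_biorth c S x :
  (forall y, y \in c -> (forall x, x \in c -> B x y = 0) -> y = 0) ->
  (S <= c)%VS -> x \in c ->
  (forall y, y \in c -> (forall z, z \in S -> B z y = 0) -> B x y = 0) ->
  x \in S.
Proof.
move=> nondeg Sc xc perp; apply: contraT => nSx.
pose p := daddv_pi S^C S; have capS : (S^C :&: S = 0)%VS by rewrite capvC capv_compl.
have addS v : v \in (S^C + S)%VS by rewrite addvC addv_complf memvf.
have p0 z : z \in S -> p z = 0 by apply: daddv_pi0.
have px0 : p x != 0.
  apply: contraNneq nSx => px; have := daddv_pi_add capS (addS x).
  by rewrite -/p px add0r => <-; apply: memv_pi.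
have [j nz_j] : exists j, coord (vbasis {:V}) j (p x) != 0.
  apply/existsP; apply: contraR px0; rewrite negb_exists => /forallP u0.
  rewrite (coord_vbasis (memvf (p x))) big1 // => j _.
  by have := u0 j; rewrite negbK => /eqP->; rewrite scale0r.
pose l v := coord (vbasis {:V}) j (p v).
have lP a v w : l (a *: v + w) = a * l v + l w by rewrite /l !linearP.
have [y yc Bl] := form_riesz lP nondeg.
case/eqP: nz_j; rewrite -[LHS]Bl //; apply: perp => // z zS.
by rewrite Bl ?(subvP Sc) // /l p0 // linear0.
Qed.

End Forms.

Section CartanCriterion.
Variables (C : numClosedFieldType) (L : lieAlgType C).
Implicit Types (U I : {vspace L}) (x y z : L).

(** By the derivation rule, the shift by [mu + l] of a bracket is the sum of the brackets in which
    one argument is shifted. Each summand lowers [p + q]. *)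
Lemma geig_lie (y b x : L) (mu l : C) p q :
  iter p (eshift (adl y) mu) b = 0 -> iter q (eshift (adl y) l) x = 0 ->
  iter (p + q) (eshift (adl y) (mu + l)) (lie b x) = 0.
Proof.
have [n le_n] := ubnP (p + q)%N; elim: n p q b x le_n => // n IHn p q b x.
rewrite ltnS; case: p => [|p] le_n; first by move=> b0 _; rewrite [b]b0 lie0l iter_lfun0.
case: q le_n => [|q] le_n; first by move=> _ x0; rewrite [x]x0 linear0 iter_lfun0.
move=> pb qx; rewrite addSn iterSr.
have -> : eshift (adl y) (mu + l) (lie b x) =
    lie (eshift (adl y) mu b) x + lie b (eshift (adl y) l x).
  rewrite !eshiftE !adlE lie_der lieBl lieZl [lie b (_ - _)]linearB /=.
  by rewrite [lie b (_ *: _)]linearZ /= scalerDl opprD addrACA.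
rewrite iter_lfunD; have -> := IHn p q.+1 (eshift (adl y) mu b) x le_n _ qx; last first.
  by rewrite -iterSr.
rewrite add0r -addSnnS; apply: IHn => //; first by move: le_n; rewrite addnS.
by rewrite -iterSr.
Qed.

(** A full-rank factorization [P Q] of an idempotent matrix satisfies [Q P = 1], so the trace is the
    rank. This gives the multiplicities in Cartan's criterion as natural numbers. *)
Lemma trace_proj (V : vectType C) (p : 'End(V)) :
  (forall v : V, p (p v) = p v) -> exists2 r : nat, ltr p = r%:R & r = 0%N -> p = 0.
Proof.
move=> pp; set e := vbasis {:V}; have eb : basis_of {:V} e := vbasisP _.
pose A := mxof e e p.
have AA : A *m A = A by rewrite -(mxof_comp _ _ eb); congr mxof; apply/lfunP=> x; rewrite comp_lfunE pp.
exists (\rank A); last first.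
  by move/eqP; rewrite mxrank_eq0 (mxof_eq0 eb eb) => /eqP.
rewrite /ltr -/A -{1}(mulmx_base A) mxtrace_mulC.
suff -> : row_base A *m col_base A = 1%:M by rewrite mxtrace1.
apply: (row_free_inj (row_base_free A)); rewrite mul1mx.
apply: (row_full_inj (col_base_full A)).
move: (col_base A) (row_base A) (mulmx_base A) => P Q PQ.
by rewrite !mulmxA PQ -mulmxA PQ AA.
Qed.

Lemma span_ind (V : vectType C) (X : seq V) (P : V -> Prop) :
  P 0 -> (forall k u v, P u -> P v -> P (k *: u + v)) ->
  (forall v, v \in X -> P v) -> forall v, v \in <<X>>%VS -> P v.
Proof.
move=> P0 PD PX v; rewrite -[X]/(tval (in_tuple X)) => /coord_span ->.
apply: (big_ind P) => // [u w Pu Pw|i _]; first by rewrite -[u]scale1r; apply: PD.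
by rewrite -[_ *: _]addr0; apply: PD => //; apply/PX/mem_nth.
Qed.

(* For [y] in [[I, I]], [y'] the operator acting by the conjugate of [a] on the generalized
   [a]-eigenspace of [ad y] satisfies [[y', ad b]] in [ad I] for [b] in [I], so
   [tr (ad y \o y') = 0]; this trace is the sum of the squared moduli of the
   eigenvalues of [ad y]. *)
Lemma cartan_nilp I y :
  lie_ideal I -> (forall a b, a \in I -> b \in I -> killing a b = 0) ->
  y \in lie_span I I -> lnilp (lie y).
Proof.
move=> idI kI yII; set f := adl y.
have [s [pi [us pi_sum pi_geig [k nil_pi] pi_stable]]] := geig_projections f.
pose op (c : C -> C) : 'End(L) := \sum_(a <- s) c a *: pi a.
have opE c x : op c x = \sum_(a <- s) c a *: pi a x.
  by rewrite sum_lfunE; apply: eq_bigr => a _; rewrite scale_lfunE.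
have op_geig c a m x : iter m (eshift f a) x = 0 -> op c x = c a *: x.
  move=> xa; rewrite opE [x in RHS]pi_sum scaler_sumr !big_seq; apply: eq_bigr => b sb.
  rewrite (pi_geig _ _ _ xa _ sb); case: eqP => [->//|_]; rewrite !scaler0 //.
pose S := op id; pose S' := op Num.conj.
have eq_geig (g h : 'End(L)) : (forall a m x, iter m (eshift f a) x = 0 -> g x = h x) -> g = h.
  move=> gh; apply/lfunP=> x; rewrite [x]pi_sum !linear_sum !big_seq.
  by apply: eq_bigr => a sa; apply: (gh a k); apply: nil_pi.
have S'f x : S' (f x) = f (S' x).
  suff /lfunP/(_ x) : (S' \o f)%VF = (f \o S')%VF by rewrite !comp_lfunE.
  apply: eq_geig => a m z za; rewrite !comp_lfunE (op_geig _ _ _ _ za) linearZ /=.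
  apply: (op_geig _ a m); have fE w : f w = eshift f a w + a *: w by rewrite eshiftE subrK.
  by rewrite fE iter_lfunD iter_lfunZ za scaler0 addr0 -iterSr /= za linear0.
have ad_bar b : b \in I -> exists2 b', b' \in I &
    ((adl b \o S') - (S' \o adl b) = adl b')%VF.
  (* Bracketing with a component of [b] of eigenvalue [c] turns the eigenvalue [a] into [c + a].
     Conjugation is additive, so the commutator with [S'] multiplies that component by [- c^*]. *)
  move=> bI; exists (- \sum_(a <- s) a^* *: pi a b).
    rewrite rpredN big_seq rpred_sum // => a sa; rewrite rpredZ //.
    by apply: pi_stable => // z zI; rewrite adlE; apply: idI.
  apply: eq_geig => a m x xa; rewrite add_lfunE opp_lfunE !comp_lfunE !adlE.
  have def_b : lie b x = \sum_(c <- s) lie (pi c b) x by rewrite {1}[b]pi_sum lie_suml.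
  have S'b : S' (lie b x) = \sum_(c <- s) (c + a)^* *: lie (pi c b) x.
    rewrite def_b linear_sum !big_seq; apply: eq_bigr => c sc /=.
    exact: op_geig (geig_lie (nil_pi _ _ sc) xa).
  rewrite (op_geig _ _ _ _ xa) linearZ /= S'b def_b scaler_sumr -sumrB lieNl lie_suml.
  rewrite -sumrN; apply: eq_bigr => c _.
  by rewrite lieZl rmorphD scalerDl opprD addrC subrK.
(* For [z = [a, b]], cyclicity of the trace turns [tr (ad z \o S')] into [tr (ad a \o [ad b, S'])],
   which is [killing a b']. *)
have trS' : ltr (f \o S')%VF = 0.
  suff trS z : z \in lie_span I I -> ltr (adl z \o S')%VF = 0 by apply: trS.
  apply: (span_ind (P := fun z => ltr (adl z \o S')%VF = 0)).
  - by rewrite linear0 comp_lfun0l linear0.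
  - move=> c u v u0 v0.
    by rewrite linearP /= comp_lfunDl -comp_lfunZl linearP /= u0 v0 mulr0 addr0.
  move=> _ /allpairsP[[a b] /= [/vbasis_mem aI /vbasis_mem bI ->]].
  have [b' b'I def_b'] := ad_bar b bI.
  have := kI a b' aI b'I; rewrite /killing -def_b' adl_lie comp_lfunDr comp_lfunDl.
  rewrite comp_lfunNl comp_lfunNr !linearD !linearN /= !comp_lfunA => <-.
  by rewrite -(comp_lfunA (adl b)) (ltr_comp (adl b)).
have SS' : (S \o S' = op (fun a => a * a^*))%VF.
  apply: eq_geig => a m x xa; rewrite !comp_lfunE !(op_geig _ _ _ _ xa) linearZ /=.
  by rewrite (op_geig _ _ _ _ xa) scalerA mulrC.
(* [f = S + N] is the Jordan decomposition. [S'] commutes with the nilpotent [N], so their product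
   has trace 0 and [tr (f \o S')] equals [tr (S \o S')]. *)
pose N : 'End(L) := f - S.
have N_geig a m x : iter m (eshift f a) x = 0 -> iter m N x = 0.
  move=> xa; suff -> : iter m N x = iter m (eshift f a) x by [].
  have: forall j, iter j N x = iter j (eshift f a) x.
    elim=> //= j ->; rewrite add_lfunE opp_lfunE eshiftE; congr (_ - _).
    by apply: (op_geig _ a m); rewrite -iterD addnC iterD xa iter_lfun0.
  exact.
have nilN : lnilp N.
  exists k => x; rewrite [x]pi_sum iter_lfun_sum big_seq big1 // => a sa.
  exact: N_geig (nil_pi _ _ sa).
have S'N x : S' (N x) = N (S' x).
  rewrite !add_lfunE !opp_lfunE linearB /= S'f; congr (_ - _).
  suff /lfunP/(_ x) : (S' \o S)%VF = (S \o S')%VF by rewrite !comp_lfunE.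
  apply: eq_geig => a m z za; rewrite !comp_lfunE !(op_geig _ _ _ _ za) !linearZ /=.
  by rewrite !(op_geig _ _ _ _ za) !scalerA mulrC.
have tr0 : ltr (op (fun a => a * a^*)) = 0.
  rewrite -SS'; have -> : (S \o S' = (f \o S') - (N \o S'))%VF.
    by apply/lfunP=> x; rewrite add_lfunE opp_lfunE !comp_lfunE add_lfunE opp_lfunE opprB addrC subrK.
  by rewrite linearB /= trS' ltr_comp (ltr_nilp (comm_nilp_comp S'N nilN)) subrr.
have {tr0} s0 a : a \in s -> a = 0 \/ pi a = 0.
  move: tr0; rewrite /op linear_sum /= big_seq => tr0 sa.
  have projP b : b \in s -> exists2 r : nat, ltr (pi b) = r%:R & r = 0%N -> pi b = 0.
    by move=> sb; apply: trace_proj => x; rewrite (pi_geig b k) ?nil_pi // eqxx.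
  have ge0 b : b \in s -> 0 <= ltr ((b * b^*) *: pi b).
    move=> sb; have [r tr_b _] := projP b sb.
    by rewrite linearZ /= tr_b mulr_ge0 ?mul_conjC_ge0 ?ler0n.
  move/eqP: tr0; rewrite psumr_eq0 // => /allP/(_ a sa); rewrite sa /= linearZ /=.
  have [r -> r0] := projP a sa.
  by rewrite mulf_eq0 mul_conjC_eq0 pnatr_eq0 => /orP[/eqP|/eqP/r0]; [left|right].
exists k => x; have -> : iter k (lie y) x = iter k f x.
  by elim: k {nil_pi nilN} => //= k ->; rewrite adlE.
rewrite [x]pi_sum iter_lfun_sum big_seq big1 // => a sa.
have [a0|->] := s0 a sa; last by rewrite zero_lfunE iter_lfun0.
have f0 : eshift f 0 = f by rewrite /eshift scale0r subr0.
by rewrite -{1}f0 -a0 nil_pi.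
Qed.

(** The radical of the Killing form is an ideal. Its derived series stabilizes at a perfect ideal,
    which consists of ad-nilpotent elements by Cartan's criterion and is zero by Engel. The radical
    is therefore a solvable ideal. *)
Lemma killing_nondegenerate x :
  lie_semisimple L -> (forall y, killing x y = 0) -> x = 0.
Proof.
move=> ssL kx; have kC := @killingC _ L; have kP := @killingP _ L.
pose I0 := lker (linfun (gram (@killing _ L) fullv)).
have memI0 u : (u \in I0) <-> forall y, killing u y = 0.
  rewrite memv_ker gramE //; split=> [/eqP/(gram0 kC kP) ku y|ku].
    by rewrite killingC ku ?memvf.
  by apply/eqP/(gram0 kC kP) => y _; rewrite killingC.
have idI0 : lie_ideal I0.
  move=> u v /memI0 kv; apply/memI0 => y.
  by rewrite killing_lieC kv oppr0.
pose D k := iter k (fun U => lie_span U U) I0.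
have idD k : lie_ideal (D k) by elim: k => //= k; apply: lie_span_ideal.
have leD k : (D k.+1 <= D k)%VS by apply: lie_span_sub => u v _; apply: idD.
have DI0 k : (D k <= I0)%VS by elim: k => // k; apply: subv_trans (leD k).
suff solI0 : lie_solvable I0.
  by apply/eqP; rewrite -memv0 -(ssL _ idI0 solI0); apply/memI0.
(* The dimension cannot drop strictly more than [\dim I0] times. *)
have [k Dk] : exists k, D k.+1 = D k.
  have: forall n, (exists k, D k.+1 = D k) \/ (\dim (D n) + n <= \dim I0)%N.
    elim=> [|n [|le_n]]; [by right; rewrite addn0 | by left |].
    have [eqD|neqD] := eqVneq (D n.+1) (D n); first by left; exists n.
    right; apply: leq_trans le_n; rewrite addnS ltn_add2r.
    by rewrite ltn_neqAle dimvS // andbT; apply: contra neqD => /eqP eq_d; rewrite eqEdim leD eq_d /=.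
  case/(_ (\dim I0).+1) => // le_dim.
  by move: (leq_trans (leq_addl _ _) le_dim); rewrite ltnn.
exists k; apply: engel_perfect => // [u v _|u]; first exact: idD.
rewrite -[iter _ _ _]/(D k) -Dk => /cartan_nilp; apply; first exact: idD.
by move=> a b /(subvP (DI0 k))/memI0 ka _.
Qed.

End CartanCriterion.

(** * Gradings and their degree elements *)

Section Gradings.
Variables (R : realType) (L : lieAlgType R[i]).
Implicit Types (U W : {vspace L}) (h x y z e : L) (a b : R) (s : seq R).
Local Notation rc := (real_complex R).

Definition gr h a : {vspace L} := lker (eshift (adl h) (rc a)).

Lemma grP h a x : reflect (lie h x = rc a *: x) (x \in gr h a).
Proof. by rewrite memv_ker eshiftE adlE subr_eq0; apply: eqP. Qed.

Lemma rc_inj : injective rc. Proof. exact: complexI. Qed.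

Lemma gr_lie h a b x y : x \in gr h a -> y \in gr h b -> lie x y \in gr h (a + b).
Proof.
move=> /grP hx /grP hy; apply/grP.
by rewrite lie_der hx hy lieZl linearZ /= rmorphD scalerDl.
Qed.

Lemma gr_unique h a b x : x \in gr h a -> x \in gr h b -> a != b -> x = 0.
Proof.
move=> /grP hx /grP/eqP; rewrite hx -subr_eq0 -scalerBl scaler_eq0 subr_eq0.
by rewrite (inj_eq rc_inj) => /orP[->//|/eqP].
Qed.

Lemma adl_gr_stable h g a : lie h g = 0 -> stable (adl g) (gr h a).
Proof.
by move=> hg x /grP hx; rewrite adlE; apply/grP; rewrite lie_der hg lie0l add0r hx linearZ.
Qed.

Lemma gr_comp_mem h s U (c : R -> L) : uniq s -> stable (adl h) U ->
  (forall a, a \in s -> c a \in gr h a) -> \sum_(a <- s) c a \in U ->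
  forall a, a \in s -> c a \in U.
Proof.
move=> us hU cW sumU; apply: joint_eigen_mem us _ sumU => a b sa sb ab.
exists (adl h), rc; split=> // [d sd|]; last by rewrite (inj_eq rc_inj).
by rewrite adlE; apply/grP/cW.
Qed.

Lemma gr_comp0 h s (c : R -> L) : uniq s ->
  (forall a, a \in s -> c a \in gr h a) -> \sum_(a <- s) c a = 0 ->
  forall a, a \in s -> c a = 0.
Proof.
move=> us cW sum0 a sa; apply/eqP; rewrite -memv0.
apply: (gr_comp_mem (h := h)) us _ cW _ a sa => [x|]; last by rewrite sum0 mem0v.
by rewrite !memv0 => /eqP->; rewrite linear0.
Qed.

(** [s] may contain values with zero eigenspace. This leaves room for lists produced by sums and
    images, with no pruning. *)
Definition spec h s := uniq s /\ (\sum_(a <- s) gr h a)%VS = fullv.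

Lemma spec_dec h s U x : spec h s -> stable (adl h) U -> x \in U ->
  exists2 c : R -> L, (forall a, c a \in (gr h a :&: U)%VS) & x = \sum_(a <- s) c a.
Proof.
move=> [us full] hU Ux; have : x \in (\sum_(a <- s) gr h a)%VS by rewrite full memvf.
case/(memv_sum_seq us) => c cW def_x.
exists (fun a => if a \in s then c a else 0).
  move=> a; case: ifP => sa; last by rewrite mem0v.
  by rewrite memv_cap cW; apply: (gr_comp_mem us hU) sa; rewrite -?def_x // => b _.
by rewrite def_x !big_seq; apply: eq_bigr => a ->.
Qed.

Lemma stable_fullv (T : 'End(L)) : stable T fullv.
Proof. by move=> x _; rewrite memvf. Qed.

Lemma gr_notin h s a : spec h s -> a \notin s -> gr h a = 0%VS.
Proof.
move=> sp nsa; apply/eqP; rewrite -subv0; apply/subvP=> x xa; rewrite memv0.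
have hU : stable (adl h) (gr h a) by apply: adl_gr_stable; rewrite liexx.
have [c cW ->] := spec_dec sp hU xa; rewrite big_seq big1 // => b sb.
have /memv_capP[cb ca] := cW b; apply: gr_unique cb ca _.
by apply: contraNneq nsa => <-.
Qed.

Lemma spec_grading h s : spec h s -> is_grading (gr h).
Proof.
move=> sp; split; last by move=> a b x y; apply: gr_lie.
split=> [s' us'|x]; last by exists s; case: sp => _ ->; rewrite memvf.
apply: directv_seq => // v vW s'' us'' sum0; apply: (gr_comp0 us'') sum0 => a _.
exact: vW.
Qed.

Definition goodh e h := [/\ e \in gr h 2,
  forall j x, j <= -1 -> x \in gr h j -> lie e x = 0 -> x = 0 &
  forall j y, -1 <= j -> y \in gr h (j + 2) -> exists2 x, x \in gr h j & lie e x = y].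

Lemma goodh_good e h s : spec h s -> goodh e h -> good_grading e (gr h).
Proof.
move=> sp [e2 inj_e surj_e]; split; [exact: spec_grading sp | exact: e2 | | ].
  move=> j lej x y xj yj exy; apply/eqP; rewrite -subr_eq0; apply/eqP.
  by apply: (inj_e j _ lej); [exact: rpredB | rewrite linearB /= exy subrr].
by move=> j lej y yj; apply: surj_e.
Qed.

(** Choose [h] representing [x |-> tr (D \o ad x)]. Then [E = D - ad h] is a derivation with
    [tr (E \o ad z) = 0] for every [z], and [killing (E x) y = tr (E \o ad [x, y]) = 0]. *)
Lemma derivation_inner (D : 'End(L)) : lie_semisimple L ->
  (forall x y, D (lie x y) = lie (D x) y + lie x (D y)) ->
  exists h, forall x, D x = lie h x.
Proof.
move=> ss_L derD; pose l x := ltr (D \o adl x)%VF.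
have lP k x y : l (k *: x + y) = k * l x + l y.
  by rewrite /l linearP /= comp_lfunDr -comp_lfunZr linearP.
have nondeg y : y \in fullv -> (forall x, x \in fullv -> killing x y = 0) -> y = 0.
  move=> _ ky; apply: killing_nondegenerate => // x.
  by rewrite killingC ky ?memvf.
have [h _ hl] := form_riesz (@killingC _ L) (@killingP _ L) lP nondeg.
exists h => x; apply/eqP; rewrite -subr_eq0; apply/eqP.
pose E := D - adl h.
have Ex z : E z = D z - lie h z by rewrite add_lfunE opp_lfunE adlE.
have trE z : ltr (E \o adl z)%VF = 0.
  rewrite /E comp_lfunDl comp_lfunNl linearD linearN /= -[ltr (D \o _)%VF]/(l z).
  by rewrite -hl ?memvf // killingC subrr.
have derE y z : E (lie y z) = lie (E y) z + lie y (E z).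
  rewrite !Ex derD lie_der lieBl linearB /= opprD addrACA; congr (_ + _).
have adE y : adl (E y) = ((E \o adl y) - (adl y \o E))%VF.
  apply/lfunP=> z; rewrite add_lfunE opp_lfunE !comp_lfunE !adlE derE addrK //.
rewrite -Ex; clearbody E; apply: killing_nondegenerate => // y.
have := trE (lie x y); rewrite /killing adE adl_lie comp_lfunDl comp_lfunDr.
rewrite comp_lfunNl comp_lfunNr !linearD !linearN /= !comp_lfunA => <-.
by rewrite -(comp_lfunA (adl x)) (ltr_comp (adl x)).
Qed.

Lemma grading_elem (Gamma : R -> {vspace L}) : lie_semisimple L ->
  is_grading Gamma -> exists h s, spec h s /\ forall a, Gamma a = gr h a.
Proof.
move=> ss_L [[dir span] gr_Gamma].
(* The degrees occurring in the decompositions of a basis suffice, so only finitely many real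
   degrees matter. *)
have [s [us full]] : exists s, uniq s /\ (\sum_(a <- s) Gamma a)%VS = fullv.
  have spanX (X : seq L) : exists s, forall x, x \in X -> x \in (\sum_(a <- s) Gamma a)%VS.
    elim: X => [|x X [s sX]]; first by exists [::] => x; rewrite in_nil.
    have [s' xs'] := span x; exists (s' ++ s) => y; rewrite big_cat inE => /orP[/eqP->|/sX].
      exact: (subvP (addvSl _ _)).
    exact: (subvP (addvSr _ _)).
  have [s sX] := spanX (vbasis {:L}).
  exists (undup s); rewrite undup_uniq sumv_undup; split=> //; apply/eqP.
  by rewrite eqEsubv subvf -(span_basis (vbasisP {:L})); apply/span_subvP.
have cap0 a r : uniq (a :: r) -> (Gamma a :&: \sum_(b <- r) Gamma b = 0)%VS.
  by move=> uar; apply/directv_seq_cap/dir.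
have Gamma0 a : a \notin s -> Gamma a = 0%VS.
  by move=> nsa; rewrite -(cap0 a s) /= ?nsa // full capvf.
pose pi a := daddv_pi (Gamma a) (\sum_(b <- rem a s) Gamma b)%VS.
have capr a : (Gamma a :&: \sum_(b <- rem a s) Gamma b = 0)%VS.
  by apply: cap0; rewrite /= mem_rem_uniqF // rem_uniq.
have pi_id a x : x \in Gamma a -> pi a x = x.
  by move=> xa; rewrite /pi daddv_pi_id.
have pi_0 a b x : b \in s -> b != a -> x \in Gamma b -> pi a x = 0.
  move=> sb ba xb; have xr : x \in (\sum_(b <- rem a s) Gamma b)%VS.
    by apply: (subvP (sumv_seq_sup (P := xpredT) _ _ isT)) xb; rewrite mem_rem_uniq // inE ba.
  exact: daddv_pi0.
pose D : 'End(L) := \sum_(a <- s) rc a *: pi a.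
have DE a x : x \in Gamma a -> D x = rc a *: x.
  move=> xa; rewrite sum_lfunE; have [sa|nsa] := boolP (a \in s); last first.
    move: xa; rewrite Gamma0 // memv0 => /eqP->; rewrite scaler0 big1 // => b _.
    by rewrite linear0.
  rewrite (sum_seq_single us sa) => [|b sb ba]; rewrite scale_lfunE; first by rewrite pi_id.
  by rewrite (pi_0 b a x sa) ?scaler0 // eq_sym.
have dec x : exists2 c : R -> L, (forall a, c a \in Gamma a) & x = \sum_(a <- s) c a.
  by apply: memv_sum_seq; rewrite ?full ?memvf.
have [h hD] : exists h, forall x, D x = lie h x.
  apply: derivation_inner => // x y.
  have derD_hom a z : z \in Gamma a -> D (lie z y) = lie (D z) y + lie z (D y).
    move=> za; have [d dW ->] := dec y.
    rewrite (linear_sum D) !(linear_sum (lie _)) (linear_sum D) -big_split /=.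
    apply: eq_bigr => b _; have yb := dW b.
    by rewrite (DE (a + b)) ?gr_Gamma // (DE a) // (DE b) // rmorphD scalerDl lieZl linearZ.
  have [c cW def_x] := dec x.
  rewrite def_x lie_suml !(linear_sum D) !lie_suml -big_split /=.
  by apply: eq_bigr => a _; apply: (derD_hom a).
have sub_gr a : (Gamma a <= gr h a)%VS.
  by apply/subvP=> x xa; apply/grP; rewrite -hD (DE a).
have sp : spec h s.
  split=> //; apply/eqP; rewrite eqEsubv subvf -full; apply: subv_sum_seq => a sa _.
  exact: subv_trans (sub_gr a) (sumv_seq_sup (P := xpredT) _ sa isT).
exists h, s; split=> // a; apply/eqP; rewrite eqEsubv sub_gr; apply/subvP=> x xa.
have hU : stable (adl h) (gr h a) by apply: adl_gr_stable; rewrite liexx.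
have [c cW def_x] := dec x.
have cg b : b \in s -> c b \in gr h b by move=> _; apply: (subvP (sub_gr b)).
have ca b : b \in s -> c b \in gr h a.
  by apply: (gr_comp_mem us hU cg); rewrite -def_x.
rewrite def_x big_seq rpred_sum // => b sb.
have [<-//|ab] := eqVneq b a.
by rewrite (gr_unique (cg b sb) (ca b sb) ab) mem0v.
Qed.

Lemma good_goodh e (Gamma : R -> {vspace L}) : lie_semisimple L ->
  good_grading e Gamma -> exists h s, [/\ spec h s, goodh e h & Gamma = gr h].
Proof.
move=> ss_L [grG eG inj_e surj_e]; have [h [s [sp eqG]]] := grading_elem ss_L grG.
have {eqG} eqG : Gamma = gr h by apply/funext.
exists h, s; split=> //; rewrite /goodh -eqG; split; first exact: eG.
  move=> j x lej xj ex0; apply: (inj_e j lej); rewrite ?mem0v //.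
  by rewrite ex0 linear0.
by move=> j y lej yj; apply: surj_e.
Qed.

End Gradings.

(** * Truncations of stable subspaces by degree *)

Section Truncations.
Variables (R : realType) (L : lieAlgType R[i]).
Implicit Types (U W m : {vspace L}) (h x y z e : L) (a b : R) (s : seq R) (P : pred R).
Local Notation rc := (real_complex R).

Lemma killing_gr h a b x y : x \in gr h a -> y \in gr h b -> a + b != 0 -> killing x y = 0.
Proof.
move=> /grP hx /grP hy nz; have := killing_lieC h x y.
rewrite hx hy linearZ /= killingC linearZ /= (killingC y x) => /eqP.
rewrite -addr_eq0 -mulrDl mulf_eq0 -rmorphD /=.
by rewrite -(rmorph0 rc) (inj_eq (@rc_inj R)) (negPf nz) => /eqP.
Qed.

Definition specm m h s := uniq s /\ (m <= \sum_(a <- s) (gr h a :&: m))%VS.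

(** The conditions [0 <= a] and [0 < a] give the spaces [q] and [u]. The conditions [b < a] give the
    filtration along which components are removed. *)
Definition trm m h s P : {vspace L} := (\sum_(a <- s | P a) (gr h a :&: m))%VS.

Lemma spec_specm h s m : spec h s -> stable (adl h) m -> specm m h s.
Proof.
move=> sp hm; split; first by case: sp.
apply/subvP=> x xm; have [c cW ->] := spec_dec sp hm xm.
by apply: (memv_sum_seqr (P := xpredT)) => a _ _; apply: cW.
Qed.

Lemma specm_dec m h s x : specm m h s -> x \in m ->
  exists2 c : R -> L, (forall a, c a \in (gr h a :&: m)%VS) & x = \sum_(a <- s) c a.
Proof. by move=> [us full] /(subvP full); apply: memv_sum_seq. Qed.

Lemma specm_notin m h s a : specm m h s -> a \notin s -> (gr h a :&: m = 0)%VS.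
Proof.
move=> sp nsa; apply/eqP; rewrite -subv0; apply/subvP=> x /memv_capP[xa xm]; rewrite memv0.
have hU : stable (adl h) (gr h a) by apply: adl_gr_stable; rewrite liexx.
have [c cW def_x] := specm_dec sp xm; rewrite def_x big_seq big1 // => b sb.
have cb d : d \in s -> c d \in gr h d by have /memv_capP[] := cW d.
have ca : c b \in gr h a by apply: (gr_comp_mem (proj1 sp) hU cb) => //; rewrite -def_x.
by apply: gr_unique (cb b sb) ca _; apply: contraNneq nsa => <-.
Qed.

Lemma trm_sub m h s P : (trm m h s P <= m)%VS.
Proof. by apply: subv_sum_seq => a _ _; apply: capvSr. Qed.

Lemma trmS m h s P (Q : pred R) : (forall a, P a -> Q a) -> (trm m h s P <= trm m h s Q)%VS.
Proof.
move=> PQ; apply: subv_sum_seq => a sa /PQ Qa.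
exact: (sumv_seq_sup (fun a => gr h a :&: m)%VS sa Qa).
Qed.

Lemma trm_le m m' h s P : (m <= m')%VS -> (trm m h s P <= trm m' h s P)%VS.
Proof.
move=> mm'; apply: subv_sum_seq => a sa Pa.
exact: subv_trans (capvS (subvv _) mm') (sumv_seq_sup (fun a => gr h a :&: m')%VS sa Pa).
Qed.

Lemma mem_trm m h s P a x : specm m h s -> P a -> x \in gr h a -> x \in m -> x \in trm m h s P.
Proof.
move=> sp Pa xa xm; have xam : x \in (gr h a :&: m)%VS by rewrite memv_cap xa.
have [sa|nsa] := boolP (a \in s).
  exact: (subvP (sumv_seq_sup (fun a => gr h a :&: m)%VS sa Pa)).
by move: xam; rewrite (specm_notin sp nsa) memv0 => /eqP->; rewrite mem0v.
Qed.

Lemma trm_ind m h s P (Q : L -> Prop) : Q 0 -> (forall x y, Q x -> Q y -> Q (x + y)) ->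
  (forall a x, a \in s -> P a -> x \in gr h a -> x \in m -> Q x) ->
  forall x, x \in trm m h s P -> Q x.
Proof.
move=> Q0 QD Qgr; rewrite /trm; elim: s Qgr => [|a s IHs] Qgr x.
  by rewrite big_nil memv0 => /eqP->.
have {}IHs : forall x, x \in (\sum_(a <- s | P a) (gr h a :&: m))%VS -> Q x.
  by apply: IHs => b z sb; apply: Qgr; rewrite inE sb orbT.
rewrite big_cons; case: ifP => [Pa|_]; last exact: IHs.
case/memv_addP=> u /memv_capP[ua um] [w /IHs Qw ->]; apply: QD => //.
by apply: (Qgr a) => //; apply: mem_head.
Qed.

Lemma trm_lie m h s P (Q S : pred R) : specm m h s -> lie_stable m m ->
  (forall a b, P a -> Q b -> S (a + b)) ->
  forall x y, x \in trm m h s P -> y \in trm m h s Q -> lie x y \in trm m h s S.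
Proof.
move=> sp mm PQS x y xP yQ; elim/trm_ind: x / xP.
- by rewrite lie0l mem0v.
- by move=> u v uS vS; rewrite lieDl rpredD.
move=> a x _ Pa xa xm; elim/trm_ind: y / yQ.
- by rewrite linear0 mem0v.
- by move=> u v uS vS; rewrite linearD rpredD.
move=> b y _ Qb yb ym; 
exact: (mem_trm (P := S) sp (PQS a b Pa Qb) (gr_lie xa yb) (mm x y xm ym)).
Qed.

Lemma trm_cap m h s P a x : uniq s -> ~~ P a -> x \in gr h a -> x \in trm m h s P -> x = 0.
Proof.
move=> us nPa xa; rewrite /trm -big_filter => /(memv_sum_seq (filter_uniq P us))[c cW def_x].
have hU : stable (adl h) (gr h a) by apply: adl_gr_stable; rewrite liexx.
have cg b : c b \in gr h b by have /memv_capP[] := cW b.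
rewrite def_x big_seq big1 // => b sb.
have sumU : \sum_(d <- filter P s) c d \in gr h a by rewrite -def_x.
have ca : c b \in gr h a.
  exact: (gr_comp_mem (filter_uniq P us) hU (fun d _ => cg d) sumU sb).
apply: gr_unique (cg b) ca _; apply: contraNneq nPa => <-.
by move: sb; rewrite mem_filter => /andP[].
Qed.

(** Write [y = y0 + yp] with [y0] of degree 0 and [yp] of positive degrees. The part [yp] is
    orthogonal to [h] for degree reasons. The iterates of [ad y0] are the lowest-degree terms of
    those of [ad y], so [ad y0] is nilpotent. It commutes with [ad h], and the product has trace
    0. *)
Lemma killing_trm h s y : spec h s -> y \in trm fullv h s (fun a => 0 <= a) ->
  lnilp (lie y) -> killing h y = 0.
Proof.
move=> sp yq [K nil_y].
have h0 : h \in gr h 0 by apply/grP; rewrite liexx scale0r.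
have spf : specm fullv h s by apply: spec_specm => //; apply: stable_fullv.
have ff : lie_stable fullv (fullv : {vspace L}) by move=> u v _ _; rewrite memvf.
have [y0 y00 [yp yp0 def_y]] : exists2 y0, y0 \in gr h 0 &
    exists2 yp, yp \in trm fullv h s (fun a => 0 < a) & y = y0 + yp.
  elim/trm_ind: {nil_y}y / yq.
  - by exists 0; rewrite ?mem0v //; exists 0; rewrite ?mem0v ?addr0.
  - move=> u v [u0 u00 [up upp ->]] [v0 v00 [vp vpp ->]].
    exists (u0 + v0); first exact: rpredD.
    by exists (up + vp); [exact: rpredD | rewrite addrACA].
  move=> a x _; rewrite le_eqVlt => /orP[/eqP<- xa _|a0 xa _].
    by exists x => //; exists 0; rewrite ?mem0v ?addr0.
  by exists 0; rewrite ?mem0v //; exists x; rewrite ?add0r //; apply: mem_trm xa _; rewrite ?memvf.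
have nil_y0 : lnilp (adl y0).
  exists K => x; have [c cW ->] := spec_dec sp (stable_fullv _) (memvf x).
  rewrite iter_lfun_sum big_seq big1 // => a sa; have /memv_capP[xa _] := cW a.
  move: {c cW}(c a) xa => z za.
  have iter_y k : iter k (adl y0) z \in gr h a /\
      iter k (lie y) z - iter k (adl y0) z \in trm fullv h s (fun b => a < b).
    elim: k => [|k [IH0 IHp]] /=; first by rewrite subrr mem0v.
    rewrite adlE; split; first by have := gr_lie y00 IH0; rewrite add0r.
    set u := iter k (adl y0) z in IH0 IHp *; set v := iter k (lie y) z in IHp *.
    have -> : lie y v - lie y0 u = lie y0 (v - u) + lie yp ((v - u) + u).
      by rewrite subrK def_y lieDl linearB /= addrAC.
    have y0q : y0 \in trm fullv h s (pred1 0) by apply: (mem_trm spf _ y00 (memvf _)); apply: eqxx.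
    have uq : u \in trm fullv h s (pred1 a) by apply: (mem_trm spf _ IH0 (memvf _)); apply: eqxx.
    have S1 b d : pred1 0 b -> a < d -> a < b + d by move=> /eqP->; rewrite add0r.
    have S2 b d : 0 < b -> a < d -> a < b + d by move=> b0 ad; rewrite -[a]add0r ltrD.
    have S3 b d : 0 < b -> pred1 a d -> a < b + d by move=> b0 /eqP->; rewrite ltrDr.
    apply: rpredD; first exact: (trm_lie spf ff S1 y0q IHp).
    rewrite linearD; apply: rpredD; first exact: (trm_lie spf ff S2 yp0 IHp).
    exact: (trm_lie spf ff S3 yp0 uq).
  have [zK] := iter_y K; rewrite nil_y sub0r rpredN.
  by move=> /(trm_cap (proj1 spf) _ zK) ->; rewrite ?ltxx.
rewrite def_y linearD /= -[RHS]addr0; congr (_ + _).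
  apply: ltr_nilp; apply: comm_nilp_comp nil_y0 => x; rewrite !adlE lie_der.
  by move/grP: y00 => ->; rewrite rmorph0 scale0r lie0l add0r.
elim/trm_ind: yp / yp0 {def_y} => [|u v u0 v0|a x _ a0 xa _].
- by rewrite linear0.
- by rewrite linearD /= u0 v0 addr0.
by apply: killing_gr h0 xa _; rewrite add0r gt_eqF.
Qed.

End Truncations.

(** * sl2-triples *)

Section CommutatorNilpotent.
Variables (K : numFieldType) (V : vectType K) (A B C : 'End(V)).
Hypotheses (defC : forall x, C x = A (B x) - B (A x)) (AC : forall x, A (C x) = C (A x)).

Lemma iterA_C k x : iter k A (C x) = C (iter k A x).
Proof. by elim: k => //= k ->. Qed.

Lemma iter_AC k j x : iter k A (iter j C x) = iter j C (iter k A x).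
Proof. by elim: j => //= j <-; rewrite iterA_C. Qed.

Lemma iterA_B k x : iter k.+1 A (B x) = B (iter k.+1 A x) + k.+1%:R *: C (iter k A x).
Proof.
elim: k x => [|k IHk] x; first by rewrite /= defC scale1r addrC subrK.
have -> : iter k.+2 A (B x) = A (iter k.+1 A (B x)) by [].
rewrite IHk linearD linearZ /= -[A (iter k A x)]/(iter k.+1 A x).
have -> : A (B (iter k.+1 A x)) = B (A (iter k.+1 A x)) + C (iter k.+1 A x).
  by rewrite defC addrC subrK.
by rewrite AC -addrA -[k.+2%:R]natr1 scalerDl scale1r [C _ + _]addrC.
Qed.

(* If [A^(r+1) C^s = 0], then commuting with [B] and multiplying by [C^s]
   yields [A^r C^(2s+1) = 0]. *)
Lemma commutator_nilp : lnilp A -> lnilp C.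
Proof.
case=> r; suff main s : (forall x, iter r A (iter s C x) = 0) -> lnilp C by apply: (main 0%N).
elim: r s => [|r IHr] s; first by move=> Cs; exists s.
move=> ACs; apply: (IHr (s + s.+1)%N) => x.
set y := iter s C x; have AB : iter r.+1 A (B y) = r.+1%:R *: C (iter r A y).
  by rewrite iterA_B ACs linear0 add0r.
have : iter s C (iter r.+1 A (B y)) = 0 by rewrite -iter_AC ACs.
rewrite AB iter_lfunZ => /eqP; rewrite scaler_eq0 pnatr_eq0 /= => /eqP Cs0.
by rewrite iterD iterS iter_AC iterA_C -/y.
Qed.

End CommutatorNilpotent.

Section Nilpotency.
Variables (R : realType) (L : lieAlgType R[i]).
Implicit Types (U W m : {vspace L}) (h x y z e f : L) (a b : R) (s : seq R).
Local Notation rc := (real_complex R).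

Lemma iter_adl n k x : iter k (adl n) x = iter k (lie n) x.
Proof. by elim: k => //= k ->; rewrite adlE. Qed.

Lemma gr_iter h a b n k x : n \in gr h a -> x \in gr h b ->
  iter k (lie n) x \in gr h (k%:R * a + b).
Proof.
move=> na xb; elim: k => [|k IHk]; first by rewrite mul0r add0r.
by have := gr_lie na IHk; rewrite addrA -natr1 mulrDl mul1r [a + _]addrC.
Qed.

(** The degrees [k a + b] for [k <= size s] are distinct, so one of them is outside [s] and has zero
    eigenspace. *)
Lemma gr_nilp h s a n : spec h s -> a != 0 -> n \in gr h a -> lnilp (lie n).
Proof.
move=> sp nz_a na; exists (size s).+1 => x.
have [c cW ->] := spec_dec sp (@stable_fullv _ _ _) (memvf x).
rewrite -iter_adl iter_lfun_sum big1 // => b _; rewrite iter_adl.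
have /memv_capP[cb _] := cW b.
pose g (k : nat) := k%:R * a + b.
have [/allP all_s|/allPn[k]] := boolP (all [pred k | g k \in s] (iota 0 (size s).+1)).
  have ug : uniq (map g (iota 0 (size s).+1)).
    rewrite map_inj_uniq ?iota_uniq // => j k /addIr/(mulIf nz_a)/eqP.
    by rewrite eqr_nat => /eqP.
  have /(uniq_leq_size ug) : {subset map g (iota 0 (size s).+1) <= s}.
    by move=> _ /mapP[k /all_s gk ->].
  by rewrite size_map size_iota ltnn.
rewrite mem_iota add0n /= => lt_k nsk.
have k0 : iter k (lie n) (c b) = 0.
  by apply/eqP; rewrite -memv0 -(gr_notin sp nsk); apply: gr_iter.
by apply: (iter_le0 (ltnW lt_k) _ k0); rewrite linear0.
Qed.

Lemma killing_gr_comp h s a x y (c : R -> L) : spec h s ->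
  (forall b, c b \in gr h b) -> y = \sum_(b <- s) c b -> x \in gr h a ->
  killing x y = killing x (c (- a)).
Proof.
move=> sp cW -> xa; have us : uniq s by case: sp.
rewrite linear_sum /=; have [sa|nsa] := boolP (- a \in s).
  rewrite (bigD1_seq (- a)) //= big1 ?addr0 // => b ba.
  by apply: killing_gr xa (cW b) _; rewrite addrC addr_eq0.
have /eqP -> : c (- a) == 0 by have := cW (- a); rewrite (gr_notin sp nsa) memv0.
rewrite linear0 big_seq big1 // => b sb; apply: killing_gr xa (cW b) _.
by rewrite addrC addr_eq0; apply: contraNneq nsa => <-.
Qed.

End Nilpotency.

Section Sl2Triples.
Variables (R : realType) (L : lieAlgType R[i]).
Hypothesis ss_L : lie_semisimple L.
Implicit Types (U W m : {vspace L}) (h x y z e f : L) (a b : R) (s : seq R).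
Local Notation rc := (real_complex R).

Lemma killing_nondegf y : y \in fullv -> (forall x, x \in fullv -> killing x y = 0) -> y = 0.
Proof.
by move=> _ ky; apply: killing_nondegenerate => // x; rewrite killingC ky ?memvf.
Qed.

Lemma killing_biorth (S : {vspace L}) x :
  (forall y, (forall z, z \in S -> killing z y = 0) -> killing x y = 0) -> x \in S.
Proof.
move=> perp; apply: (form_biorth (@killingC _ L) (@killingP _ L) killing_nondegf (subvf S) (memvf x)).
by move=> y _; apply: perp.
Qed.

Definition sl2 e h f := [/\ lie h e = 2 *: e, lie h f = - (2 *: f) & lie e f = h].

(** [T = (ad e)^2] is self-adjoint, so [e] is in its image if it is orthogonal to its kernel, and
    only [v] of degree -2 matters. If [T v = 0], then [w = [e, v]] commutes with [e]. Hence [ad w]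
    is nilpotent by [commutator_nilp], and [w] has degree 0. Thus [0 = killing h w = killing [h, e]
    v = 2 killing e v]. *)
Lemma good_sl2 e h s : spec h s -> goodh e h ->
  exists f h0, [/\ f \in gr h (- 2), h0 \in gr h 0 & sl2 e h0 f].
Proof.
move=> sp [e2 inj_e surj_e].
have he : lie h e = 2 *: e by move/grP: e2 => ->; rewrite rmorph_nat.
pose T : 'End(L) := (adl e \o adl e)%VF.
have TE x : T x = lie e (lie e x) by rewrite comp_lfunE !adlE.
have T_gr a x : x \in gr h a -> T x \in gr h (2 + (2 + a)).
  by move=> xa; rewrite TE; exact: (gr_lie e2 (gr_lie e2 xa)).
have kT x y : killing (T x) y = killing x (T y).
  by rewrite !TE killing_lieC killing_lieC opprK.
have : e \in (T @: gr h (- 2))%VS.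
  apply: killing_biorth => y perp.
  have [c cW def_y] := spec_dec sp (@stable_fullv _ _ _) (memvf y).
  have cg b : c b \in gr h b by have /memv_capP[] := cW b.
  rewrite (killing_gr_comp sp cg def_y e2); set v := c (- 2).
  have v2 : v \in gr h (- 2) by apply: cg.
  have Tv : T v = 0.
    apply: killing_nondegf; rewrite ?memvf // => x _.
    have [d dW def_x] := spec_dec sp (@stable_fullv _ _ _) (memvf x).
    have dg b : d b \in gr h b by have /memv_capP[] := dW b.
    rewrite killingC (killing_gr_comp sp dg def_x (T_gr _ _ v2)) killingC.
    rewrite subrr addr0 -kT.
    have dT : T (d (- 2)) \in gr h 2 by have := T_gr _ _ (dg (- 2)); rewrite subrr addr0.
    rewrite -(killing_gr_comp sp cg def_y dT); apply: perp.
    exact: memv_img (dg (- 2)).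
  have nil_e : lnilp (adl e).
    have [k ek] := gr_nilp sp (lt0r_neq0 (ltr0Sn _ 1)) e2.
    by exists k => x; rewrite iter_adl ek.
  have w0 : lie e v \in gr h 0 by have := gr_lie e2 v2; rewrite subrr.
  have nil_w : lnilp (lie (lie e v)).
    have [x|x|k wk] := commutator_nilp (A := adl e) (B := adl v) (C := adl (lie e v)) _ _ nil_e.
    - by rewrite adl_lie add_lfunE opp_lfunE !comp_lfunE.
    - by rewrite !adlE lie_der -TE Tv lie0l add0r.
    by exists k => x; rewrite -iter_adl wk.
  have spf := spec_specm sp (@stable_fullv _ _ (adl h)).
  have wq : lie e v \in trm fullv h s (fun a => 0 <= a).
    exact: (mem_trm (P := fun a => 0 <= a) spf (lexx 0) w0 (memvf _)).
  have := killing_trm sp wq nil_w.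
  rewrite -killing_lie he; rewrite killingC linearZ /= killingC => /eqP.
  by rewrite mulf_eq0 pnatr_eq0 => /eqP.
case/memv_imgP => z z2; rewrite TE => def_e.
(* With [e = [e, [e, z]]], the factor -2 is forced by [[h0, e] = - [e, [e, f]] = 2 e]. *)
pose f := (- 2) *: z; pose h0 := lie e f.
have f2 : f \in gr h (- 2) by apply: rpredZ.
have h00 : h0 \in gr h 0 by have := gr_lie e2 f2; rewrite subrr.
have h0e : lie h0 e = 2 *: e.
  by rewrite lieC /h0 /f !lieZr -def_e scaleNr opprK.
exists f, h0; split; [exact: f2 | exact: h00 | split; [exact: h0e | | by []]].
have h0f : lie h0 f \in gr h (- 2) by have := gr_lie h00 f2; rewrite add0r.
(* Goodness makes [ad e] injective in degree -2. It kills [[h0, f] + 2 f], which gives the remaining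
   relation of the triple. *)
have le21 : - 2 <= - 1 :> R by rewrite lerN2 ler1n.
apply/eqP; rewrite -addr_eq0; apply/eqP.
apply: (inj_e _ _ le21 (rpredD h0f (rpredZ 2 f2))).
rewrite lieDr lie_der [lie e h0]lieC h0e lieNl lieZl -/h0 liexx addr0.
by rewrite [lie e (2 *: f)]lieZr -/h0 addNr.
Qed.

End Sl2Triples.

(** The analogue of [geig_span] for distinct roots. [T - b] acts on an [a]-eigenvector as the scalar
    [a - b], so preimages are explicit and true eigenvectors suffice. *)
Lemma eigen_span (C : closedFieldType) (V : vectType C) (T : 'End(V)) (U : {vspace V})
    (s : seq C) x :
  uniq s -> stable T U -> x \in U -> foldr (fun a => eshift T a) x s = 0 ->
  x \in (\sum_(a <- s) (lker (eshift T a) :&: U))%VS.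
Proof.
move=> + TU; elim/last_ind: s x => [|s b IHs] x; first by move=> _ _ /= ->; rewrite mem0v.
rewrite rcons_uniq foldr_rcons => /andP[nbs us] Ux gx0.
set W := fun a : C => (lker (eshift T a) :&: U)%VS.
have [c cW gx] := memv_sum_seq us (IHs _ us (eshift_stable _ TU Ux) gx0).
have cT a : T (c a) = a *: c a.
  by have /memv_capP[] := cW a; rewrite memv_ker eshiftE subr_eq0 => /eqP.
pose z := \sum_(a <- s) (a - b)^-1 *: c a.
have zW : z \in (\sum_(a <- s) W a)%VS.
  by apply: (memv_sum_seqr (P := xpredT)) => a _ _; apply: rpredZ.
have zU : z \in U by rewrite rpred_sum // => a _; have /memv_capP[_ ?] := cW a; apply: rpredZ.
have xz : x - z \in W b.
  apply/memv_capP; split; last exact: rpredB Ux zU.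
  rewrite memv_ker linearB /= gx subr_eq0; apply/eqP.
  rewrite /z linear_sum !big_seq; apply: eq_bigr => a sa /=.
  rewrite linearZ /= eshiftE cT -scalerBl scalerA mulVf ?scale1r // subr_eq0.
  by apply: contraNneq nbs => <-.
rewrite -[x](subrK z) addrC -cats1 big_cat big_seq1.
exact: memv_add zW xz.
Qed.

(** * Weights of a triple on the centralizer of [e] *)

Section Sl2Weights.
Variables (R : realType) (L : lieAlgType R[i]) (e h f : L).
Hypotheses (ss_L : lie_semisimple L) (triple : sl2 e h f) (nil_f : lnilp (lie f)).
Implicit Types (U W m : {vspace L}) (x y z : L) (a b : R) (s : seq R).
Local Notation rc := (real_complex R).

Lemma h_iter_f k x :
  lie h (iter k (lie f) x) = iter k (lie f) (lie h x) - (k.*2)%:R *: iter k (lie f) x.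
Proof.
have [_ hf _] := triple; elim: k => [|k IHk]; first by rewrite scale0r subr0.
rewrite !iterS lie_der hf IHk lieNl lieZl lieBr lieZr [X in X = _]addrC -addrA; congr (_ + _).
by rewrite -opprD -scalerDl doubleS -[k.*2.+2]addn2 natrD.
Qed.

(** Stated for arbitrary [x], not for weight vectors, since it serves to prove that [ad h] is
    diagonalizable on the kernel of [ad e]. *)
Lemma e_iter_f k x : lie e (iter k.+1 (lie f) x) =
  iter k.+1 (lie f) (lie e x) + k.+1%:R *: iter k (lie f) (lie h x - k%:R *: x).
Proof.
have [_ _ ef] := triple; elim: k => [|k IHk].
  by rewrite /= lie_der ef scale1r scale0r subr0 addrC.
rewrite [iter k.+2 _ x]iterS lie_der ef IHk lieDr lieZr -!iterS h_iter_f.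
have iterB j u (l : R[i]) v : iter j (lie f) (u - l *: v) = iter j (lie f) u - l *: iter j (lie f) v.
  by elim: j => //= j ->; rewrite lieBr lieZr.
rewrite !iterB addrCA; congr (_ + _).
set A := iter k.+1 _ (lie h x); set B := iter k.+1 _ x.
rewrite !scalerBr addrACA -{1}[A]scale1r -scalerDl nat1r -opprD !scalerA -scalerDl.
by rewrite -!natrM -natrD -muln2 -mulnDr [(k.+2 * _)%N]mulnC.
Qed.

Definition cent_e : {vspace L} := lker (adl e).

Lemma cent_eP x : reflect (lie e x = 0) (x \in cent_e).
Proof. by rewrite memv_ker adlE; apply: eqP. Qed.

Lemma cent_e_stable : stable (adl h) cent_e.
Proof.
have [he _ _] := triple; move=> x /cent_eP ex; rewrite adlE; apply/cent_eP.
by rewrite lie_der [lie e h]lieC he ex lie0r addr0 lieNl lieZl ex scaler0 oppr0.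
Qed.

(** On the kernel of [ad e], one has [e^K f^K = K! h (h - 1) ... (h - K + 1)]. When [f^K = 0], the
    operator [ad h] is annihilated there by a polynomial with the simple roots 0, ..., K - 1. *)
Lemma cent_e_weights : exists K, specm cent_e h [seq i%:R | i <- iota 0 K].
Proof.
have [K fK] := nil_f; exists K; split.
  by rewrite map_inj_uniq ?iota_uniq // => i j /eqP; rewrite eqr_nat => /eqP.
apply/subvP=> x xe; rewrite big_map.
have foldK k y : y \in cent_e ->
    iter k (lie e) (iter k (lie f) y) =
    (k`!)%:R *: foldr (fun l => eshift (adl h) l) y [seq i%:R | i <- iota 0 k].
  elim: k y => [|k IHk] y ye; first by rewrite scale1r.
  rewrite iterSr e_iter_f; move/cent_eP: (ye) => ->.
  have -> : iter k.+1 (lie f) 0 = 0 by rewrite -iter_adl iter_lfun0.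
  have -> : lie h y - k%:R *: y = eshift (adl h) k%:R y by rewrite eshiftE adlE.
  rewrite add0r -iter_adl iter_lfunZ iter_adl IHk ?eshift_stable //; last exact: cent_e_stable.
  have -> : iota 0 k.+1 = rcons (iota 0 k) k by rewrite -addn1 iotaD add0n cats1.
  by rewrite map_rcons foldr_rcons scalerA -natrM factS.
have := foldK K x xe; rewrite fK -iter_adl iter_lfun0 => /esym/eqP.
rewrite scaler_eq0 pnatr_eq0 (gtn_eqF (fact_gt0 K)) /= => /eqP fold0.
have us : uniq [seq i%:R : R[i] | i <- iota 0 K].
  by rewrite map_inj_uniq ?iota_uniq // => i j /eqP; rewrite eqr_nat => /eqP.
have xW := eigen_span us cent_e_stable xe fold0; rewrite big_map in xW.
have eqW i : (gr h i%:R :&: cent_e)%VS = (lker (eshift (adl h) i%:R) :&: cent_e)%VS.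
  by rewrite /gr rmorph_nat.
by rewrite (eq_bigr (fun i : nat => (lker (eshift (adl h) i%:R) :&: cent_e)%VS)).
Qed.

(** The centralizer of the whole triple, by [cent_eh_f]. *)
Definition cent_eh : {vspace L} := (cent_e :&: gr h 0)%VS.

Lemma cent_ehP x : reflect (lie e x = 0 /\ lie h x = 0) (x \in cent_eh).
Proof.
apply: (iffP memv_capP) => [[/cent_eP ex /grP hx]|[ex hx]].
  by rewrite ex hx rmorph0 scale0r.
by split; [apply/cent_eP | apply/grP; rewrite hx rmorph0 scale0r].
Qed.

Lemma cent_e_neg a x : a < 0 -> x \in gr h a -> x \in cent_e -> x = 0.
Proof.
move=> a0 xa xe; have [K spK] := cent_e_weights.
have nsa : a \notin [seq i%:R | i <- iota 0 K].
  by apply/mapP=> -[i _ eq_a]; move: a0; rewrite eq_a ltNge ler0n.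
have /memv_capP : x \in gr h a /\ x \in cent_e by split; [exact: xa | exact: xe].
by rewrite (specm_notin spK nsa) memv0 => /eqP.
Qed.

(** [[f, x]] commutes with [e] and has weight -2, while the weights on the kernel of [ad e] are
    nonnegative. *)
Lemma cent_eh_f x : x \in cent_eh -> lie f x = 0.
Proof.
have [he hf ef] := triple; case/cent_ehP => ex hx.
apply: (@cent_e_neg (- 2)); first by rewrite oppr_lt0 ltr0n.
  by apply/grP; rewrite lie_der hf hx lie0r addr0 lieNl lieZl rmorphN rmorph_nat scaleNr.
by apply/cent_eP; rewrite lie_der ef hx ex lie0r addr0.
Qed.

Lemma killing_cent_e x y : x \in cent_e -> y \in cent_eh ->
  (forall z, z \in cent_eh -> killing z y = 0) -> killing x y = 0.
Proof.
move=> xe /memv_capP[_ y0] perp; have [K spK] := cent_e_weights.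
have [c cW ->] := specm_dec spK xe; rewrite killingC linear_sum big1 // => a _.
have /memv_capP[ca ce] := cW a; rewrite /= killingC.
have [a0|nz_a] := eqVneq a 0; last by apply: (killing_gr ca y0); rewrite addr0.
by rewrite a0 in ca ce *; apply: perp; apply/memv_capP; split; [exact: ce | exact: ca].
Qed.

(* Such a [y] is orthogonal to the centralizer of [e], hence equal to [[e, z]]
   with [z] of weight -2; then [e f^(k+1) z = - (k+1)(k+2) f^k z], and the
   nilpotency of [f] gives [z = 0]. *)
Lemma killing_cent_eh_nondegenerate y : y \in cent_eh ->
  (forall x, x \in cent_eh -> killing x y = 0) -> y = 0.
Proof.
have [he hf ef] := triple; move=> yc perp; have [ey hy] := cent_ehP _ yc.
have fy := cent_eh_f yc.
have /memv_imgP[z _] : y \in (adl e @: fullv)%VS.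
  apply: killing_biorth => // t perp_t.
  have te : t \in cent_e.
    apply/cent_eP; apply: killing_nondegf; rewrite ?memvf // => u _.
    rewrite -[RHS]oppr0 -(perp_t (lie e u)); last by rewrite -adlE memv_img ?memvf.
    by rewrite killing_lieC opprK.
  by rewrite killingC; apply: killing_cent_e.
rewrite adlE => def_y; pose u := lie h z + 2 *: z.
have ue : u \in cent_e.
  apply/cent_eP; rewrite /u lieDr lieZr lie_der [lie e h]lieC he lieNl lieZl -def_y hy.
  by rewrite addr0 addNr.
have [K spK] := cent_e_weights; have [c cW def_u] := specm_dec spK ue.
set s := [seq _ | _ <- _] in spK def_u.
have s_ge0 a : a \in s -> rc (a + 2) != 0.
  case/mapP => i _ ->; rewrite -(rmorph0 rc) (inj_eq (@rc_inj R)).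
  by rewrite gt_eqF // ltr_wpDl ?ler0n ?ltr0n.
(* [ad h + 2] is invertible on the kernel of [ad e], whose weights are nonnegative. Subtracting the
   preimage of [u] gives [v] weight -2 without changing [[e, v] = y]. *)
pose v := z - \sum_(a <- s) (rc (a + 2))^-1 *: c a.
have ce a : lie e (c a) = 0 by have /memv_capP[_ /cent_eP] := cW a.
have ch a : lie h (c a) = rc a *: c a by have /memv_capP[/grP] := cW a.
have ev : lie e v = y.
  rewrite /v lieBr -def_y linear_sum big1 ?subr0 // => a _ /=.
  by rewrite lieZr ce scaler0.
have hv : lie h v = - (2 *: v).
  apply/eqP; rewrite -addr_eq0 /v lieBr scalerBr addrACA -opprD -/u def_u.
  rewrite linear_sum scaler_sumr -big_split /= subr_eq0; apply/eqP.
  rewrite !big_seq; apply: eq_bigr => a sa.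
  rewrite lieZr ch !scalerA -scalerDl -[LHS]scale1r; congr (_ *: _).
  have rcD : rc (a + 2) = rc a + 2 by rewrite rmorphD rmorph_nat.
  by rewrite [_ * rc a]mulrC -mulrDl -rcD divff ?s_ge0.
have fv k : iter k.+1 (lie f) v = 0 -> iter k (lie f) v = 0.
  move=> fk1; have := e_iter_f k v.
  rewrite fk1 lie0r ev hv -scaleNr -scalerBl.
  have -> : iter k.+1 (lie f) y = 0 by rewrite iterSr fy -iter_adl iter_lfun0.
  rewrite add0r -iter_adl iter_lfunZ scalerA => /esym/eqP.
  rewrite scaler_eq0 mulf_eq0 pnatr_eq0 -opprD oppr_eq0 -natrD pnatr_eq0 /=.
  by rewrite iter_adl => /eqP.
have v0 : v = 0.
  have [k] := nil_f; move/(_ v); elim: k => // k IHk /fv; exact: IHk.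
by rewrite -ev v0 lie0r.
Qed.

End Sl2Weights.

(** * Commuting conjugates *)

Lemma seq_min (R : realType) (l : seq R) :
  l != [::] -> exists2 a, a \in l & {in l, forall b, a <= b}.
Proof.
elim: l => // a [|b l] IHl _; first by exists a; rewrite ?mem_head // => c; rewrite inE => /eqP->.
have [//|c cl c_min] := IHl; have [le_ac|lt_ca] := leP a c.
  exists a; rewrite ?mem_head // => d; rewrite inE => /orP[/eqP-> //|/c_min].
  exact: le_trans.
exists c; first by rewrite inE cl orbT.
by move=> d; rewrite inE => /orP[/eqP->|/c_min//]; apply: ltW.
Qed.

Section Conjugation.
Variables (R : realType) (L : lieAlgType R[i]).
(** [act] stands for the operators of the adjoint group. [act_exp] asks of an exponential only that
    its terms of order at least 2 stay in any subspace containing the corresponding iterates. *)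
Variable act : 'End(L) -> Prop.
Hypotheses (act1 : act \1%VF)
  (actM : forall g k, act g -> act k -> act (g \o k)%VF)
  (actV : forall g, act g -> exists2 k, act k & cancel g k /\ cancel k g)
  (act_lie : forall g x y, act g -> g (lie x y) = lie (g x) (g y))
  (act_exp : forall h n (a : R), a != 0 -> n \in gr h a ->
     exists2 g, act g & forall x (U : {vspace L}),
       (forall k, iter k.+2 (lie n) x \in U) -> g x - x - lie n x \in U).
Implicit Types (U W m : {vspace L}) (h x y z e f : L) (a b : R) (s : seq R).
Implicit Types (g k : 'End(L)).
Local Notation rc := (real_complex R).

(* Exponentials of components of positive degree [a], in increasing order
   of [a], remove the components of [x] one after the other. *)
Lemma act_shift m h s b x : 0 <= b -> specm m h s -> lie_stable m m ->
  x \in trm m h s (fun a => b < a) ->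
  exists g, [/\ act g, g (h + x) = h &
    forall z, (forall n, n \in m -> lie n z = 0) -> g z = z].
Proof.
have [p le_p] := ubnP (size [seq a <- s | b < a]).
elim: p b x le_p => // p IHp b x; rewrite ltnS => le_p b0 sp mm xb.
have [l0|nz_l] := eqVneq [seq a <- s | b < a] [::].
  move: xb; rewrite /trm -big_filter l0 big_nil memv0 => /eqP->.
  by exists \1%VF; split=> // [|z _]; rewrite id_lfunE ?addr0.
have [a1 la1 a1_min] := seq_min nz_l.
have /andP[ba1 sa1] : (b < a1) && (a1 \in s) by rewrite -mem_filter.
have a1_gt0 : 0 < a1 := le_lt_trans b0 ba1.
have nz_a1 : rc a1 != 0 by rewrite -(rmorph0 rc) (inj_eq (@rc_inj R)) gt_eqF.
pose U := trm m h s (fun a => a1 < a).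
have [c c1 [r rU def_x]] : exists2 c, c \in (gr h a1 :&: m)%VS & exists2 r, r \in U & x = c + r.
  elim/trm_ind: x / xb => [|u v [c c1 [r rU ->]] [d d1 [q qU ->]]|a u sa ba ua um].
  - by exists 0; rewrite ?mem0v //; exists 0; rewrite ?mem0v ?addr0.
  - by exists (c + d); [exact: rpredD | exists (r + q); [exact: rpredD | rewrite addrACA]].
  have la : a \in [seq a <- s | b < a] by rewrite mem_filter ba.
  have := a1_min a la; rewrite le_eqVlt => /orP[/eqP eq_a|a1a].
    exists u; last by exists 0; rewrite ?mem0v ?addr0.
    by rewrite eq_a; apply/memv_capP; split; [exact: ua | exact: um].
  exists 0; first exact: mem0v.
  exists u; last by rewrite add0r.
  exact: (mem_trm (P := fun a => a1 < a) sp a1a ua um).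
have /memv_capP[cg cm] := c1.
(* Since [[n, h] = - a1 n = - c], the linear term of the exponential cancels the lowest component
   [c]. All other contributions have degree above [a1]. *)
pose n := (rc a1)^-1 *: c.
have n1 : n \in gr h a1 by apply: rpredZ.
have nm : n \in m by apply: rpredZ.
have hn : lie n h = - c.
  by rewrite lieC; move/grP: n1 => ->; rewrite scalerA divff ?scale1r.
have nc : lie n c = 0 by rewrite /n lieZl liexx scaler0.
have nU y : y \in trm m h s (fun a => b < a) -> lie n y \in U.
  have nT : n \in trm m h s (pred1 a1).
    by apply: (mem_trm (P := pred1 a1) sp _ n1 nm); apply: eqxx.
  apply: (trm_lie sp mm _ nT) => u v /eqP-> bv.
  by rewrite ltrDl (le_lt_trans b0 bv).
have Ub : (U <= trm m h s (fun a => (b < a)%R))%VS by apply: trmS => a; apply: lt_trans.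
have [g0 act_g0 g0P] := act_exp (lt0r_neq0 a1_gt0) n1.
have [x' x'U gx'] : exists2 x', x' \in U & g0 (h + x) = h + x'.
  have nx : lie n x \in U by apply: nU.
  have nUU y : y \in U -> lie n y \in U by move=> yU; apply: nU; apply: (subvP Ub).
  have nn j : iter j.+2 (lie n) (h + x) \in U.
    rewrite !iterSr lieDr hn lieDr lieNr nc oppr0 add0r.
    by elim: j => [|j IHj]; [exact: nUU | rewrite iterS; exact: nUU].
  have gU := g0P (h + x) U nn.
  exists (g0 (h + x) - h); last by rewrite addrCA subrr addr0.
  have xU : x + lie n (h + x) \in U.
    by rewrite lieDr hn {1}def_x addrACA subrr add0r; apply: rpredD.
  have := rpredD gU xU; rewrite [x + _]addrC addrA subrK.
  by rewrite opprD addrA subrK.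
have lt_size : (size [seq a <- s | (a1 < a)%R] < p)%N.
  have us1 : uniq (a1 :: [seq a <- s | a1 < a]).
    by rewrite /= mem_filter ltxx filter_uniq //; case: sp.
  have sub1 : {subset a1 :: [seq a <- s | a1 < a] <= [seq a <- s | b < a]}.
    move=> a; rewrite inE !mem_filter => /orP[/eqP->|/andP[a1a ->]].
      by rewrite ba1 sa1.
    by rewrite (lt_trans ba1 a1a).
  exact: leq_trans (uniq_leq_size us1 sub1) le_p.
have [g1 [act_g1 g1h g1z]] := IHp a1 x' lt_size (ltW a1_gt0) sp mm x'U.
exists (g1 \o g0)%VF; split; first exact: actM.
  by rewrite comp_lfunE gx'.
move=> z cz; rewrite comp_lfunE; suff -> : g0 z = z by apply: g1z.
have nz : lie n z = 0 by apply: cz.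
have : g0 z - z - lie n z \in 0%VS.
  by apply: g0P => j; rewrite !iterSr nz lie0r -iter_adl iter_lfun0 mem0v.
by rewrite memv0 nz subr0 subr_eq0 => /eqP.
Qed.

Lemma act_gr g h a x : act g -> x \in gr h a -> g x \in gr (g h) a.
Proof. by move=> ag /grP hx; apply/grP; rewrite -act_lie // hx linearZ. Qed.

Lemma act_spec g h s : act g -> spec h s -> spec (g h) s.
Proof.
move=> ag sp; split; first by case: sp.
apply/eqP; rewrite eqEsubv subvf; apply/subvP=> x _.
have [g' ag' [gK g'K]] := actV ag.
have [c cW def_x] := spec_dec sp (@stable_fullv _ _ _) (memvf (g' x)).
rewrite -[x]g'K def_x linear_sum; apply: (memv_sum_seqr (P := xpredT)) => a _ _ /=.
by have /memv_capP[ca _] := cW a; apply: act_gr ag ca.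
Qed.

Lemma act_goodh g e h : act g -> g e = e -> goodh e h -> goodh e (g h).
Proof.
move=> ag ge [e2 inj_e surj_e]; have [g' ag' [gK g'K]] := actV ag.
have g'e : g' e = e by rewrite -{1}ge gK.
split; first by rewrite -{1}ge; exact: (act_gr ag e2).
  move=> j x lej xj ex0; have := act_gr ag' xj; rewrite gK => g'xj.
  have := inj_e j (g' x) lej g'xj; rewrite -{1}g'e -act_lie // ex0 linear0.
  by move=> /(_ erefl) g'x0; rewrite -[x]g'K g'x0 linear0.
move=> j y lej yj; have := act_gr ag' yj; rewrite gK => g'yj.
have [x xj exy] := surj_e j (g' y) lej g'yj.
exists (g x); first exact: (act_gr ag xj).
by rewrite -{1}ge -act_lie // exy g'K.
Qed.

End Conjugation.

(** * Nilpotency and orthogonality of positive parts *)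

Section PositivePart.
Variables (R : realType) (L : lieAlgType R[i]).
Implicit Types (m : {vspace L}) (h x y : L) (a b : R) (s : seq R).

(** Each application of [ad y] moves the least degree present to a strictly larger element of the
    finite list [s]. *)
Lemma trm_pos_nilp h s y : spec h s ->
  y \in trm fullv h s (fun a => 0 < a) -> lnilp (lie y).
Proof.
move=> sp y0; have spf := spec_specm sp (@stable_fullv _ _ (adl h)).
have ff : lie_stable fullv (fullv : {vspace L}) by move=> u v _ _; rewrite memvf.
have step n b x : (size [seq a <- s | (b < a)%R] <= n)%N ->
    x \in trm fullv h s (fun a => b < a) -> iter n (lie y) x = 0.
  elim: n b x => [|n IHn] b x le_n xb.
    move: le_n xb; rewrite leqn0 size_eq0 /trm -big_filter => /eqP->.
    by rewrite big_nil memv0 => /eqP.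
  have [l0|nz_l] := eqVneq [seq a <- s | b < a] [::].
    move: xb; rewrite /trm -big_filter l0 big_nil memv0 => /eqP->.
    by rewrite -iter_adl iter_lfun0.
  have [a1 la1 a1_min] := seq_min nz_l.
  have /andP[ba1 sa1] : (b < a1) && (a1 \in s) by rewrite -mem_filter.
  have x1 : x \in trm fullv h s (fun a => a1 <= a).
    elim/trm_ind: x / xb => [|u v ux vx|a u sa ba ua um]; [exact: mem0v | exact: rpredD | ].
    apply: (mem_trm (P := fun a => a1 <= a) spf _ ua um).
    by apply: a1_min; rewrite mem_filter ba.
  have yx : lie y x \in trm fullv h s (fun a => a1 < a).
    apply: (trm_lie spf ff _ y0 x1) => a d a0 a1d.
    by rewrite (le_lt_trans a1d) // ltrDr.
  rewrite iterSr; apply: (IHn a1) yx; rewrite -ltnS; apply: leq_trans le_n.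
  have us1 : uniq (a1 :: [seq a <- s | a1 < a]).
    by rewrite /= mem_filter ltxx filter_uniq //; case: sp.
  have sub1 : {subset a1 :: [seq a <- s | a1 < a] <= [seq a <- s | b < a]}.
    move=> a; rewrite inE !mem_filter => /orP[/eqP->|/andP[a1a ->]].
      by rewrite ba1 sa1.
    by rewrite (lt_trans ba1 a1a).
  exact: (uniq_leq_size us1 sub1).
exists (size s).+1 => x; have [c cW ->] := spec_dec sp (@stable_fullv _ _ _) (memvf x).
rewrite -iter_adl iter_lfun_sum big1 // => a _; rewrite iter_adl iterSr.
have /memv_capP[ca cf] := cW a.
have c1 : c a \in trm fullv h s (pred1 a).
  by apply: (mem_trm (P := pred1 a) spf _ ca cf); apply: eqxx.
apply: (step _ a); first by rewrite size_filter count_size.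
by apply: (trm_lie spf ff _ y0 c1) => b d b0 /eqP->; rewrite ltrDr.
Qed.

(** A component of [y] of degree [a < 0] can pair nontrivially only with degree [- a > 0], where [y]
    is orthogonal to [m]. Nondegeneracy on [m] kills it. *)
Lemma perp_trm_pos m h s y : specm m h s ->
  (forall z, z \in m -> (forall x, x \in m -> killing x z = 0) -> z = 0) ->
  y \in m -> (forall x, x \in trm m h s (fun a => 0 < a) -> killing x y = 0) ->
  y \in trm m h s (fun a => 0 <= a).
Proof.
move=> sp nondeg ym perp; have [c cW def_y] := specm_dec sp ym.
have us : uniq s by case: sp.
have cg b : c b \in gr h b by have /memv_capP[] := cW b.
have cm b : c b \in m by have /memv_capP[] := cW b.
rewrite def_y big_seq rpred_sum // => a sa; have [a0|a0] := leP 0 a.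
  exact: (mem_trm (P := fun a => 0 <= a) sp a0 (cg a) (cm a)).
suff -> : c a = 0 by rewrite mem0v.
apply: nondeg (cm a) _ => x xm; have [d dW ->] := specm_dec sp xm.
rewrite killingC linear_sum big1 // => b _ /=; rewrite killingC.
have /memv_capP[dg dm] := dW b.
have [ab|nz_ab] := eqVneq (b + a) 0; last exact: (killing_gr dg (cg a) nz_ab).
have db : d b \in trm m h s (fun a => 0 < a).
  apply: (mem_trm (P := fun a => 0 < a) sp _ dg dm).
  by move/eqP: ab; rewrite addr_eq0 => /eqP->; rewrite oppr_gt0.
rewrite -(perp _ db) def_y linear_sum (sum_seq_single us sa) // => j _ ja /=.
apply: (killing_gr dg (cg j)); apply: contra ja => bj.
by rewrite -(inj_eq (addrI b)) ab.
Qed.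

End PositivePart.

Section CommutingConjugates.
Variables (R : realType) (L : lieAlgType R[i]).
Hypothesis ss_L : lie_semisimple L.
Variable act : 'End(L) -> Prop.
Hypotheses (act1 : act \1%VF)
  (actM : forall g k, act g -> act k -> act (g \o k)%VF)
  (actV : forall g, act g -> exists2 k, act k & cancel g k /\ cancel k g)
  (act_lie : forall g x y, act g -> g (lie x y) = lie (g x) (g y))
  (act_exp : forall h n (a : R), a != 0 -> n \in gr h a ->
     exists2 g, act g & forall x (U : {vspace L}),
       (forall k, iter k.+2 (lie n) x \in U) -> g x - x - lie n x \in U).
Implicit Types (U W m : {vspace L}) (h x y z e f : L) (a b : R) (s : seq R).
Implicit Types (g k : 'End(L)).
Local Notation rc := (real_complex R).

Lemma cent_e_sub e : lie_stable (cent_e e) (cent_e e).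
Proof.
move=> x y /cent_eP ex /cent_eP ey; apply/cent_eP.
by rewrite lie_der ex ey lie0l lie0r addr0.
Qed.

(** [h0' - h0 = [e, f' - f]] lies in the kernel and in the image of [ad e], which are orthogonal.
    Its component of weight 0 is thus orthogonal to [cent_eh], hence zero, and [act_shift] removes
    the positive components. *)
Lemma neutral_conj e h0 f h0' f' : sl2 e h0 f -> lnilp (lie f) -> sl2 e h0' f' ->
  exists g, [/\ act g, g e = e & g h0' = h0].
Proof.
move=> triple nil_f [h0'e _ ef']; have [h0e _ ef] := triple.
pose w := h0' - h0; have we : w \in cent_e e.
  by apply/cent_eP; rewrite lieBr lieC h0'e lieC h0e subrr.
have [K spK] := cent_e_weights triple nil_f; set s := [seq _ | _ <- _] in spK.
have us : uniq s by case: spK.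
have [c cW def_w] := specm_dec spK we.
have cg b := memv_capl (cW b); have ce b := memv_capr (cW b).
have c0 : c 0 = 0.
  have c0c : c 0 \in cent_eh e h0 by apply/memv_capP; split; [exact: ce | exact: cg].
  apply: (killing_cent_eh_nondegenerate ss_L triple nil_f c0c) => x /memv_capP[xe x0].
  have [s0|ns0] := boolP (0 \in s); last first.
    have /memv_capP := conj (cg 0) (ce 0).
    by rewrite (specm_notin spK ns0) memv0 => /eqP->; rewrite linear0.
  have <- : killing x w = killing x (c 0).
    rewrite def_w linear_sum (sum_seq_single us s0) // => b _ nz_b.
    by apply: (killing_gr x0 (cg b)); rewrite add0r.
  rewrite killingC /w -ef -ef' -lieBr killing_lieC.
  by move/cent_eP: xe => ->; rewrite linear0 oppr0.
have w_pos : w \in trm (cent_e e) h0 s (fun a => 0 < a).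
  rewrite def_w big_seq rpred_sum // => a sa.
  have [a0|nz_a] := eqVneq a 0; first by rewrite a0 c0 mem0v.
  apply: (mem_trm (P := fun a => 0 < a) spK _ (cg a) (ce a)).
  by rewrite lt_neqAle eq_sym nz_a; case/mapP: sa => i _ ->; rewrite ler0n.
have [g [ag gh gz]] := act_shift act1 actM act_exp (lexx 0) spK (@cent_e_sub e) w_pos.
exists g; split=> //; last by rewrite -gh /w addrC subrK.
by apply: gz => n /cent_eP en; rewrite lieC en oppr0.
Qed.

Section Centralizer.
Variables (e h0 f : L).
Hypotheses (triple : sl2 e h0 f) (nil_f : lnilp (lie f)).
Let c := cent_eh e h0.

Definition neutral h := lie h h0 = 0 /\ lie h e = 2 *: e.

Lemma cent_lie_h0 x : x \in c -> lie h0 x = 0.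
Proof. by case/cent_ehP. Qed.

Lemma cent_sub : lie_stable c c.
Proof.
move=> x y /cent_ehP[ex hx] /cent_ehP[ey hy]; apply/cent_ehP.
by split; rewrite lie_der ?ex ?ey ?hx ?hy lie0l lie0r addr0.
Qed.

Lemma neutral_stable h : neutral h -> stable (adl h) c.
Proof.
move=> [hh0 he] x /cent_ehP[ex hx]; rewrite adlE; apply/cent_ehP.
split; rewrite lie_der ?ex ?hx lie0r addr0.
  by rewrite [lie e h]lieC he lieNl lieZl ex scaler0 oppr0.
by rewrite [lie h0 h]lieC hh0 oppr0 lie0l.
Qed.

Lemma neutral_cent h : neutral h -> h - h0 \in c.
Proof.
move=> [hh0 he]; have [h0e _ _] := triple; apply/cent_ehP; split.
  by rewrite lieBr [lie e h]lieC he [lie e h0]lieC h0e subrr.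
by rewrite lieBr liexx subr0 lieC hh0 oppr0.
Qed.

(* By biorthogonality it suffices that [h - h0] be orthogonal to the orthogonal
   [q :&: (u + u')] of [u + (q :&: q')]; this holds because [killing h] vanishes
   on the ad-nilpotent elements of the nonnegative part. *)
Lemma cent_correction h s h' s' : neutral h -> spec h s -> neutral h' -> spec h' s' ->
  exists2 r, r \in (trm c h s (fun a => 0 <= a)%R :&: trm c h' s' (fun a => 0 <= a)%R)%VS &
    h - h0 - r \in trm c h s (fun a => 0 < a).
Proof.
move=> nh sp nh' sp'; set u := trm c h s (fun a => 0 < a).
set q := trm c h s _; set q' := trm c h' s' _; pose u' := trm c h' s' (fun a => 0 < a).
have spc := spec_specm sp (neutral_stable nh).
have spc' := spec_specm sp' (neutral_stable nh').
have nondeg y : y \in c -> (forall x, x \in c -> killing x y = 0) -> y = 0.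
  exact: killing_cent_eh_nondegenerate ss_L triple nil_f y.
have uc : (u <= c)%VS := trm_sub c h s _.
have qc : (q <= c)%VS := trm_sub c h s _.
have u'c : (u' <= c)%VS := trm_sub c h' s' _.
have uq : (u <= q)%VS by apply: trmS => a; apply: ltW.
have kC := @killingC _ L; have kP := @killingP _ L.
suff : h - h0 \in (u + (q :&: q'))%VS.
  by case/memv_addP=> x xu [r rq ->]; exists r => //; rewrite addrK.
apply: (form_biorth kC kP nondeg).
- by rewrite subv_add uc; apply: subv_trans (capvSl _ _) qc.
- exact: neutral_cent.
move=> y yc perp.
have yq : y \in q.
  by apply: (perp_trm_pos spc nondeg yc) => x xu; apply/perp/(subvP (addvSl _ _)).
have : y \in (u + u')%VS.
  have uu'c : (u + u' <= c)%VS.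
    by rewrite subv_add; apply/andP; split; [exact: uc | exact: u'c].
  apply: (form_biorth kC kP nondeg uu'c yc).
  move=> t tc perp_t; rewrite killingC; apply: perp; apply: (subvP (addvSr _ _)).
  apply/memv_capP; split.
    by apply: (perp_trm_pos spc nondeg tc) => x xu; apply/perp_t/(subvP (addvSl _ _)).
  by apply: (perp_trm_pos spc' nondeg tc) => x xu; apply/perp_t/(subvP (addvSr _ _)).
case/memv_addP=> y1 y1u [y2 y2u' def_y].
(* [y2] is ad-nilpotent because it lies in [u'], and nonnegative for [h] because [u] is contained in
   [q]: the two conditions of [killing_trm]. *)
have y2q : y2 \in q.
  have -> : y2 = y - y1 by rewrite def_y addrC addKr.
  exact: rpredB yq (subvP uq y1 y1u).
have p0 : h - h0 \in gr h 0.
  by case: nh => hh0 _; apply/grP; rewrite lieBr liexx hh0 subrr scale0r.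
have -> : killing (h - h0) y = killing (h - h0) y1 + killing (h - h0) y2.
  by rewrite def_y linearD.
have -> : killing (h - h0) y1 = 0.
  elim/trm_ind: y1 / y1u {def_y} => [|v w v0 w0|a x _ a0 xa _].
  - by rewrite linear0.
  - by rewrite linearD /= v0 w0 addr0.
  by apply: (killing_gr p0 xa); rewrite add0r gt_eqF.
rewrite add0r killingC linearB /= [killing y2 h]killingC.
have [_ _ ef] := triple; have /cent_ehP[ey2 _] := subvP u'c y2 y2u'.
have -> : killing y2 h0 = 0 by rewrite killingC -ef killing_lieC ey2 linear0 oppr0.
rewrite subr0; apply: (killing_trm sp).
  exact: (subvP (trm_le h s _ (subvf c))) y2q.
apply: (trm_pos_nilp sp'); exact: (subvP (trm_le h' s' _ (subvf c))) y2u'.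
Qed.

Lemma cent_shift h s x : neutral h -> spec h s ->
  x \in trm c h s (fun a => 0 < a) ->
  exists g, [/\ act g, g e = e & g h = h - x].
Proof.
move=> nh sp xu; have spc := spec_specm sp (neutral_stable nh).
have nxu : - x \in trm c h s (fun a => 0 < a) by rewrite rpredN.
have [g [ag gh gz]] := act_shift act1 actM act_exp (lexx 0) spc cent_sub nxu.
have ge : g e = e by apply: gz => n /cent_ehP[en _]; rewrite lieC en oppr0.
have [k ak [gK kK]] := actV ag; exists k; split; first exact: ak.
  by rewrite -{1}ge gK.
by rewrite -{1}gh gK.
Qed.

(** [[r, h0]] vanishes, [[r, h]] loses the component of degree 0, and [[r, x]] has positive degrees.
    With [h - h0 - x] equal to the correction found for [h], this places the bracket of the two
    corrections in the positive part. *)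
Lemma cent_bracket h s r x : neutral h -> spec h s ->
  r \in trm c h s (fun a => 0 <= a) -> x \in trm c h s (fun a => 0 < a) ->
  lie r (h - h0 - x) \in trm c h s (fun a => 0 < a).
Proof.
move=> nh sp rq xu; have spc := spec_specm sp (neutral_stable nh).
have rc_ := subvP (trm_sub c h s _) r rq.
rewrite !lieBr [lie r h0]lieC (cent_lie_h0 rc_) oppr0 subr0; apply: rpredB; last first.
  by apply: (trm_lie spc cent_sub _ rq xu) => a b a0 b0; apply: ltr_wpDl.
rewrite lieC rpredN; elim/trm_ind: r / rq {rc_} => [|v w v0 w0|a y _ a0 ya yc].
- by rewrite lie0r mem0v.
- by rewrite lieDr; apply: rpredD.
move/grP: (ya) => ->; have [->|nz_a] := eqVneq a 0; first by rewrite rmorph0 scale0r mem0v.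
apply: rpredZ; apply: (mem_trm (P := fun a => 0 < a) spc _ ya yc).
by rewrite lt_neqAle eq_sym nz_a.
Qed.

Lemma cent_commuting h s h' s' : neutral h -> spec h s -> neutral h' -> spec h' s' ->
  exists g g', [/\ act g /\ g e = e, act g' /\ g' e = e & lie (g h) (g' h') = 0].
Proof.
move=> nh sp nh' sp'.
have spc := spec_specm sp (neutral_stable nh).
have spc' := spec_specm sp' (neutral_stable nh').
have [r /memv_capP[rq rq'] xu] := cent_correction nh sp nh' sp'.
have [r' /memv_capP[r'q' r'q] xu'] := cent_correction nh' sp' nh sp.
set u := trm c h s (fun a => 0 < a) in xu; set u' := trm c h' s' (fun a => 0 < a) in xu'.
set x := h - h0 - r in xu; set x' := h' - h0 - r' in xu'.
have rE : h - h0 - x = r by rewrite /x opprB addrCA subrr addr0.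
have r'E : h' - h0 - x' = r' by rewrite /x' opprB addrCA subrr addr0.
have rcc : r \in c := subvP (trm_sub c h s _) r rq.
have r'cc : r' \in c := subvP (trm_sub c h s _) r' r'q.
pose W := (u :&: u')%VS.
have rr'W : lie r r' \in W.
  apply/memv_capP; split.
    rewrite lieC rpredN -rE; exact: cent_bracket nh sp r'q xu.
  rewrite -r'E; exact: cent_bracket nh' sp' rq' xu'.
have [g [ag ge gh]] := cent_shift nh sp xu.
have gh1 : g h = h0 + r by rewrite gh -rE addrA [h0 + _]addrC subrK.
have T0 : lie (g h) h0 = 0.
  by rewrite gh1 lieDl liexx add0r lieC (cent_lie_h0 rcc) oppr0.
have TE z : z \in c -> lie (g h) z = lie r z.
  by move=> zc; rewrite gh1 lieDl (cent_lie_h0 zc) add0r.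
have TW : stable (adl (g h)) W.
  move=> w /memv_capP[wu wu']; have wc := subvP (trm_sub c h s _) w wu.
  rewrite adlE TE //; apply/memv_capP; split.
    by apply: (trm_lie spc cent_sub _ rq wu) => a b a0 b0; apply: ltr_wpDl.
  by apply: (trm_lie spc' cent_sub _ rq' wu') => a b a0 b0; apply: ltr_wpDl.
have sp1 := act_spec actV act_lie ag sp; have us : uniq s by case: sp.
have [d dW def_r'] := spec_dec sp1 (@stable_fullv _ _ _) (memvf r').
have dg a := memv_capl (dW a).
have sumW : \sum_(a <- s) rc a *: d a \in W.
  have <- : lie (g h) r' = \sum_(a <- s) rc a *: d a.
    rewrite {1}def_r' linear_sum; apply: eq_bigr => a _ /=; exact/grP/dg.
  by rewrite TE.
have d_W := gr_comp_mem us TW (fun a _ => rpredZ (rc a) (dg a)) sumW.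
(* For [a != 0], the component [d a] is [a^-1] times a component of [[g h, r'] = [r, r']], hence
   lies in [W]. What remains of [r'] commutes with [g h], and [w], being in [u'], is removed
   together with [x']. *)
pose w := \sum_(a <- s) if a == 0 then 0 else d a.
have wW : w \in W.
  rewrite /w big_seq rpred_sum // => a sa; case: eqP => [_|/eqP nz_a]; first exact: mem0v.
  have := rpredZ (rc a)^-1 (d_W a sa); rewrite scalerA mulVf ?scale1r //.
  by rewrite -(rmorph0 rc) (inj_eq (@rc_inj R)).
have Tw : lie (g h) (r' - w) = 0.
  apply/eqP; rewrite lieBr subr_eq0 def_r' /w !linear_sum; apply/eqP/eq_bigr => a _ /=.
  case: eqP => // a0; rewrite lie0r; have /grP -> := dg a.
  by rewrite a0 rmorph0 scale0r.
have xw : x' + w \in u' by apply: rpredD xu' (memv_capr wW).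
have [g' [ag' g'e g'h]] := cent_shift nh' sp' xw.
exists g, g'; split=> //; rewrite g'h.
have -> : h' - (x' + w) = h0 + (r' - w).
  by rewrite -r'E opprD !addrA; rewrite [h0 + h']addrC addrK.
by rewrite lieDr T0 Tw addr0.
Qed.

End Centralizer.

Lemma good_commuting e h s h' s' :
  spec h s -> goodh e h -> spec h' s' -> goodh e h' ->
  exists g g', [/\ act g /\ g e = e, act g' /\ g' e = e & lie (g h) (g' h') = 0].
Proof.
move=> sp gd sp' gd'.
have [f [h0 [f2 h00 triple]]] := good_sl2 ss_L sp gd.
have [f' [h0' [f'2 h00' triple']]] := good_sl2 ss_L sp' gd'.
have nil_f : lnilp (lie f).
  by apply: (gr_nilp sp _ f2); rewrite oppr_eq0 pnatr_eq0.
have [k [ak ke kh0]] := neutral_conj triple nil_f triple'.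
have neutralP (h1 : L) : e \in gr h1 2 -> h0 \in gr h1 0 -> neutral e h0 h1.
  by move=> /grP e2 /grP h10; split; [rewrite h10 rmorph0 scale0r | rewrite e2 rmorph_nat].
have nh : neutral e h0 h by case: gd => e2 _ _; apply: neutralP.
have nkh' : neutral e h0 (k h').
  case: gd' => e2 _ _; apply: neutralP; first by rewrite -ke; exact: (act_gr act_lie ak e2).
  by rewrite -kh0; exact: (act_gr act_lie ak h00').
have spk := act_spec actV act_lie ak sp'.
have [g [g' [[ag ge] [ag' g'e] gg']]] := cent_commuting triple nil_f nh sp nkh' spk.
exists g, (g' \o k)%VF; split=> //; last by rewrite comp_lfunE.
by split; [exact: actM | rewrite comp_lfunE ke].
Qed.

End CommutingConjugates.

(** * Exponentials in linear algebraic groups *)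

Section PolynomialCurves.
Variables (C : closedFieldType) (m : nat).
Local Notation mp := (mpoly.mpoly m C).
Local Notation X_ k := (mpoly.mpolyX C (mpoly.mnm1 k)).

Lemma mpoly_ring_ind (P : mp -> Prop) :
  (forall c, P (mpoly.mpolyC m c)) -> (forall k, P (X_ k)) ->
  (forall p q, P p -> P q -> P (p + q)) -> (forall p q, P p -> P q -> P (p * q)) ->
  forall p, P p.
Proof.
move=> PC PX PD PM p; rewrite (mpoly.mpolyE p); apply: (big_ind P _ PD).
  by rewrite -(mpoly.mpolyC0 m C).
move=> mm _; rewrite -mpoly.mul_mpolyC; apply: (PM) => //.
rewrite mpoly.mpolyXE_id; apply: (big_ind P _ PM); first by rewrite -(mpoly.mpolyC1 m C).
move=> i _; elim: (mpoly.fun_of_multinom _ _) => [|k IHk]; first by rewrite expr0 -(mpoly.mpolyC1 m C).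
by rewrite exprS; apply: PM.
Qed.

(** The restriction of [p] to the path with coordinates [q], kept as a univariate polynomial so that
    it can be tested by its derivatives at 0. *)
Definition curve (q : 'I_m -> {poly C}) (p : mp) : {poly C} := mpoly.mmap (@polyC C) q p.

Lemma curveD q : {morph curve q : p1 p2 / p1 + p2}. Proof. exact: mpoly.mmapD. Qed.
Lemma curveM q : {morph curve q : p1 p2 / p1 * p2}.
Proof. by case: (mpoly.mmap_is_multiplicative q (@polyC C)). Qed.
Lemma curveC q c : curve q (mpoly.mpolyC m c) = c%:P. Proof. exact: mpoly.mmapC. Qed.
Lemma curveX q k : curve q (X_ k) = q k.
Proof. by rewrite /curve mpoly.mmapX mpoly.mmap1U. Qed.

Lemma curve_horner q p t : (curve q p).[t] = mpoly.meval (fun k => (q k).[t]) p.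
Proof.
elim/mpoly_ring_ind: p => [c|k|p1 p2 e1 e2|p1 p2 e1 e2].
- by rewrite curveC mpoly.mevalC hornerC.
- by rewrite curveX mpoly.mevalXU.
- by rewrite curveD mpoly.mevalD hornerD e1 e2.
by rewrite curveM mpoly.mevalM hornerM e1 e2.
Qed.

Lemma curve_deriv q p :
  (curve q p)^`() = \sum_k curve q (mpoly.mderiv k p) * (q k)^`().
Proof.
elim/mpoly_ring_ind: p => [c|k|p1 p2 e1 e2|p1 p2 e1 e2].
- rewrite curveC derivC big1 // => k _.
  by rewrite mpoly.mderivC -(mpoly.mpolyC0 m C) curveC mul0r.
- rewrite curveX (bigD1 k) //= big1 ?addr0 => [|j jk];
    rewrite mpoly.mderivX mpoly.mnm1E.
    have -> : mpoly.mnm_sub (mpoly.mnm1 k) (mpoly.mnm1 k) = mpoly.mnm0.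
      by apply/mpoly.mnmP => j; rewrite mpoly.mnmBE mpoly.mnm0E subnn.
    by rewrite eqxx scale1r mpoly.mpolyX0 -(mpoly.mpolyC1 m C) curveC mul1r.
  by rewrite eq_sym (negPf jk) scale0r -(mpoly.mpolyC0 m C) curveC mul0r.
- rewrite curveD derivD e1 e2 -big_split; apply: eq_bigr => k _.
  by rewrite mpoly.mderivD curveD mulrDl.
rewrite curveM derivM e1 e2 mulr_suml mulr_sumr -big_split; apply: eq_bigr => k _ /=.
by rewrite mpoly.mderivM curveD !curveM mulrDl mulrAC -!mulrA.
Qed.

Definition lin_form (S : 'M[C]_m) k : mp := \sum_(l < m) S l k *: X_ l.

Definition subst (S : 'M[C]_m) (p : mp) : mp := mpoly.comp_mpoly [tuple lin_form S k | k < m] p.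

Lemma curve_lin_form q S k : curve q (lin_form S k) = \sum_(l < m) S l k *: q l.
Proof.
rewrite /lin_form; elim/big_ind2: _ => [|p1 r1 p2 r2 <- <-|l _].
- by rewrite -(mpoly.mpolyC0 m C) curveC.
- by rewrite curveD.
by rewrite -mpoly.mul_mpolyC curveM curveC curveX mul_polyC.
Qed.

Lemma curve_subst q S p :
  curve q (subst S p) = curve (fun k => \sum_(l < m) S l k *: q l) p.
Proof.
rewrite /subst; elim/mpoly_ring_ind: p => [c|k|p1 p2 e1 e2|p1 p2 e1 e2].
- by rewrite mpoly.comp_mpolyC !curveC.
- by rewrite mpoly.comp_mpolyXU -tnth_nth tnth_mktuple curveX curve_lin_form.
- by rewrite mpoly.comp_mpolyD !curveD e1 e2.
have [compM _] := mpoly.comp_mpoly_is_multiplicative [tuple lin_form S k | k < m].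
by rewrite compM !curveM e1 e2.
Qed.

End PolynomialCurves.

(** * Exponentials of nilpotent matrices *)

Section MatrixExponential.
Variables (C : numClosedFieldType) (n : nat).
Implicit Types (A B X Y H : 'M[C]_n) (p : mxpolyfun C n) (K : nat).

Definition line A X (k : 'I_(n * n)) : {poly C} := (mxvec A 0 k)%:P + mxvec X 0 k *: 'X.

Lemma line_deriv A X p :
  (curve (line A X) p)^`().[0] = \sum_k mxeval (mpoly.mderiv k p) A * mxvec X 0 k.
Proof.
rewrite curve_deriv -horner_evalE linear_sum; apply: eq_bigr => k _ /=.
rewrite horner_evalE hornerM curve_horner /line derivD derivC add0r derivZ derivX.
rewrite alg_polyC hornerC; congr (_ * _); apply: mpoly.meval_eq => l.
by rewrite hornerD hornerC hornerZ hornerX mulr0 addr0.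
Qed.

Definition mx_lin (S : 'M[C]_(n * n)) (T : 'M[C]_n -> 'M[C]_n) :=
  forall Y, mxvec Y *m S = mxvec (T Y).

Lemma mx_lin_row S T Y k : mx_lin S T ->
  \sum_(l < n * n) S l k * mxvec Y 0 l = mxvec (T Y) 0 k.
Proof. by move=> ST; rewrite -ST mxE; apply: eq_bigr => l _; rewrite mulrC. Qed.

Lemma mxeval_subst S T p Y : mx_lin S T -> mxeval (subst S p) Y = mxeval p (T Y).
Proof.
move=> ST; rewrite /mxeval mpoly.comp_mpoly_meval; apply: mpoly.meval_eq => k.
rewrite tnth_mktuple -(mx_lin_row _ _ ST) /lin_form raddf_sum; apply: eq_bigr => l _ /=.
by rewrite mpoly.mevalZ mpoly.mevalXU.
Qed.

Lemma mxdiff1_subst S T p X : mx_lin S T ->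
  mxdiff1 (subst S p) X = \sum_k mxeval (mpoly.mderiv k p) (T 1%:M) * mxvec (T X) 0 k.
Proof.
move=> ST; rewrite /mxdiff1 -!line_deriv curve_subst.
congr (_^`().[0]); congr curve; apply/funext => k.
under eq_bigr => l _ do rewrite scalerDr.
rewrite big_split /=; congr (_ + _).
  under eq_bigr => l _ do rewrite -mul_polyC -polyCM.
  by rewrite -rmorph_sum /= (mx_lin_row _ _ ST).
under eq_bigr => l _ do rewrite scalerA.
by rewrite -scaler_suml (mx_lin_row _ _ ST).
Qed.

Definition mexp K X : 'M[C]_n := \sum_(i < K) (i`!)%:R^-1 *: X ^+ i.

Definition exp_curve K X k : {poly C} :=
  \poly_(i < K) ((i`!)%:R^-1 * mxvec (X ^+ i) 0 k).

Lemma exp_curve1 K X k : (exp_curve K X k).[1] = mxvec (mexp K X) 0 k.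
Proof.
rewrite horner_poly /mexp linear_sum summxE; apply: eq_bigr => i _.
by rewrite expr1n mulr1 linearZ mxE.
Qed.

Lemma exp_curve0 K X k : (exp_curve K.+1 X k).[0] = mxvec (1%:M : 'M[C]_n) 0 k.
Proof. by rewrite horner_coef0 coef_poly /= fact0 invr1 mul1r. Qed.

(** The equation [E' = E X] for [E = exp (t X)], coordinate by coordinate. Truncation loses only the
    term in [X ^+ K], which is zero. *)
Lemma exp_curve_deriv K X k S : X ^+ K = 0 -> mx_lin S (mulmxr X) ->
  (exp_curve K X k)^`() = \sum_(l < n * n) S l k *: exp_curve K X l.
Proof.
move=> XK ST; apply/polyP => i; rewrite coef_deriv coef_sum.
under eq_bigr => l _ do rewrite coefZ coef_poly.
rewrite coef_poly; have [lt_iK|le_Ki] := ltnP i K; last first.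
  rewrite ltnNge leqW //= mul0rn big1 // => l _; exact: mulr0.
transitivity ((i`!)%:R^-1 * mxvec (X ^+ i.+1) 0 k).
  have fact_inv : (i.+1`!)%:R^-1 * i.+1%:R = (i`!)%:R^-1 :> C.
    by rewrite factS natrM invfM mulrC mulrA mulfV ?mul1r ?pnatr_eq0.
  have [_|le_K] := ltnP i.+1 K; first by rewrite -[LHS]mulr_natr mulrAC fact_inv.
  have -> : X ^+ i.+1 = 0 by rewrite -(subnK le_K) exprD XK mulr0.
  by rewrite mul0rn linear0 mxE mulr0.
rewrite exprSr -[X ^+ i * X]/(mulmxr X (X ^+ i)) -(mx_lin_row _ _ ST) mulr_sumr.
by apply: eq_bigr => l _; rewrite mulrCA.
Qed.

Lemma nilp_unit X : (exists K, X ^+ K = 0) -> 1 - X \in unitmx.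
Proof.
case=> K XK; have := subrX1 X K; rewrite XK sub0r => /eqP.
rewrite eq_sym -subr_eq0 opprK -[X - 1]opprB mulNr addrC subr_eq0 => /eqP e1.
by have [] := mulmx1_unit (esym e1).
Qed.

Lemma mexp_unit K X : X ^+ K.+1 = 0 -> mexp K.+1 X \in unitmx.
Proof.
move=> XK; pose Q := - \sum_(i < K) (i.+1`!)%:R^-1 *: X ^+ i.
have -> : mexp K.+1 X = 1 - X * Q.
  rewrite /mexp big_ord_recl fact0 invr1 scale1r expr0 /Q mulrN opprK; congr (_ + _).
  rewrite mulr_sumr; apply: eq_bigr => i _.
  by rewrite -mulmxE -scalemxAr mulmxE -exprS.
have comXQ : GRing.comm X Q.
  apply: GRing.commrN; apply: GRing.commr_sum => i _.
  by rewrite /GRing.comm -mulmxE -scalemxAr -scalemxAl mulmxE -exprS -exprSr.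
by apply: nilp_unit; exists K.+1; rewrite exprMn_comm // XK mul0r.
Qed.

Definition mad X Y : 'M[C]_n := X * Y - Y * X.

Lemma madB X Y Z : mad X (Y - Z) = mad X Y - mad X Z.
Proof. by rewrite /mad mulrBr mulrBl !opprB addrACA [RHS]addrACA [- (X * Z) + _]addrC. Qed.

Lemma mad0 X : mad X 0 = 0. Proof. by rewrite /mad mulr0 mul0r subrr. Qed.

Lemma iter_madB X k Y Z : iter k (mad X) (Y - Z) = iter k (mad X) Y - iter k (mad X) Z.
Proof. by elim: k => //= k ->; rewrite madB. Qed.

Lemma iter_mad0 X k : iter k (mad X) 0 = 0.
Proof. by elim: k => //= k ->; rewrite mad0. Qed.

Lemma mad_nilp (p q : nat) X Y : X ^+ p * Y = 0 -> Y * X ^+ q = 0 -> iter (p + q) (mad X) Y = 0.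
Proof.
have [m le_m] := ubnP (p + q)%N; elim: m p q Y le_m => // m IHm p q Y; rewrite ltnS.
case: p => [|p] le_m; first by rewrite expr0 mul1r => -> _; rewrite iter_mad0.
case: q le_m => [|q] le_m; first by rewrite expr0 mulr1 => _ ->; rewrite iter_mad0.
move=> pY Yq; rewrite addSn iterSr {2}/mad iter_madB.
have -> : iter (p + q.+1) (mad X) (X * Y) = 0.
  by apply: IHm; [exact: le_m | rewrite mulrA -exprSr | rewrite -mulrA Yq mulr0].
have -> : iter (p + q.+1) (mad X) (Y * X) = 0.
  rewrite -addSnnS; apply: IHm; first by move: le_m; rewrite addnS.
    by rewrite mulrA pY mul0r.
  by rewrite -mulrA -exprS.
by rewrite subrr.
Qed.

(** The binomial formula: left multiplication by [X] is the sum of [mad X] and right multiplication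
    by [X], which commute. *)
Lemma expr_mad i X Y :
  X ^+ i * Y = \sum_(j < i.+1) (iter j (mad X) Y * X ^+ (i - j)) *+ 'C(i, j).
Proof.
elim: i => [|i IHi]; first by rewrite big_ord1 /= expr0 mul1r mulr1.
rewrite exprS -mulrA IHi mulr_sumr.
have XZ (Z : 'M[C]_n) j : (j <= i)%N ->
    X * (Z * X ^+ (i - j)) = mad X Z * X ^+ (i - j) + Z * X ^+ (i.+1 - j).
  by move=> ji; rewrite /mad mulrBl -!mulrA -exprS -subSn // subrK.
rewrite (eq_bigr (fun j : 'I_i.+1 => (iter j.+1 (mad X) Y * X ^+ (i - j)) *+ 'C(i, j) +
   (iter j (mad X) Y * X ^+ (i.+1 - j)) *+ 'C(i, j))); last first.
  by move=> j _; rewrite mulrnAr XZ ?mulrnDl // -ltnS.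
rewrite big_split [RHS]big_ord_recl /=.
under [in RHS]eq_bigr => j _ do rewrite /bump /= add1n subSS binS mulrnDr.
rewrite [in RHS]big_split /= addrA [LHS]addrC; congr (_ + _).
rewrite [LHS]big_ord_recl [in RHS]big_ord_recr /= !bin0 bin_small // mulr0n addr0.
congr (_ + _); apply: eq_bigr => j _; rewrite /bump /= add1n subSS.
Qed.

(** The identity [exp X Y = (exp (ad X) Y) exp X], from the binomial expansion. The terms with
    [j >= 2 K] vanish because [(ad X)^(2 K) = 0]. For smaller [j], the bound [3 K <= M] leaves at
    least [K] terms in the inner sum, which is then the full exponential. *)
Lemma mexp_mad K M X Y : X ^+ K = 0 -> (K + (K + K) <= M)%N ->
  mexp M X * Y = (\sum_(j < M) (j`!)%:R^-1 *: iter j (mad X) Y) * mexp M X.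
Proof.
move=> XK le_M; pose a j := (j`!)%:R^-1 *: iter j (mad X) Y; pose b l := (l`!)%:R^-1 *: X ^+ l.
have b0 l : (K <= l)%N -> b l = 0.
  by move=> Kl; rewrite /b -(subnK Kl) exprD XK mulr0 scaler0.
have a0 j : (K + K <= j)%N -> a j = 0.
  move=> Kj; rewrite /a -(subnK Kj) iterD mad_nilp ?XK ?mul0r ?mulr0 //.
  by rewrite iter_mad0 scaler0.
have bY i : (i < M)%N -> b i * Y = \sum_(0 <= j < M | (j <= i)%N) a j * b (i - j)%N.
  move=> iM; rewrite /b -mulmxE -scalemxAl mulmxE expr_mad scaler_sumr.
  rewrite -(big_mkord xpredT (fun j => (i`!)%:R^-1 *: ((iter j (mad X) Y * X ^+ (i - j)) *+ 'C(i, j)))).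
  rewrite (big_nat_widen _ _ _ _ _ iM) /=; apply: eq_big => [j|j]; first by rewrite ltnS.
  rewrite ltnS => ji; rewrite /a -mulmxE -scalemxAl -scalemxAr scalerA mulmxE -scaler_nat scalerA.
  congr (_ *: _); rewrite -(bin_fact ji) !natrM invfM mulrC.
  rewrite mulrA mulfV ?mul1r ?invfM //.
  by rewrite pnatr_eq0 -lt0n bin_gt0.
have mexpE N : mexp N X = \sum_(0 <= l < N) b l by rewrite big_mkord.
have tail N : (K <= N)%N -> \sum_(0 <= l < N) b l = \sum_(0 <= l < K) b l.
  move=> KN; rewrite (big_cat_nat (leq0n K) KN) /= [X in _ + X]big_nat_cond [X in _ + X]big1 ?addr0 // => l.
  by case/andP => /andP[Kl _] _; apply: b0.
rewrite mexpE mulr_suml big_nat_cond.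
rewrite (eq_bigr (fun i => \sum_(0 <= j < M | (j <= i)%N) a j * b (i - j)%N)); last first.
  by move=> i /andP[/andP[_ iM] _]; apply: bY.
rewrite -big_nat_cond (exchange_big_dep_nat xpredT) //= -(big_mkord xpredT a) mulr_suml.
apply: eq_bigr => j _; have [jK|Kj] := ltnP j (K + K); last first.
  by rewrite a0 // mul0r big1 // => i _; rewrite mul0r.
rewrite -mulr_sumr; congr (_ * _).
have jM : (K <= M - j)%N.
  by rewrite leq_subRL; [apply: leq_trans le_M; rewrite addnC leq_add2l ltnW|
     apply: leq_trans le_M; rewrite (leq_trans (ltnW jK)) // leq_addl].
rewrite (tail M) -?(tail _ jM) //; last by apply: leq_trans le_M; apply: leq_addr.
rewrite [RHS](eq_bigr (fun l => b (l + j - j)%N)) => [|l _]; last by rewrite addnK.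
by rewrite -(big_addn 0 M j xpredT (fun i => b (i - j)%N)) add0n (big_nat_widenl j 0).
Qed.

End MatrixExponential.

(** * Tangent vectors and the adjoint action *)

Section AdjointGroup.
Variables (C : numClosedFieldType) (n : nat) (G : set 'M[C]_n).
Hypothesis cG : closed_subgroup G.
Implicit Types (A B X Y H : 'M[C]_n) (p : mxpolyfun C n).

Definition vanish p := forall A, G A -> mxeval p A = 0.

Lemma closed_unit A : G A -> A \in unitmx.
Proof. by have [[E ->] _ _ _] := cG; case. Qed.

Lemma mx_lin_mulmx A : mx_lin (lin_mulmx A) (mulmx A).
Proof. by move=> Y; rewrite mul_vec_lin. Qed.

Lemma mx_lin_mulmxr X : mx_lin (lin_mulmxr X) (mulmxr X).
Proof. by move=> Y; rewrite mul_vec_lin. Qed.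

(* The left-invariant derivation in the direction [X]. *)
Definition dright X p : mxpolyfun C n :=
  \sum_k mpoly.mderiv k p * lin_form (lin_mulmxr X) k.

(** For [A] in [G], the translate [B |-> p (A B)] vanishes on [G], and its differential at 1 along
    [X] is the value of [dright X p] at [A]. *)
Lemma vanish_dright X p : tangent1 G X -> vanish p -> vanish (dright X p).
Proof.
have [_ _ GM _] := cG; move=> tX p0 A GA.
have : vanish (subst (lin_mulmx A) p).
  by move=> B GB; rewrite (mxeval_subst _ _ (mx_lin_mulmx A)); apply/p0/GM.
move/tX; rewrite (mxdiff1_subst _ _ (mx_lin_mulmx A)) mulmx1 => <-.
rewrite /mxeval /dright raddf_sum; apply: eq_bigr => k _ /=.
rewrite mpoly.mevalM; congr (_ * _).
rewrite -(mx_lin_row _ _ (mx_lin_mulmxr X)) /lin_form raddf_sum; apply: eq_bigr => l _ /=.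
by rewrite mpoly.mevalZ mpoly.mevalXU.
Qed.

Lemma exp_curve_dright K X p : X ^+ K = 0 ->
  (curve (exp_curve K X) p)^`() = curve (exp_curve K X) (dright X p).
Proof.
move=> XK; rewrite curve_deriv /dright (big_morph _ (curveD _) (_ : _ = 0)); last first.
  by rewrite -(mpoly.mpolyC0 (n * n) C) curveC.
apply: eq_bigr => k _.
by rewrite curveM curve_lin_form (exp_curve_deriv _ XK (mx_lin_mulmxr X)).
Qed.

(** Differentiating along the exponential applies [dright X], so every derivative comes from a
    polynomial vanishing on [G] and is zero at [t = 0], where the curve is at 1. The value at
    [t = 1] is the claim. *)
Lemma tangent_exp K X : tangent1 G X -> X ^+ K.+1 = 0 -> G (mexp K.+1 X).
Proof.
move=> tX XK; have [[E GE] G1 _ _] := cG; rewrite GE; split; first exact: mexp_unit.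
have derivs j p : vanish p -> exists2 q, vanish q &
    (curve (exp_curve K.+1 X) p)^`(j) = curve (exp_curve K.+1 X) q.
  move=> p0; elim: j => [|j [q q0 IHj]]; first by exists p; rewrite ?derivn0.
  exists (dright X q); first exact: vanish_dright.
  by rewrite derivnS IHj exp_curve_dright.
move=> p Ep; have p0 : vanish p by move=> A; rewrite GE => -[_]; apply.
suff c0 : curve (exp_curve K.+1 X) p = 0.
  have := curve_horner (exp_curve K.+1 X) p 1; rewrite c0 horner0 => /esym.
  by rewrite (mpoly.meval_eq _ (exp_curve1 K.+1 X)).
apply/polyP => j; have [q q0] := derivs j p p0.
move/(congr1 (fun r : {poly C} => r.[0])).
rewrite curve_horner (mpoly.meval_eq _ (exp_curve0 K X)) -/(mxeval q 1%:M) q0 //.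
rewrite horner_coef0 coef_derivn addn0 ffactnn => /eqP.
by rewrite coef0 -mulr_natr mulf_eq0 pnatr_eq0 (gtn_eqF (fact_gt0 j)) orbF => /eqP.
Qed.

Lemma tangent_conj A X : G A -> tangent1 G X -> tangent1 G (A *m X *m invmx A).
Proof.
have [_ _ GM GV] := cG; move=> GA tX p p0; have uA := closed_unit GA.
pose S := lin_mulmx A *m lin_mulmxr (invmx A).
have ST : mx_lin S (fun Y => A *m Y *m invmx A).
  by move=> Y; rewrite /S mulmxA mx_lin_mulmx mx_lin_mulmxr.
have := tX (subst S p); rewrite (mxdiff1_subst _ _ ST) mulmx1 mulmxV //; apply.
by move=> B GB; rewrite (mxeval_subst _ _ ST); apply/p0/GM; [apply: GM | apply: GV].
Qed.

Variables (L : lieAlgType C) (phi : 'Hom(L, 'M[C]_n)).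
Hypothesis lie_G : lie_algebra_of G phi.

(** [phi^-1] inverts [phi] only on its image, which conjugation by [G] preserves. *)
Lemma phi_Ad A x : G A -> phi (Ad phi A x) = A *m phi x *m invmx A.
Proof.
have [_ _ phiG] := lie_G; move=> GA.
rewrite /Ad !comp_lfunE lfunE /= mulmxA limg_lfunVK //.
by apply/phiG/tangent_conj => //; apply/phiG/memv_img/memvf.
Qed.

(** The instance of the abstract [act]. *)
Definition adjoint (g : 'End(L)) := exists2 A, G A & g = Ad phi A.

Lemma phi_eq (g k : 'End(L)) : (forall x, phi (g x) = phi (k x)) -> g = k.
Proof. by have [_ inj _] := lie_G; move=> gk; apply/lfunP => x; apply/inj/gk. Qed.

Lemma adjoint1 : adjoint \1%VF.
Proof.
have [_ G1 _ _] := cG; exists 1%:M => //; apply: phi_eq => x.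
by rewrite phi_Ad // invmx1 mulmx1 mul1mx id_lfunE.
Qed.

Lemma Ad_comp A B : G A -> G B -> (Ad phi A \o Ad phi B)%VF = Ad phi (A *m B).
Proof.
have [_ _ GM _] := cG; move=> GA GB; apply: phi_eq => x.
have uA := closed_unit GA; have uB := closed_unit GB.
have VAB : invmx (A *m B) = invmx B *m invmx A.
  have uAB : A *m B \in unitmx by rewrite unitmx_mul uA.
  apply: (can_inj (mulKmx uAB)); rewrite mulmxV // mulmxA mulmxK // mulmxV //.
by rewrite comp_lfunE (phi_Ad _ GA) (phi_Ad _ GB) (phi_Ad _ (GM A B GA GB)) VAB !mulmxA.
Qed.

Lemma adjointM g k : adjoint g -> adjoint k -> adjoint (g \o k)%VF.
Proof.
have [_ _ GM _] := cG; move=> [A GA ->] [B GB ->]; exists (A *m B); first exact: GM.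
by rewrite Ad_comp.
Qed.

Lemma adjointV g : adjoint g -> exists2 k, adjoint k & cancel g k /\ cancel k g.
Proof.
have [_ G1 GM GV] := cG; move=> [A GA ->]; have uA := closed_unit GA.
exists (Ad phi (invmx A)); first by exists (invmx A) => //; apply: GV.
have Ad1 : Ad phi 1%:M = \1%VF.
  by apply: phi_eq => x; rewrite phi_Ad // invmx1 mulmx1 mul1mx id_lfunE.
split=> x; rewrite -comp_lfunE.
  by rewrite (Ad_comp (GV A GA) GA) mulVmx // Ad1 id_lfunE.
by rewrite (Ad_comp GA (GV A GA)) mulmxV // Ad1 id_lfunE.
Qed.

Lemma adjoint_lie g x y : adjoint g -> g (lie x y) = lie (g x) (g y).
Proof.
have [phi_lie inj _] := lie_G; case=> A GA ->; have uA := closed_unit GA; apply: inj.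
rewrite phi_lie !phi_Ad // phi_lie mulmxBr mulmxBl !mulmxA.
by rewrite !mulmxKV.
Qed.

(** [X ^+ k] is an eigenvector of [[H, _]] for [k a], or zero. An annihilating polynomial has
    finitely many roots, so some [k a] is not a root and that power vanishes. *)
Lemma ad_eigen_nilp a H X : a != 0 -> H * X - X * H = a *: X -> exists K, X ^+ K = 0.
Proof.
move=> nz_a HX; pose T : 'End('M[C]_n) := linfun (mulmx H) - linfun (mulmxr H).
have TE Y : T Y = H *m Y - Y *m H by rewrite add_lfunE opp_lfunE !lfunE.
have TX k : T (X ^+ k) = (k%:R * a) *: X ^+ k.
  elim: k => [|k IHk]; first by rewrite expr0 mul0r scale0r TE mulmx1 mul1mx subrr.
  rewrite TE exprS -!mulmxE mulmxA -[H *m X](subrK (X *m H)) [H *m X - _]HX.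
  rewrite mulmxDl -!mulmxA -addrA -mulmxBr -TE IHk -scalemxAl -scalemxAr -scalerDl.
  by rewrite -{1}(mul1r a) -mulrDl nat1r.
have [s s0] := char_poly_kills T.
have foldX k r : foldr (fun l => eshift T l) (X ^+ k) r = (\prod_(l <- r) (k%:R * a - l)) *: X ^+ k.
  elim: r => [|l r IHr]; first by rewrite big_nil scale1r.
  by rewrite /= IHr linearZ /= eshiftE TX -scalerBl scalerA big_cons mulrC.
pose g k : C := k%:R * a.
have [/allP all_s|/allPn[k _ nsk]] := boolP (all [pred k | g k \in s] (iota 0 (size s).+1)).
  have ug : uniq (map g (iota 0 (size s).+1)).
    by rewrite map_inj_uniq ?iota_uniq // => j k /(mulIf nz_a)/eqP; rewrite eqr_nat => /eqP.
  have /(uniq_leq_size ug) : {subset map g (iota 0 (size s).+1) <= s}.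
    by move=> _ /mapP[k /all_s gk ->].
  by rewrite size_map size_iota ltnn.
exists k; have := foldX k s; rewrite s0 => /esym/eqP; rewrite scaler_eq0 => /orP[|/eqP//].
rewrite prodf_seq_eq0 => /hasP[l sl /=]; rewrite subr_eq0 => /eqP gk.
by case/negP: nsk; rewrite /g /= gk.
Qed.

Lemma adjoint_exp h m (a : C) : a != 0 -> lie h m = a *: m ->
  exists2 g, adjoint g & forall x (U : {vspace L}),
    (forall k, iter k.+2 (lie m) x \in U) -> g x - x - lie m x \in U.
Proof.
have [phi_lie inj phiG] := lie_G; move=> nz_a hm; pose X := phi m.
have [K XK] : exists K, X ^+ K = 0.
  by apply: (ad_eigen_nilp nz_a (H := phi h)); rewrite -phi_lie hm linearZ.
have tX : tangent1 G X by apply/phiG/memv_img/memvf.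
(* [mexp_mad] asks for [3 K] terms. The two more allow the terms [x] and [[m, x]] to be split
   off. *)
pose M := (K + (K + K)).+2; have XM : X ^+ M = 0.
  by rewrite /M -2!addnS exprD XK mul0r.
have GE := tangent_exp tX XM; set E := mexp M X in GE.
exists (Ad phi E) => [|x U xU]; first by exists E.
have phi_iter k : phi (iter k (lie m) x) = iter k (mad X) (phi x).
  by elim: k => //= k <-; rewrite phi_lie.
have -> : Ad phi E x = \sum_(j < M) (j`!)%:R^-1 *: iter j (lie m) x.
  have EY : E *m phi x = (\sum_(j < M) (j`!)%:R^-1 *: iter j (mad X) (phi x)) *m E.
    exact: mexp_mad (phi x) XK (leqW (leqW (leqnn _))).
  apply: inj; rewrite phi_Ad // EY.
  rewrite mulmxK ?closed_unit // linear_sum; apply: eq_bigr => j _ /=.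
  by rewrite linearZ /= phi_iter.
rewrite 2!big_ord_recl /= fact0 factS fact0 muln1 invr1 !scale1r.
rewrite [x + _]addrC addrK addrAC subrr add0r.
by apply: rpred_sum => j _; apply: rpredZ; exact: (xU j).
Qed.

End AdjointGroup.

(** * Chains of adjacent gradings *)

Lemma convex_gt (R : realFieldType) (t a b c : R) :
  0 <= t <= 1 -> c < a -> c < b -> c < (1 - t) * a + t * b.
Proof.
case/andP; rewrite le_eqVlt => /orP[/eqP<- _ ca _|t0 t1 ca cb].
  by rewrite subr0 mul1r mul0r addr0.
have -> : c = (1 - t) * c + t * c by rewrite -mulrDl subrK mul1r.
by rewrite ler_ltD ?ltr_pM2l // ler_wpM2l ?subr_ge0 // ltW.
Qed.

Lemma convex_lt (R : realFieldType) (t a b c : R) :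
  0 <= t <= 1 -> a < c -> b < c -> (1 - t) * a + t * b < c.
Proof.
move=> t01 ac bc; rewrite -ltrN2 opprD -!mulrN; apply: convex_gt => //.
  by rewrite ltrN2.
by rewrite ltrN2.
Qed.

Section Segment.
Variables (R : realType) (L : lieAlgType R[i]) (h1 h2 : L) (s1 s2 : seq R).
Hypotheses (h12 : lie h1 h2 = 0) (sp1 : spec h1 s1) (sp2 : spec h2 s2).
Implicit Types (U : {vspace L}) (x y e : L) (a b t : R) (p : R * R).
Local Notation rc := (real_complex R).

Definition segment t : L := rc (1 - t) *: h1 + rc t *: h2.
Definition weight t p : R := (1 - t) * p.1 + t * p.2.
Let J p : {vspace L} := (gr h1 p.1 :&: gr h2 p.2)%VS.
Let ps := [seq (a, b) | a <- s1, b <- s2].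

Lemma lie21 : lie h2 h1 = 0. Proof. by rewrite lieC h12 oppr0. Qed.

Lemma segment0 : segment 0 = h1.
Proof. by rewrite /segment subr0 rmorph1 rmorph0 scale1r scale0r addr0. Qed.

Lemma segment1 : segment 1 = h2.
Proof. by rewrite /segment subrr rmorph1 rmorph0 scale1r scale0r add0r. Qed.

Lemma joint_segment t p x : x \in J p -> x \in gr (segment t) (weight t p).
Proof.
case/memv_capP=> /grP x1 /grP x2; apply/grP.
by rewrite lieDl !lieZl x1 x2 !scalerA -scalerDl -!rmorphM -rmorphD.
Qed.

Lemma segment_stable t a : stable (adl h1) (gr (segment t) a) /\ stable (adl h2) (gr (segment t) a).
Proof.
by split; apply: adl_gr_stable; rewrite lieDl !lieZl ?liexx ?h12 ?lie21 !scaler0 addr0.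
Qed.

Lemma uniq_ps : uniq ps.
Proof. by apply: allpairs_uniq; [case: sp1 | case: sp2 | move=> [? ?] [? ?]]. Qed.

Lemma joint_dec x : exists2 c : R * R -> L, (forall p, c p \in J p) & x = \sum_(p <- ps) c p.
Proof.
apply: (memv_sum_seq uniq_ps).
have [c cW ->] := spec_dec sp1 (@stable_fullv _ _ _) (memvf x).
rewrite [X in X \in _]big_seq rpred_sum // => a sa.
have [d dW ->] := spec_dec sp2 (adl_gr_stable (a := a) h12) (memv_capl (cW a)).
rewrite [X in X \in _]big_seq rpred_sum // => b sb.
have sab : (a, b) \in ps by apply/allpairsP; exists (a, b); split.
apply: (subvP (sumv_seq_sup (P := xpredT) J sab isT)).
by apply/memv_capP; split; [exact: memv_capr (dW b) | exact: memv_capl (dW b)].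
Qed.

Lemma joint_mem U (c : R * R -> L) : stable (adl h1) U -> stable (adl h2) U ->
  (forall p, c p \in J p) -> \sum_(p <- ps) c p \in U -> forall p, p \in ps -> c p \in U.
Proof.
move=> U1 U2 cW; apply: (joint_eigen_mem uniq_ps) => p q _ _ pq.
have [eq1|neq1] := eqVneq p.1 q.1.
  exists (adl h2), (fun r => rc r.2); split; [exact: U2 | | ].
    by move=> r _; rewrite adlE; apply/grP/(memv_capr (cW r)).
  rewrite /= (inj_eq (@rc_inj R)); apply: contra pq => /eqP eq2.
  by rewrite [p]surjective_pairing eq1 eq2 -surjective_pairing.
exists (adl h1), (fun r => rc r.1); split; [exact: U1 | | ].
  by move=> r _; rewrite adlE; apply/grP/(memv_capl (cW r)).
by rewrite /= (inj_eq (@rc_inj R)).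
Qed.

Lemma segment_spec t : spec (segment t) (undup [seq weight t p | p <- ps]).
Proof.
split; first exact: undup_uniq.
apply/eqP; rewrite eqEsubv subvf; apply/subvP=> x _; rewrite sumv_undup.
have [c cW ->] := joint_dec x; rewrite [X in X \in _]big_seq rpred_sum // => p pps.
have wp : weight t p \in [seq weight t p | p <- ps] by apply: map_f.
apply: (subvP (sumv_seq_sup (P := xpredT) (gr (segment t)) wp isT)).
exact: joint_segment (cW p).
Qed.

Lemma segment_adjacent t u :
  (forall p, p \in ps -> int_below (weight t p) <= weight u p <= int_above (weight t p)) ->
  adjacent (gr (segment t)) (gr (segment u)).
Proof.
move=> adj; split=> [s us|x].
  apply: directv_seq; [exact: us | move=> v vW s' us' sum0 i s'i].
  apply/eqP; rewrite -memv0.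
  apply: (joint_eigen_mem us') s'i; last by rewrite sum0 mem0v.
  have st0 (T : 'End(L)) : stable T 0%VS by move=> z; rewrite !memv0 => /eqP->; rewrite linear0.
  move=> p q _ _ pq; have [eq1|neq1] := eqVneq p.1 q.1.
    exists (adl (segment u)), (fun r => rc r.2); split; [exact: st0 | | ].
      by move=> r _; rewrite adlE; apply/grP/(memv_capr (vW r)).
    rewrite /= (inj_eq (@rc_inj R)); apply: contra pq => /eqP eq2.
    by rewrite [p]surjective_pairing eq1 eq2 -surjective_pairing.
  exists (adl (segment t)), (fun r => rc r.1); split; [exact: st0 | | ].
    by move=> r _; rewrite adlE; apply/grP/(memv_capl (vW r)).
  by rewrite /= (inj_eq (@rc_inj R)).
exists [seq (weight t p, weight u p) | p <- ps].
have [c cW ->] := joint_dec x; rewrite [X in X \in _]big_seq rpred_sum // => p pps.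
have wp : (weight t p, weight u p) \in [seq (weight t p, weight u p) | p <- ps].
  by apply/mapP; exists p.
apply: (subvP (sumv_seq_sup
  (fun ij : R * R => gr (segment t) ij.1 :&: gr (segment u) ij.2)%VS wp (adj p pps))).
by apply/memv_capP; split; exact: joint_segment (cW p).
Qed.

End Segment.

Section SegmentGood.
Variables (R : realType) (L : lieAlgType R[i]).
Implicit Types (U : {vspace L}) (h x y e : L) (a b t : R) (p : R * R).
Local Notation rc := (real_complex R).

(** Surjectivity for [h1] gives a preimage. Its [h2]-components outside degree [p.2 - 2] are sent to
    degrees other than [p.2], hence to 0, so the component in that degree is already a preimage. *)
Lemma joint_surj e h1 h2 s2 p y : lie h1 h2 = 0 -> spec h2 s2 -> e \in gr h2 2 -> goodh e h1 ->
  1 <= p.1 -> y \in gr h1 p.1 -> y \in gr h2 p.2 ->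
  exists2 x, lie e x = y & x \in gr h1 (p.1 - 2) /\ x \in gr h2 (p.2 - 2).
Proof.
move=> h12 sp2 e2 [_ _ surj_e] p1 y1 y2.
have le1 : -1 <= p.1 - 2 by rewrite lerBrDr (_ : -1 + 2 = 1) // -[2]/(1 + 1) addKr.
have y1' : y \in gr h1 (p.1 - 2 + 2) by rewrite subrK.
have [x x1 exy] := surj_e _ y le1 y1'.
have [d dW def_x] := spec_dec sp2 (adl_gr_stable (a := p.1 - 2) h12) x1.
have us : uniq s2 by case: sp2.
have d2 b := memv_capl (dW b); have d1 b := memv_capr (dW b).
have ed b : b \in s2 -> b != p.2 - 2 -> lie e (d b) = 0.
  move=> sb nb; have edb : lie e (d b) \in gr h2 (2 + b) by apply: gr_lie e2 (d2 b).
  have h22 : lie h2 h2 = 0 by rewrite liexx.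
  have sumU : \sum_(c <- s2) lie e (d c) \in gr h2 p.2.
    have -> : \sum_(c <- s2) lie e (d c) = y by rewrite -exy def_x linear_sum.
    exact: y2.
  have in2 : lie e (d b) \in gr h2 p.2.
    apply: (joint_eigen_mem us _ sumU sb) => c c' _ _ cc'.
    exists (adl h2), (fun a => rc (2 + a)); split; first exact: adl_gr_stable h22.
      by move=> c0 _; rewrite adlE; apply/grP/(gr_lie e2 (d2 c0)).
    by rewrite /= (inj_eq (@rc_inj R)) (inj_eq (addrI 2)).
  apply: gr_unique edb in2 _; apply: contra nb => /eqP <-.
  by rewrite addrC addKr.
have [sb|nsb] := boolP (p.2 - 2 \in s2).
  exists (d (p.2 - 2)); last by split; [exact: d1 | exact: d2].
  by rewrite -exy def_x linear_sum (sum_seq_single us sb).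
exists 0; last by split; exact: mem0v.
rewrite lie0r -exy def_x linear_sum big_seq big1 // => b sb /=; apply: (ed b sb).
by apply: contraNneq nsb => <-.
Qed.

Lemma segment_goodh h1 h2 s1 s2 e t : lie h1 h2 = 0 -> spec h1 s1 -> spec h2 s2 ->
  goodh e h1 -> goodh e h2 -> 0 <= t <= 1 -> goodh e (segment h1 h2 t).
Proof.
move=> h12 sp1 sp2 gd1 gd2 /andP[t0 t1].
have h21 := lie21 h12.
have [e1 inj1 _] := gd1; have [e2 inj2 _] := gd2.
have omt : 0 <= 1 - t by rewrite subr_ge0.
pose ps := [seq (a, b) | a <- s1, b <- s2].
split.
- have := joint_segment (h1 := h1) (h2 := h2) t (p := (2, 2)) (x := e).
  rewrite /weight /= -mulrDl subrK mul1r; apply.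
  by apply/memv_capP; split; [exact: e1 | exact: e2].
- move=> j x lej xj ex.
  have [c cW def_x] := joint_dec h12 sp1 sp2 x.
  have [st1 st2] := segment_stable h12 t j.
  have he (h : L) : e \in gr h 2 -> stable (adl h) (lker (adl e)).
    move=> /grP he z; rewrite !memv_ker !adlE => /eqP ez.
    by rewrite lie_der [lie e h]lieC he ez lie0r addr0 lieNl lieZl ez scaler0 oppr0.
  (* Stability of [U] under both operators puts each joint component of [x] in the kernel of
     [ad e]. *)
  pose U := (gr (segment h1 h2 t) j :&: lker (adl e))%VS.
  have U1 : stable (adl h1) U.
    by move=> z /memv_capP[zj ze]; apply/memv_capP; split; [exact: (st1 z zj) | exact: (he h1 e1 z ze)].
  have U2 : stable (adl h2) U.
    by move=> z /memv_capP[zj ze]; apply/memv_capP; split; [exact: (st2 z zj) | exact: (he h2 e2 z ze)].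
  have xU : \sum_(p <- ps) c p \in U.
    rewrite -def_x; apply/memv_capP; split; first exact: xj.
    by rewrite memv_ker adlE ex.
  have cU := joint_mem sp1 sp2 U1 U2 cW xU.
  rewrite def_x big_seq big1 // => p pps.
  have /memv_capP[cj] := cU p pps; rewrite memv_ker adlE => /eqP ec.
  have [wj|nwj] := eqVneq (weight t p) j; last first.
    exact: gr_unique (joint_segment t (cW p)) cj nwj.
  have [p1|p1] := leP p.1 (-1); first exact: inj1 _ _ p1 (memv_capl (cW p)) ec.
  have [p2|p2] := leP p.2 (-1); first exact: inj2 _ _ p2 (memv_capr (cW p)) ec.
  move: lej; rewrite -wj leNgt => /negP[].
  by apply: convex_gt p1 p2; apply/andP.
move=> j y lej yj.
have [c cW def_y] := joint_dec h12 sp1 sp2 y.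
have [st1 st2] := segment_stable h12 t (j + 2).
have yU : \sum_(p <- ps) c p \in gr (segment h1 h2 t) (j + 2) by rewrite -def_y.
have cU := joint_mem sp1 sp2 st1 st2 cW yU.
suff /memv_imgP[x xj ->] : y \in (adl e @: gr (segment h1 h2 t) j)%VS.
  by exists x; [exact: xj | rewrite adlE].
rewrite def_y big_seq rpred_sum // => p pps.
have [wj|nwj] := eqVneq (weight t p) (j + 2); last first.
  by rewrite (gr_unique (joint_segment t (cW p)) (cU p pps) nwj) mem0v.
have [x <- [x1 x2]] : exists2 x, lie e x = c p & x \in gr h1 (p.1 - 2) /\ x \in gr h2 (p.2 - 2).
  have [c1 c2] := (memv_capl (cW p), memv_capr (cW p)).
  have [p1|p1] := leP 1 p.1; first exact: (joint_surj h12 sp2 e2 gd1 p1 c1 c2).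
  have [p2|p2] := leP 1 p.2.
    have [x ex [x2 x1]] := joint_surj (p := (p.2, p.1)) h21 sp1 e1 gd2 p2 c2 c1.
    exists x; [exact: ex | split; [exact: x1 | exact: x2]].
  have : weight t p < 1 by apply: convex_lt p1 p2; apply/andP.
  by rewrite wj ltNge -lerBlDr (_ : 1 - 2 = -1) ?lej // -[2]/(1 + 1) opprD addNKr.
rewrite -adlE; apply: memv_img.
have := joint_segment (h1 := h1) (h2 := h2) t (p := (p.1 - 2, p.2 - 2)) (x := x).
have -> : weight t (p.1 - 2, p.2 - 2) = j.
  rewrite -[RHS](addrK 2) -wj /weight /= !mulrBr addrACA -opprD.
  by rewrite -[X in _ - X]mulrDl subrK mul1r.
by apply; apply/memv_capP; split; [exact: x1 | exact: x2].
Qed.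

End SegmentGood.

(** * Times at which a weight is an integer *)

Section Crossings.
Variable R : realType.
Implicit Types (a b t u : R) (p : R * R) (m : int).

Lemma weight_sub t u p : weight u p - weight t p = (u - t) * (p.2 - p.1).
Proof. by rewrite /weight; ring. Qed.

Lemma weight_at x p : p.2 != p.1 -> weight ((x - p.1) / (p.2 - p.1)) p = x.
Proof.
move=> np; have nz : p.2 - p.1 != 0 by rewrite subr_eq0.
by have := weight_sub 0 ((x - p.1) / (p.2 - p.1)) p; rewrite subr0 divfK // /weight
  subr0 mul1r mul0r addr0 => /addIr.
Qed.

(** The weight is affine in time. If it left the interval, it would take the integer value at the
    violated end strictly between [t] and [u]. Both ends differ from the weight at [t], so an
    integer weight at time [t] itself does no harm. *)
Lemma weight_no_crossing t u p : t < u ->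
  (forall v m, t < v < u -> weight v p = m%:~R -> p.1 = p.2) ->
  int_below (weight t p) <= weight u p <= int_above (weight t p).
Proof.
move=> tu nocross; have [lt_below _] := int_belowP (weight t p).
have [gt_above _] := int_aboveP (weight t p).
have [eq_p|np] := eqVneq p.2 p.1.
  have -> : weight u p = weight t p.
    by apply/eqP; rewrite -subr_eq0 weight_sub eq_p subrr mulr0.
  by rewrite !ltW.
have tE x : x = weight ((x - p.1) / (p.2 - p.1)) p by rewrite weight_at.
have wE v : v = (weight v p - p.1) / (p.2 - p.1).
  have nz : p.2 - p.1 != 0 by rewrite subr_eq0.
  by rewrite /weight (_ : _ - p.1 = v * (p.2 - p.1)) ?mulfK //; ring.
have cross (m : int) : (weight t p < m%:~R < weight u p) || (weight u p < m%:~R < weight t p) -> False.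
  pose v : R := (m%:~R - p.1) / (p.2 - p.1).
  have wv : weight v p = m%:~R by rewrite -tE.
  move=> tmu; case/eqP: np; rewrite (nocross v m) //.
  case/orP: tmu => /andP[tm mu].
    have p12 : 0 < p.2 - p.1.
      by rewrite -(pmulr_rgt0 _ (_ : 0 < u - t)) ?subr_gt0 // -weight_sub subr_gt0 (lt_trans tm).
    by rewrite [t]wE [u]wE /v !ltr_pM2r ?invr_gt0 // !ltrD2r tm mu.
  have p12 : p.2 - p.1 < 0.
    by rewrite -(pmulr_rlt0 _ (_ : 0 < u - t)) ?subr_gt0 // -weight_sub subr_lt0 (lt_trans tm).
  by rewrite [t]wE [u]wE /v !ltr_nM2r ?invr_lt0 // !ltrD2r tm mu.
apply/andP; split; rewrite leNgt; apply/negP => lt_w.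
  by apply: (cross (Num.ceil (weight t p) - 1)); apply/orP; right; rewrite lt_below lt_w.
by apply: (cross (Num.floor (weight t p) + 1)); apply/orP; left; rewrite gt_above lt_w.
Qed.

(** On the unit interval a weight is bounded by [|p.1| + |p.2|], hence by [B] for all pairs at once,
    and a nonconstant weight takes each integer value at only one time. *)
Lemma integer_times (ps : seq (R * R)) : exists F : seq R,
  forall v p m, p \in ps -> 0 <= v <= 1 -> weight v p = m%:~R -> p.1 != p.2 -> v \in F.
Proof.
pose x : R := \sum_(p <- ps) (`|p.1| + `|p.2|); pose B := Num.bound x.
pose ms : seq int := [seq k%:Z - B%:Z | k <- iota 0 (B + B).+1].
exists [seq (m%:~R - p.1) / (p.2 - p.1) | p <- ps, m <- ms] => v p m pps v01 wv np.
apply/allpairsP; exists (p, m); split=> //=; last first.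
  have nz : p.2 - p.1 != 0 by rewrite subr_eq0 eq_sym.
  by rewrite -wv /weight (_ : _ - p.1 = v * (p.2 - p.1)) ?mulfK //; ring.
have x_ge : `|p.1| + `|p.2| <= x.
  by rewrite /x (big_rem p) //= lerDl sumr_ge0 // => q _; rewrite addr_ge0.
have ltB : x < B%:R by apply: archi_boundP; rewrite sumr_ge0 // => q _; rewrite addr_ge0.
have mB : `|m%:~R| < B%:R :> R.
  apply: le_lt_trans ltB; apply: le_trans x_ge; rewrite -wv /weight.
  case/andP: v01 => v0 v1; apply: le_trans (ler_normD _ _) _; rewrite !normrM.
  by apply: lerD; rewrite -[leRHS]mul1r; apply: ler_wpM2r => //; rewrite ger0_norm ?subr_ge0 // lerBlDr lerDl.
have {}mB : (`|m| < B%:Z)%R.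
  by rewrite -(ltr_int R) intr_norm.
apply/mapP; exists (absz (m + B%:Z)).
  rewrite mem_iota /= add0n; move: mB; lia.
move: mB; lia.
Qed.

(** The defaults in [head 1 T = 0] and [last 0 T = 1] rule out the empty list. Consecutive times of
    the sorted list enclose no other integer time. *)
Lemma crossing_times (ps : seq (R * R)) : exists T : seq R,
  [/\ sorted <%R T, head 1 T = 0, last 0 T = 1, {in T, forall t, 0 <= t <= 1} &
    forall i p, (i.+1 < size T)%N -> p \in ps ->
      int_below (weight (nth 0 T i) p) <= weight (nth 0 T i.+1) p <= int_above (weight (nth 0 T i) p)].
Proof.
have [F FP] := integer_times ps.
pose T : seq R := sort <=%R (undup (0 :: 1 :: [seq t <- F | 0 <= t <= 1])).
have memT t : (t \in T) = [|| t == 0, t == 1 | (0 <= t <= 1) && (t \in F)].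
  by rewrite mem_sort mem_undup !inE mem_filter.
have T01 : {in T, forall t, 0 <= t <= 1}.
  by move=> t; rewrite memT => /or3P[/eqP->|/eqP->|/andP[]//]; rewrite ?lexx ler01.
have ltT : sorted <%R T by rewrite lt_sorted_uniq_le sort_uniq undup_uniq sort_sorted //; apply: le_total.
have T_0 : 0 \in T by rewrite memT eqxx.
have T_1 : 1 \in T by rewrite memT eqxx orbT.
clearbody T; have lt_nth i k : (i < k)%N -> (k < size T)%N -> nth 0 T i < nth 0 T k.
  by move=> ik kT; apply: (sorted_ltn_nth lt_trans) => //; rewrite inE; apply: ltn_trans kT.
have sT : (0 < size T)%N by case: (T) T_0.
exists T; split=> //.
- have := T_0; rewrite -index_mem => iT; have n0 := nth_index 0 T_0.
  have -> : head 1 T = nth 0 T 0 by case: (T) sT.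
  apply/eqP; rewrite eq_le; have /andP[-> _] := T01 _ (mem_nth 0 sT); rewrite andbT leNgt.
  apply/negP; rewrite -[X in X < _]n0; case: (index 0 T) iT => [|k] kT; first by rewrite ltxx.
  by rewrite ltNge (ltW (lt_nth 0%N k.+1 _ kT)).
- have := T_1; rewrite -index_mem => iT; have n1 := nth_index 0 T_1.
  have lT : ((size T).-1 < size T)%N by rewrite prednK.
  rewrite -nth_last; apply/eqP; rewrite eq_le; have /andP[_ ->] := T01 _ (mem_nth 0 lT).
  rewrite leNgt /=; apply/negP; rewrite -[X in _ < X]n1.
  have : (index (1%R : R) T <= (size T).-1)%N by rewrite -ltnS prednK.
  rewrite leq_eqVlt => /orP[/eqP->|ik]; first by rewrite ltxx.
  by rewrite ltNge (ltW (lt_nth _ _ ik lT)).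
move=> i p iT pps; have iT' : (i < size T)%N by apply: ltnW.
apply: weight_no_crossing; first exact: lt_nth.
move=> v m /andP[tv vu] wv; apply/eqP; apply: contraT => np.
have /andP[t0 _] := T01 _ (mem_nth 0 iT'); have /andP[_ u1] := T01 _ (mem_nth 0 iT).
have v01 : 0 <= v <= 1 by rewrite (le_trans t0 (ltW tv)) (le_trans (ltW vu) u1).
have vT : v \in T by rewrite memT v01 (FP v p m) ?orbT.
have kT : (index v T < size T)%N by rewrite index_mem.
move: tv vu; rewrite -(nth_index 0 vT) => tv vu.
have [ki|ik] := leqP (index v T) i.
  move: tv; rewrite ltNge; move: ki; rewrite leq_eqVlt => /orP[/eqP->|ki]; first by rewrite lexx.
  by rewrite (ltW (lt_nth _ _ ki iT')).
move: vu; rewrite ltNge; move: ik; rewrite leq_eqVlt => /orP[/eqP->|ik]; first by rewrite lexx.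
by rewrite (ltW (lt_nth _ _ ik kT)).
Qed.

End Crossings.

Lemma conjugate_gr (R : realType) (L : lieAlgType R[i]) (N : nat) (G : set 'M[R[i]]_N)
    (phi : 'Hom(L, 'M[R[i]]_N)) (h : L) (g : 'End(L)) :
  closed_subgroup G -> lie_algebra_of G phi -> adjoint G phi g ->
  conjugate G phi (gr h) (gr (g h)) /\ conjugate G phi (gr (g h)) (gr h).
Proof.
move=> cG lie_G; have half k (x : L) : adjoint G phi k -> conjugate G phi (gr x) (gr (k x)).
  move=> ak; have [A GA def_k] := ak; exists A => // j; rewrite -def_k.
  have [k' ak' [kK k'K]] := adjointV cG lie_G ak.
  have act_lie := adjoint_lie cG lie_G.
  apply/eqP; rewrite eqEsubv; apply/andP; split; apply/subvP=> y.
    by case/memv_imgP=> z zj ->; exact: (act_gr act_lie ak zj).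
  move=> yj; rewrite -[y]k'K; apply: memv_img.
  have := act_gr act_lie ak' yj.
  by rewrite kK.
move=> ag; split; first exact: half.
have [k ak [gK kK]] := adjointV cG lie_G ag.
by rewrite -{2}[h]gK; apply: half.
Qed.

Theorem theorem2 (R : realType) (L : lieAlgType R[i]) (N : nat)
    (G : set 'M[R[i]]_N) (phi : 'Hom(L, 'M[R[i]]_N))
    (e : L) (Gamma Gamma' : R -> {vspace L})
    (ss_L : lie_semisimple L)
    (ss_G : connected_semisimple_group G)
    (lie_G : lie_algebra_of G phi)
    (nil_e : lie_nilpotent e)
    (good_Gamma : good_grading e Gamma)
    (good_Gamma' : good_grading e Gamma') :
  exists (n : nat) (c : nat -> R -> {vspace L}),
    [/\ (1 <= n)%N /\ (forall i : nat, (1 <= i <= n)%N -> good_grading e (c i)),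
        conjugate G phi Gamma (c 1%N),
        (forall i : nat, (1 <= i < n)%N -> adjacent (c i) (c i.+1)) &
        conjugate G phi (c n) Gamma'].
Proof.
have [cG _ _] := ss_G.
have [h [s [sp gd ->]]] := good_goodh ss_L good_Gamma.
have [h' [s' [sp' gd' ->]]] := good_goodh ss_L good_Gamma'.
have act1 := adjoint1 cG lie_G; have actM := adjointM cG lie_G.
have actV := adjointV cG lie_G; have act_lie := adjoint_lie cG lie_G.
have act_exp (h0 m : L) (a : R) : a != 0 -> m \in gr h0 a ->
    exists2 g, adjoint G phi g & forall x (U : {vspace L}),
      (forall k, iter k.+2 (lie m) x \in U) -> g x - x - lie m x \in U.
  move=> nz_a /grP hm; apply: (adjoint_exp cG lie_G _ hm).
  by rewrite -(rmorph0 (real_complex R)) (inj_eq (@rc_inj R)).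
have [g [g' [[ag ge] [ag' g'e] gg']]] :=
  good_commuting ss_L act1 actM actV act_lie act_exp sp gd sp' gd'.
have sp1 := act_spec actV act_lie ag sp; have gd1 := act_goodh actV act_lie ag ge gd.
have sp2 := act_spec actV act_lie ag' sp'; have gd2 := act_goodh actV act_lie ag' g'e gd'.
have [T [sortT T0 T1 T01 adjT]] := crossing_times [seq (a, b) | a <- s, b <- s'].
(* The chain is numbered from 1 and the list of times from 0. *)
pose c i := gr (segment (g h) (g' h') (nth 0 T i.-1)).
have T_gt0 : (0 < size T)%N by case: (T) T0 => //= /eqP; rewrite oner_eq0.
exists (size T), c; split.
- split; first exact: T_gt0.
  move=> i /andP[i_gt0 iT].
  have iT' : (i.-1 < size T)%N by rewrite prednK.
  apply: (goodh_good (segment_spec gg' sp1 sp2 _)).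
  exact: segment_goodh gg' sp1 sp2 gd1 gd2 (T01 _ (mem_nth 0 iT')).
- have -> : c 1%N = gr (g h) by rewrite /c /= nth0 (_ : head 0 T = 0) ?segment0 //; case: (T) T0.
  exact: (proj1 (conjugate_gr h cG lie_G ag)).
- move=> i /andP[i_gt0 iT]; apply: (segment_adjacent gg' sp1 sp2) => p pps.
  by have := adjT i.-1 p; rewrite prednK //; apply.
have -> : c (size T) = gr (g' h') by rewrite /c nth_last T1 segment1.
exact: (proj2 (conjugate_gr h' cG lie_G ag')).
Qed.
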